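(* There is a randomized algorithm running in $\tilde{O}(n^2)$ time that, given any distance function $d$ and any point set $P=\{p_1,\ldots,p_n\}$ in general position, constructs a directed graph $G=(P,E)$ which, with high probability, is navigable and whose average out-degree is at most $c\log n$ times the average out-degree of the sparsest navigable graph for $P$, for a fixed constant $c$.
   Context: A distance function on a finite point set $P=\{p_1,\ldots,p_n\}$ is any function $d:P\times P\to\mathbb{R}_{\ge 0}$ with $d(p_i,p_i)=0$ for all $i$ and $d(p_i,p_j)=d(p_j,p_i)>0$ for $i\neq j$; the triangle inequality is not assumed. $P$ is in general position if its points are distinct and $d(p_i,p_j)\neq d(p_i,p_k)$ for all $i$ and all $j\neq k$. A directed graph $G=(P,E)$ is navigable if for all $p_i\neq p_j$ in $P$ there exists $p_k\in P$ with $(p_i,p_k)\in E$ and $d(p_k,p_j)<d(p_i,p_j)$. The distance $d$ is assumed to be evaluable in $O(1)$ time. $\tilde{O}(m)$ means $O(m\log^{c'} m)$ for a fixed constant $c'$. ''With high probability'' means with probability at least $1-1/n^{c''}$ for an arbitrarily large constant $c''$. *)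

(* Defs.v *)
From mathcomp Require Import all_boot all_order all_algebra.
From mathcomp Require Import reals exp.

Set Implicit Arguments.
Unset Strict Implicit.
Unset Printing Implicit Defensive.

Import Order.TTheory GRing.Theory Num.Theory.
Local Open Scope ring_scope.

(* The points p_1, ..., p_n are identified with the elements of 'I_n. *)
Section Graphs.
Variables (R : realType) (n : nat) (d : 'I_n -> 'I_n -> R).

Definition distance_function : Prop :=
  [/\ forall i, d i i = 0,
      forall i j, d i j = d j i
    & forall i j, i != j -> 0 < d i j].

(* The points are distinct by construction. *)
Definition general_position : Prop :=
  forall i j k, j != k -> d i j != d i k.

Definition digraph := {set 'I_n * 'I_n}.

Definition navigable (G : digraph) : bool :=
  [forall i, forall j, (i != j) ==>
    [exists k, ((i, k) \in G) && (d k j < d i j)]].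

Definition outdeg (G : digraph) (i : 'I_n) : nat :=
  #|[set k | (i, k) \in G]|.

Definition avg_outdeg (G : digraph) : R :=
  (\sum_(i < n) (outdeg G i)%:R) / n%:R.

Definition sparsest_navigable (H : digraph) : Prop :=
  navigable H /\
  forall H' : digraph, navigable H' -> avg_outdeg H <= avg_outdeg H'.

End Graphs.

(* Randomized computations whose random choices are finitely many draws:
   [Draw k] picks i uniformly in {0, ..., m} and continues as [k i]. *)
Inductive rtree (A : Type) : Type :=
| Result of A
| Draw (m : nat) of ('I_m.+1 -> rtree A).

Fixpoint Pr (R : realType) (A : Type) (E : A -> bool) (t : rtree A) : R :=
  match t with
  | Result a => (E a)%:R
  | Draw m k => (\sum_(i < m.+1) Pr R E (k i)) / m.+1%:R
  end.

Fixpoint surely (A : Type) (E : A -> bool) (t : rtree A) : Prop :=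
  match t with
  | Result a => E a
  | Draw m k => forall i, surely E (k i)
  end.

(* A randomized word RAM with a distance oracle, programmed in a structured
   imperative language.  A program names finitely many arrays of words and
   arrays of reals, all indexed by words; a scalar is one array cell.
   Distances can be queried, stored and compared, but there is no arithmetic
   on reals, so no information can be packed into them. *)
Inductive wop := OAdd | OSub | OMul | ODiv | OMod.

Inductive wexp :=
| WConst of nat
| WLoad (a : nat) of wexp
| WOp of wop & wexp & wexp.

Inductive rexp :=
| RLoad (a : nat) of wexp
| RDist of wexp & wexp.

Inductive test :=
| TLt of wexp & wexp
| TEq of wexp & wexp
| TRLt of rexp & rexp
| TNot of test
| TAnd of test & test.

(* The first two arguments of [CSet], [CSetR] and [CRand] designate the cell
   that is assigned; [CRand a e b] assigns a uniform element of {0, ..., b}. *)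
Inductive cmd :=
| CSet (a : nat) of wexp & wexp
| CSetR (a : nat) of wexp & rexp
| CRand (a : nat) of wexp & wexp
| CSeq of cmd & cmd
| CIf of test & cmd & cmd
| CWhile of test & cmd.

Record state (R : Type) :=
  State { word_arrays : nat -> nat -> nat; real_arrays : nat -> nat -> R }.

Definition upd (V : Type) (m : nat -> nat -> V) (a i : nat) (v : V) :
    nat -> nat -> V :=
  fun a' i' => if (a' == a) && (i' == i) then v else m a' i'.

Section Machine.
(* Words range over {0, ..., W - 1}. *)
Variables (R : realType) (W : nat) (dist : nat -> nat -> R).
Implicit Types s : state R.

Definition eval_op (o : wop) (x y : nat) : nat :=
  match o with
  | OAdd => x + y
  | OSub => x - y (* truncated at 0 *)
  | OMul => x * y
  | ODiv => x %/ y
  | OMod => x %% y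
  end%N.

Fixpoint weval s (e : wexp) : nat :=
  match e with
  | WConst c => c %% W
  | WLoad a e1 => word_arrays s a (weval s e1)
  | WOp o e1 e2 => eval_op o (weval s e1) (weval s e2) %% W
  end%N.

Definition reval s (x : rexp) : R :=
  match x with
  | RLoad a e => real_arrays s a (weval s e)
  | RDist e1 e2 => dist (weval s e1) (weval s e2)
  end.

Fixpoint teval s (t : test) : bool :=
  match t with
  | TLt e1 e2 => (weval s e1 < weval s e2)%N
  | TEq e1 e2 => weval s e1 == weval s e2
  | TRLt x y => reval s x < reval s y
  | TNot t1 => ~~ teval s t1
  | TAnd t1 t2 => teval s t1 && teval s t2
  end.

Definition set_word s (a i v : nat) : state R :=
  State (upd (word_arrays s) a i v) (real_arrays s).

Definition set_real s (a i : nat) (v : R) : state R :=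
  State (word_arrays s) (upd (real_arrays s) a i v).

(* [run T k s] executes the stack of commands [k] for at most [T] time units,
   with result [None] when time runs out.  One unit is charged per executed
   command or loop test; the expressions evaluated therein have a size bounded
   by the program, so that each of them takes O(1) operations and queries. *)
Fixpoint run (T : nat) (k : seq cmd) (s : state R) : rtree (option (state R)) :=
  match k, T with
  | [::], _ => Result (Some s)
  | _ :: _, 0%N => Result None
  | c :: k', T'.+1 =>
    match c with
    | CSet a e v => run T' k' (set_word s a (weval s e) (weval s v))
    | CSetR a e x => run T' k' (set_real s a (weval s e) (reval s x))
    | CRand a e b =>
      Draw (fun i : 'I_(weval s b).+1 =>
              run T' k' (set_word s a (weval s e) i))
    | CSeq c1 c2 => run T' (c1 :: c2 :: k') s
    | CIf t c1 c2 => run T' ((if teval s t then c1 else c2) :: k') s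
    | CWhile t c1 => run T' (if teval s t then c1 :: c :: k' else k') s
    end
  end.

End Machine.

(* Words of O(log n) bits, large enough to hold n. *)
Definition word_bound (K n : nat) : nat :=
  (2 ^ (K.+1 * (up_log 2 n).+1))%N.

(* Cell 0 of word array 0 holds n; everything else is 0. *)
Definition init_state (R : realType) (n : nat) : state R :=
  State (upd (fun _ _ => 0%N) 0 0 n) (fun _ _ => 0).

(* Junk value 0 when an argument is not the index of a point. *)
Definition oracle (R : realType) (n : nat) (d : 'I_n -> 'I_n -> R)
    (a b : nat) : R :=
  match insub a : option 'I_n, insub b : option 'I_n with
  | Some i, Some j => d i j
  | _, _ => 0
  end.

(* The output is the adjacency matrix, stored row by row in word array 1. *)
Definition output_graph (R : realType) (n : nat) (s : state R) : digraph n :=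
  [set e : 'I_n * 'I_n | word_arrays s 1 (e.1 * n + e.2)%N != 0%N].

Definition execute (R : realType) (K : nat) (prog : cmd) (n : nat)
    (d : 'I_n -> 'I_n -> R) (T : nat) : rtree (option (state R)) :=
  run (word_bound K n) (oracle d) T [:: prog] (init_state R n).

Definition halts_within (R : realType) (K : nat) (prog : cmd) (n : nat)
    (d : 'I_n -> 'I_n -> R) (T : nat) : Prop :=
  surely isSome (execute K prog d T).

Definition Pr_output (R : realType) (K : nat) (prog : cmd) (n : nat)
    (d : 'I_n -> 'I_n -> R) (T : nat) (E : digraph n -> bool) : R :=
  Pr R (fun o => if o is Some s then E (output_graph n s) else false)
     (execute K prog d T).

(* T(n) = O(f(n) log^c' f(n)) *)
Definition soft_O (R : realType) (c' : nat) (T f : nat -> nat) : Prop :=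
  exists (C : R) (n0 : nat), forall n : nat, (n0 <= n)%N ->
    (T n)%:R <= C * (f n)%:R * ln ((f n)%:R : R) ^+ c'.

(* Main.v *)
(* Let rk_j be the ranking of the points by their distance to j.  A graph is
   navigable iff the out-neighbourhood of every i hits all the sets
   {k | rk_j(k) < rk_j(i)}, j <> i, so each i is a set cover instance in which
   j is covered by a prefix, of length rk_j(i), of the sorted list of j.

   The optimum of each instance is guessed to be at most g = 1, 2, 4, ....
   Given g, put L = ceil(n / g).  One additional instance, common to all i,
   asks to hit the prefix of length L of every list; it has a fractional cover
   of value n / L <= g, and it takes care of the pairs with rk_j(i) > L.  Only
   n L pairs (i, j) with rk_j(i) <= L remain, all with short prefixes.

   An instance is solved in O(log n) rounds.  A round draws 2 g h uncovered
   elements with h = Theta(log n), then scans the points once and picks each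
   point which covers at least h samples not covered by the previous picks.
   Hence there are at most 2 g picks, and if there is a fractional cover of
   value g then at most g h samples stay uncovered.  A set of picks which
   covers less than 1 / 16 of the uncovered elements contains half of the
   samples with probability at most 2 ^ (- 2 g h), so that by a union bound
   over the (n + 1) ^ (2 g) sets of picks the number of uncovered elements
   shrinks by a factor 15 / 16 with high probability.  The failure
   probability affects h but not the number of picks, which is why the
   approximation factor does not depend on it.

   Time: enumerating the prefixes of the samples costs 2 g h L = O(n h) per
   round, and testing the uncovered elements after each of the O(g log n)
   picks costs O(n L g log n) = O(n ^ 2 log n) over all the instances. *)
Require Import Defs.
From mathcomp Require Import all_boot all_order all_algebra.
From mathcomp Require Import reals exp.
From mathcomp Require Import zify ring lra.

Set Implicit Arguments.
Unset Strict Implicit.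
Unset Printing Implicit Defensive.

Import Order.TTheory GRing.Theory Num.Theory.
Local Open Scope ring_scope.

(** * Ranks in a finite total order *)

(** The time bound has to hold on every run and the quality only with high probability, yet both are
    properties of one execution tree. The program logic below therefore carries two credits through
    the commands: time, and a real number which bounds the probability of ending in a rejected
    memory. A draw may distribute the failure credit unevenly over its outcomes as long as the
    average does not grow, so the union bound of a round takes the form of a potential, a sum over
    the bad families of picks, which does not increase on average along the draws. A bad family that
    covers half of the samples has a term at least 1 in it, and a credit of 1 pays for any outcome.
    Hence the many invariants of the form [1 <= phi \/ ...]: after a failure only time and the shape
    of the memory remain to be controlled. The fraction 1/16 fits this potential: a sample covered
    with probability below 1/16 multiplies [16 ^ hits] by less than 2 on average, while hits on half
    of [M] samples give [16 ^ (M / 2) = 4 ^ M], so the failure probability of a fixed family is at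
    most [2 ^ M / 4 ^ M]. *)

Lemma sub_count_lt (T : eqType) (p q : pred T) (s : seq T) (x : T) :
  subpred p q -> x \in s -> q x -> ~~ p x -> (count p s < count q s)%N.
Proof.
move=> pq xs qx px.
rewrite -[X in (_ < X)%N]size_filter -(count_predC p (filter q s)) !count_filter.
rewrite (@eq_count _ _ p) => [|y /=]; last first.
  by case py: (p y) => //=; rewrite pq.
rewrite -[X in (X < _)%N]addn0 ltn_add2l -has_count.
by apply/hasP; exists x => //=; rewrite px qx.
Qed.

Section Rank.
Local Open Scope nat_scope.
Variables (lt : rel nat) (n : nat).
Hypotheses (lt_irr : irreflexive lt) (lt_trans : transitive lt).
Hypothesis lt_total : forall x y, x < n -> y < n -> x != y -> lt x y || lt y x.

Lemma count_lt_mono (s : seq nat) x y :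
  x \in s -> lt x y -> count (lt^~ x) s < count (lt^~ y) s.
Proof.
move=> xs xy; apply: (@sub_count_lt _ _ _ _ x) => //=; last by rewrite lt_irr.
by move=> z zx; apply: lt_trans zx xy.
Qed.

Lemma count_ltE (s : seq nat) x y : {in s, forall z, z < n} ->
  x \in s -> y < n -> (count (lt^~ x) s < count (lt^~ y) s) = lt x y.
Proof.
move=> sn xs yn; apply/idP/idP; last exact: count_lt_mono.
apply: contraLR => xy; rewrite -leqNgt; case: (eqVneq x y) => [->//|ne].
have /orP[|yx] := lt_total (sn _ xs) yn ne; first by rewrite (negPf xy).
by apply: sub_count => z zy; apply: lt_trans zy yx.
Qed.

(** Distinct elements have distinct ranks, all below [size s]; being as many as the interval has
    elements, they fill it. *)
Lemma rank_perm (s : seq nat) : uniq s -> {in s, forall z, z < n} ->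
  perm_eq [seq count (lt^~ x) s | x <- s] (iota 0 (size s)).
Proof.
move=> us sn; set r := fun x => _.
have ur : uniq (map r s).
  rewrite map_inj_in_uniq // => x y xs ys exy; apply/eqP; apply: contraT => ne.
  have /orP[] := lt_total (sn _ xs) (sn _ ys) ne.
    by move=> /(count_lt_mono xs); rewrite -/(r x) -/(r y) exy ltnn.
  by move=> /(count_lt_mono ys); rewrite -/(r x) -/(r y) exy ltnn.
have sr : {subset map r s <= iota 0 (size s)}.
  move=> _ /mapP[x xs ->]; rewrite mem_iota add0n /= -(count_predT s).
  by apply: (@sub_count_lt _ _ _ _ x) => //; rewrite lt_irr.
apply: uniq_perm; rewrite ?iota_uniq //.
by have [] := uniq_min_size ur sr; rewrite ?size_map ?size_iota.
Qed.

Lemma rank_surj (s : seq nat) r : uniq s -> {in s, forall z, z < n} ->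
  r < size s -> exists2 x, x \in s & count (lt^~ x) s = r.
Proof.
move=> us sn rs; have : r \in iota 0 (size s) by rewrite mem_iota.
by rewrite -(perm_mem (rank_perm us sn)) => /mapP[x xs ->]; exists x.
Qed.

Lemma rank_inj (s : seq nat) x y : {in s, forall z, z < n} -> x \in s -> y \in s ->
  count (lt^~ x) s = count (lt^~ y) s -> x = y.
Proof.
move=> sn xs ys exy; apply/eqP; apply: contraT => ne.
have /orP[] := lt_total (sn _ xs) (sn _ ys) ne.
  by move=> /(count_lt_mono xs); rewrite exy ltnn.
by move=> /(count_lt_mono ys); rewrite exy ltnn.
Qed.

(* [w] is the width of the sorted blocks at some stage of a bottom-up merge
   sort of [0, ..., n - 1], and [bpos w x] is the position of [x] then. *)
Definition block (w b : nat) : seq nat := [seq y <- iota 0 n | y %/ w == b].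

Definition brank (w x : nat) : nat := count (lt^~ x) (block w (x %/ w)).

Definition bpos (w x : nat) : nat := x %/ w * w + brank w x.

(** The block to be merged with block [b]: [b + 1] for [b] even, [b - 1] for [b] odd. *)
Definition sibling (b : nat) : nat := b + 1 - 2 * (b %% 2).

Lemma block_uniq w b : uniq (block w b).
Proof. exact: filter_uniq (iota_uniq _ _). Qed.

Lemma mem_block w b y : (y \in block w b) = (y < n) && (y %/ w == b).
Proof. by rewrite mem_filter mem_iota andbC. Qed.

Lemma block_ltn w b : {in block w b, forall z, z < n}.
Proof. by move=> z; rewrite mem_block => /andP[]. Qed.

Lemma size_block w b : 0 < w -> size (block w b) = minn w (n - b * w).
Proof.
move=> w0; rewrite /block size_filter; elim: n => [|k IH].
  by rewrite sub0n minn0.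
rewrite -addn1 iotaD add0n count_cat IH /= addn0.
have -> : (k %/ w == b) = (b * w <= k < b * w + w).
  by rewrite eqn_leq -ltnS ltn_divLR // leq_divRL // mulSn addnC andbC.
by lia.
Qed.

Lemma brank1 x : brank 1 x = 0.
Proof.
apply/eqP; rewrite -leqn0 leqNgt -has_count; apply/hasP => -[y].
rewrite mem_block !divn1 => /andP[_ /eqP ->].
by rewrite lt_irr.
Qed.

(** The block of [x] of width [2 * w] is the disjoint union of its block of width [w] and the
    sibling, so merging only requires one count in the sibling per element. *)
Lemma brank_double w x : 0 < w ->
  brank (2 * w) x = brank w x + count (lt^~ x) (block w (sibling (x %/ w))).
Proof.
move=> w0; rewrite /brank /block !count_filter -count_predUI.
rewrite [X in _ = _ + X](@eq_count _ _ pred0) ?count_pred0 ?addn0; last first.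
  move=> y /=; rewrite /sibling; case: eqP => [->|]; rewrite ?andbF ?andbT //=.
  by case: eqP; rewrite ?andbF //; lia.
apply: eq_count => y /=; rewrite -andb_orr; congr (_ && _).
rewrite /sibling mulnC !divnMA.
move: (y %/ w) (x %/ w) => a b. lia.
Qed.

Lemma brank_last w x : x < n -> n <= w -> brank w x = count (lt^~ x) (iota 0 n).
Proof.
move=> xn nw; rewrite /brank /block (divn_small (leq_trans xn nw)).
congr count; apply/all_filterP/allP => y; rewrite mem_iota add0n => /= yn.
by rewrite divn_small ?(leq_trans yn).
Qed.

Lemma brank_lt w x : 0 < w -> x < n -> brank w x < minn w (n - x %/ w * w).
Proof.
move=> w0 xn; rewrite -size_block // -(count_predT (block _ _)).
by apply: (@sub_count_lt _ _ _ _ x); rewrite ?lt_irr // mem_block xn /=.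
Qed.

Lemma bpos_lt w x : 0 < w -> x < n -> bpos w x < n.
Proof. by move=> w0 xn; have := brank_lt w0 xn; rewrite /bpos; lia. Qed.

(** A rank stays below [w], so the quotient of the position by [w] gives back the block, and the
    remainder gives back the rank. *)
Lemma bpos_inj w x y : 0 < w -> x < n -> y < n -> bpos w x = bpos w y -> x = y.
Proof.
move=> w0 xn yn e.
have rx := brank_lt w0 xn; have ry := brank_lt w0 yn.
have eb : x %/ w = y %/ w.
  have := congr1 (divn^~ w) e; rewrite /bpos /= !divnMDl //.
  rewrite [brank w x %/ w]divn_small ?[brank w y %/ w]divn_small ?addn0 //.
    exact: leq_trans ry (geq_minl _ _).
  exact: leq_trans rx (geq_minl _ _).
apply: (@rank_inj (block w (x %/ w))); rewrite ?mem_block ?xn ?yn ?eb ?eqxx //.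
  exact: block_ltn.
by move: e; rewrite /bpos /brank eb => /addnI.
Qed.

End Rank.

(** * A program logic with time and failure credits *)

Lemma Pr_ge0 (R : realType) (A : Type) (E : A -> bool) (t : rtree A) :
  0 <= Pr R E t.
Proof.
elim: t => [a|m k IH] /=; first by rewrite ler0n.
by rewrite divr_ge0 ?ler0n ?sumr_ge0.
Qed.

Definition memory : Type := nat -> nat -> nat.

Section Logic.
Local Open Scope nat_scope.
Variables (R : realType) (W : nat) (dist : nat -> nat -> R).
Variable E : memory -> bool.

(* Only the word arrays are used: the real arrays stay null. *)
Definition mem_state (m : memory) : state R := State m (fun _ _ => 0%R).

Definition accept (o : option (state R)) : bool :=
  if o is Some s then E (word_arrays s) else false.

Fixpoint ev (m : memory) (e : wexp) : nat :=
  match e with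
  | WConst c => c
  | WLoad a e1 => m a (ev m e1)
  | WOp o e1 e2 => eval_op o (ev m e1) (ev m e2)
  end.

(** No constant or result of an operation wraps around modulo [W], so the machine computes as over
    the unbounded naturals. Loads return the stored word unreduced. *)
Fixpoint fits (m : memory) (e : wexp) : Prop :=
  match e with
  | WConst c => c < W
  | WLoad a e1 => fits m e1
  | WOp o e1 e2 => [/\ fits m e1, fits m e2 & eval_op o (ev m e1) (ev m e2) < W]
  end.

Definition rev_exp (m : memory) (x : rexp) : R :=
  match x with
  | RLoad _ _ => 0%R
  | RDist e1 e2 => dist (ev m e1) (ev m e2)
  end.

Definition rfits (m : memory) (x : rexp) : Prop :=
  match x with
  | RLoad _ e => fits m e
  | RDist e1 e2 => fits m e1 /\ fits m e2
  end.

Fixpoint tev (m : memory) (t : test) : bool :=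
  match t with
  | TLt e1 e2 => ev m e1 < ev m e2
  | TEq e1 e2 => ev m e1 == ev m e2
  | TRLt x y => (rev_exp m x < rev_exp m y)%R
  | TNot t1 => ~~ tev m t1
  | TAnd t1 t2 => tev m t1 && tev m t2
  end.

Fixpoint tfits (m : memory) (t : test) : Prop :=
  match t with
  | TLt e1 e2 | TEq e1 e2 => fits m e1 /\ fits m e2
  | TRLt x y => rfits m x /\ rfits m y
  | TNot t1 => tfits m t1
  | TAnd t1 t2 => tfits m t1 /\ tfits m t2
  end.

Lemma weval_ev m e : fits m e -> weval W (mem_state m) e = ev m e.
Proof.
elim: e => [c|a e IH|o e1 IH1 e2 IH2] /=.
- exact: modn_small.
- by move=> /IH ->.
- by case=> /IH1 -> /IH2 -> /modn_small.
Qed.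

Lemma teval_tev m t : tfits m t -> teval W dist (mem_state m) t = tev m t.
Proof.
have rE x : rfits m x -> reval W dist (mem_state m) x = rev_exp m x.
  by case: x => [a e|e1 e2] //= [f1 f2]; rewrite !weval_ev.
elim: t => [e1 e2|e1 e2|x y|t IH|t1 IH1 t2 IH2] /=.
- by case=> f1 f2; rewrite !weval_ev.
- by case=> f1 f2; rewrite !weval_ev.
- by case=> f1 f2; rewrite !rE.
- by move=> /IH ->.
- by case=> /IH1 -> /IH2 ->.
Qed.

(* [tau] is a time credit and [phi] a failure credit: started with at least
   [tau] time units the commands [k] terminate, and the result is accepted
   with probability at least [1 - phi]. *)
Definition ok (tau : nat) (phi : R) (k : seq cmd) (m : memory) : Prop :=
  forall T, tau <= T ->
    surely isSome (run W dist T k (mem_state m)) /\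
    (1 - phi <= Pr R accept (run W dist T k (mem_state m)))%R.

(** A Hoare triple in continuation-passing style: acceptance is only known at the end of the
    complete run, so [c] is judged through all its continuations [k]. Both remaining credits are
    arguments of [Q] since they may depend on the draws; [d] is time set aside for [k]. *)
Definition spec (c : cmd) (m : memory) (phi : R) (tau : nat)
    (Q : memory -> R -> nat -> Prop) : Prop :=
  forall k d, (forall m' phi' tau', Q m' phi' tau' -> ok (tau' + d) phi' k m') ->
    ok (tau + d) phi (c :: k) m.

(** A failure credit of at least 1 pays for any final memory, because [1 - phi] is then at most
    0. *)
Lemma ok_nil m phi tau : E m /\ (0 <= phi)%R \/ (1 <= phi)%R -> ok tau phi [::] m.
Proof.
move=> H T _; have -> : run W dist T [::] (mem_state m) = Result (Some (mem_state m)).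
  by case: T.
split=> //=; case: H => [[-> H]|H]; first by rewrite lerBlDr lerDl.
by apply: le_trans (ler0n _ _); rewrite subr_le0.
Qed.

Lemma spec_ok c m phi tau (Q : memory -> R -> nat -> Prop) :
  spec c m phi tau Q ->
  (forall m' phi' tau', Q m' phi' tau' -> E m' /\ (0 <= phi')%R \/ (1 <= phi')%R) ->
  ok tau phi [:: c] m.
Proof.
move=> H HQ; rewrite -[tau]addn0; apply: H => m' phi' tau' /HQ.
exact: ok_nil.
Qed.

Lemma spec_frame c m phi tau d (Q : memory -> R -> nat -> Prop) :
  spec c m phi tau Q ->
  spec c m phi (tau + d) (fun m' phi' t => exists2 tau', t = tau' + d & Q m' phi' tau').
Proof.
move=> H k d' Hk; rewrite -addnA; apply: H => m' phi' tau' HQ.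
by rewrite addnA; apply: Hk; exists tau'.
Qed.

Lemma spec_weaken c m phi tau phi' tau' (Q Q' : memory -> R -> nat -> Prop) :
  (phi <= phi')%R -> tau <= tau' ->
  (forall m f t, Q m f t -> Q' m f t) ->
  spec c m phi tau Q -> spec c m phi' tau' Q'.
Proof.
move=> le_phi le_tau HQ H k d Hk T le_T.
have [||H1 H2] := H k d _ T; [by move=> m1 f t /HQ; apply: Hk|by lia|].
by split=> //; apply: le_trans H2; rewrite lerB.
Qed.

Lemma spec_set a e v m phi tau (Q : memory -> R -> nat -> Prop) :
  fits m e -> fits m v -> Q (upd m a (ev m e) (ev m v)) phi tau ->
  spec (CSet a e v) m phi tau.+1 Q.
Proof.
move=> fe fv HQ k d Hk [|T] // le_T /=.
by rewrite !weval_ev //; apply: (Hk _ _ _ HQ).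
Qed.

Lemma spec_seq c1 c2 m phi tau (Q : memory -> R -> nat -> Prop) :
  spec c1 m phi tau (fun m' phi' tau' => spec c2 m' phi' tau' Q) ->
  spec (CSeq c1 c2) m phi tau.+1 Q.
Proof.
by move=> H k d Hk [|T] // le_T /=; apply: H le_T => m' phi' tau' H2; apply: H2.
Qed.

Lemma spec_if t c1 c2 m phi tau (Q : memory -> R -> nat -> Prop) :
  tfits m t ->
  (tev m t -> spec c1 m phi tau Q) -> (~~ tev m t -> spec c2 m phi tau Q) ->
  spec (CIf t c1 c2) m phi tau.+1 Q.
Proof.
move=> ft H1 H2 k d Hk [|T] // le_T /=; rewrite teval_tev //.
by case: ifP => [/H1|/negbT /H2] H; apply: H le_T.
Qed.

(** The probability of acceptance at a draw is the average over its branches, so the credit can be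
    redistributed among them at constant average. *)
Lemma spec_rand a e b m phi tau (phis : nat -> R) (Q : memory -> R -> nat -> Prop) :
  fits m e -> fits m b ->
  (\sum_(i < (ev m b).+1) phis i <= phi *+ (ev m b).+1)%R ->
  (forall i, i <= ev m b -> Q (upd m a (ev m e) i) (phis i) tau) ->
  spec (CRand a e b) m phi tau.+1 Q.
Proof.
move=> fe fb Hphi HQ k d Hk [|T] // le_T /=; rewrite !weval_ev //.
have Hi (i : 'I_(ev m b).+1) := Hk _ _ _ (HQ i (ltn_ord i)) T le_T.
split=> [i|]; first by have [] := Hi i.
rewrite ler_pdivlMr ?ltr0n // mulrBl mul1r.
apply: (@le_trans _ _ (\sum_(i < (ev m b).+1) (1 - phis i))%R).
  rewrite sumrB sumr_const card_ord mulr_natr lerB //.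
by apply: ler_sum => i _; have [] := Hi i.
Qed.

(* The first argument of [Inv] bounds the number of remaining iterations. *)
Lemma spec_while t c (Inv : nat -> memory -> R -> nat -> Prop) N m phi tau
    (Q : memory -> R -> nat -> Prop) :
  (forall N m phi tau, Inv N m phi tau -> tfits m t /\ 0 < tau) ->
  (forall N m phi tau, Inv N m phi tau.+1 -> tev m t ->
     exists2 N', N = N'.+1 & spec c m phi tau (Inv N')) ->
  (forall N m phi tau, Inv N m phi tau.+1 -> ~~ tev m t -> Q m phi tau) ->
  Inv N m phi tau -> spec (CWhile t c) m phi tau Q.
Proof.
move=> H0 Hbody Hexit HI k d Hk.
elim: N m phi tau HI => [|N IH] m phi [|tau] HI; have [ft // _] := H0 _ _ _ _ HI.
  move=> [|T] // le_T /=; rewrite teval_tev //.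
  case: ifP => [|/negbT] ht; first by have [] := Hbody _ _ _ _ HI ht.
  exact: (Hk _ _ _ (Hexit _ _ _ _ HI ht)).
move=> [|T] // le_T /=; rewrite teval_tev //.
case: ifP => [|/negbT] ht; last exact: (Hk _ _ _ (Hexit _ _ _ _ HI ht)).
have [N' [<-] Hs] := Hbody _ _ _ _ HI ht.
by apply: Hs le_T => m' phi' tau' HI'; apply: IH.
Qed.

Definition V (a : nat) : wexp := WLoad a (WConst 0).
Definition SetV (a : nat) (e : wexp) : cmd := CSet a (WConst 0) e.
Definition For (v : nat) (b : wexp) (c : cmd) : cmd :=
  CSeq (SetV v (WConst 0))
    (CWhile (TLt (V v) b) (CSeq c (SetV v (WOp OAdd (V v) (WConst 1))))).

(** Overhead: an iteration pays for the loop test, the inner [CSeq] and the increment; entry and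
    exit pay for the outer [CSeq], the initialisation and the last test. *)
Lemma spec_for v b c N (Inv : nat -> memory -> R -> nat -> Prop) m phi tau
    (Q : memory -> R -> nat -> Prop) :
  1 < W -> N < W ->
  (forall i m phi tau, i <= N -> Inv i m phi tau ->
     [/\ m v 0 = i, fits m b & ev m b = N]) ->
  (forall i m phi tau, i < N -> Inv i m phi tau ->
     spec c m phi tau (fun m' phi' tau' =>
       m' v 0 = i /\ Inv i.+1 (upd m' v 0 i.+1) phi' tau')) ->
  (forall m phi tau, Inv N m phi tau -> Q m phi tau) ->
  Inv 0 (upd m v 0 0) phi tau ->
  spec (For v b c) m phi (tau + 3 * N + 3) Q.
Proof.
move=> W1 NW Hv Hbody Hexit HI; rewrite addnS; apply: spec_seq; rewrite addnS.
apply: spec_set; [exact: ltnW W1|exact: ltnW W1|].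
pose J r m phi t := exists i tau, [/\ i + r = N, t = tau + 3 * r + 1 & Inv i m phi tau].
apply: (@spec_while _ _ J N).
- move=> r m' phi' t [i [tau' [eN -> HI']]]; rewrite addn1.
  have [|v0 fb eb] := Hv i m' phi' tau' _ HI'; first by lia.
  by split; [split; [exact: ltnW W1|exact: fb]|].
- move=> r m' phi' t [i [tau' [eN et HI']]] /=.
  have [|-> fb ->] := Hv i m' phi' tau' _ HI'; first by lia.
  move=> lt_i; exists r.-1; first by lia.
  have -> : t = (tau' + 3 * r.-1 + 2).+1 by lia.
  apply: spec_seq.
  apply: spec_weaken (spec_frame (d := 3 * r.-1 + 2) (Hbody _ _ _ _ lt_i HI')) => //.
    by rewrite addnA.
  move=> m1 f1 t1 [t' -> [v1 HI1]]; rewrite addnA addn2.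
  apply: spec_set => /=; rewrite ?v1; [by lia|by split=> //; lia|].
  by exists i.+1, t'; rewrite addn1; split=> //; [lia|rewrite addn1].
- move=> r m' phi' t [i [tau' [eN et HI']]] /=.
  have [|-> fb ->] := Hv i m' phi' tau' _ HI'; first by lia.
  rewrite -leqNgt => le_i; apply: Hexit.
  have -> : N = i by lia.
  by have -> : t = tau' by lia.
- by exists 0, tau; split=> //; lia.
Qed.

(** Unspent time is forgotten, which suits worst-case costs; the amortised cost of the scan requires
    the finer [spec]. *)
Definition fspec (c : cmd) (m : memory) (phi : R) (t : nat) (Q : memory -> R -> Prop) :=
  spec c m phi t (fun m' phi' _ => Q m' phi').

(** For commands without draws: whatever the failure credit was, it comes back unchanged. *)
Definition dspec (c : cmd) (m : memory) (t : nat) (P : memory -> Prop) :=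
  forall phi, fspec c m phi t (fun m' phi' => phi' = phi /\ P m').

Lemma fspec_weaken c m phi phi' t t' (Q Q' : memory -> R -> Prop) :
  fspec c m phi t Q -> (forall m' f, Q m' f -> Q' m' f) ->
  (phi <= phi')%R -> t <= t' -> fspec c m phi' t' Q'.
Proof. by move=> H HQ le_phi le_t; apply: spec_weaken H => // ? ? _; apply: HQ. Qed.

Lemma fspec_le c m phi t t' (Q : memory -> R -> Prop) :
  fspec c m phi t Q -> t <= t' -> fspec c m phi t' Q.
Proof. by move=> H; apply: fspec_weaken H _ _. Qed.

Lemma fspec_seq c1 c2 m phi t1 t2 (Q : memory -> R -> Prop) :
  fspec c1 m phi t1 (fun m' phi' => fspec c2 m' phi' t2 Q) ->
  fspec (CSeq c1 c2) m phi (t1 + t2).+1 Q.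
Proof.
move=> H; apply: spec_seq; apply: spec_weaken (spec_frame (d := t2) H) => //.
move=> m' f t [t' -> H2]; apply: spec_weaken H2 => //; exact: leq_addl.
Qed.

Lemma fspec_if b c1 c2 m phi t (Q : memory -> R -> Prop) :
  tfits m b -> (tev m b -> fspec c1 m phi t Q) ->
  (~~ tev m b -> fspec c2 m phi t Q) -> fspec (CIf b c1 c2) m phi t.+1 Q.
Proof. exact: spec_if. Qed.

Lemma fspec_for v b c N (f : nat -> nat) (Inv : nat -> memory -> R -> Prop) m phi
    (Q : memory -> R -> Prop) :
  1 < W -> N < W ->
  (forall i m phi, i <= N -> Inv i m phi -> [/\ m v 0 = i, fits m b & ev m b = N]) ->
  (forall i m phi, i < N -> Inv i m phi ->
     fspec c m phi (f i) (fun m' phi' => m' v 0 = i /\ Inv i.+1 (upd m' v 0 i.+1) phi')) ->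
  (forall m phi, Inv N m phi -> Q m phi) ->
  Inv 0 (upd m v 0 0) phi ->
  fspec (For v b c) m phi (\sum_(0 <= i < N) f i + 3 * N + 3) Q.
Proof.
move=> W1 NW Hv Hbody Hexit HI.
apply: (@spec_for _ _ _ N (fun i m phi t => Inv i m phi /\ \sum_(i <= k < N) f k <= t)) => //.
- by move=> i m' phi' t le_i [HI' _]; apply: Hv HI'.
- move=> i m' phi' t lt_i [HI']; rewrite big_ltn // => le_t.
  apply: spec_weaken (spec_frame (d := \sum_(i.+1 <= k < N) f k) (Hbody _ _ _ lt_i HI')) => //.
  by move=> m1 f1 t1 [t' -> [v1 HI1]]; split=> //; split=> //; apply: leq_addl.
- by move=> m' phi' t [HI' _]; apply: Hexit.
Qed.

Lemma dspec_spec c m t (P : memory -> Prop) phi tau (Q : memory -> R -> nat -> Prop) :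
  dspec c m t P -> t <= tau -> (forall m' tau', tau - t <= tau' -> P m' -> Q m' phi tau') ->
  spec c m phi tau Q.
Proof.
move=> H le_t HQ; apply: spec_weaken (spec_frame (d := tau - t) (H phi)) => //.
  by rewrite subnKC.
move=> m' f t' [t1 -> [-> HP]]; apply: HQ => //; apply: leq_addl.
Qed.

Lemma dspec_fspec c m t (P : memory -> Prop) phi (Q : memory -> R -> Prop) :
  dspec c m t P -> (forall m', P m' -> Q m' phi) -> fspec c m phi t Q.
Proof.
by move=> H HQ; apply: (dspec_spec H) => // m' _ _; apply: HQ.
Qed.

Lemma dspec_weaken c m t t' (P P' : memory -> Prop) :
  dspec c m t P -> (forall m', P m' -> P' m') -> t <= t' -> dspec c m t' P'.
Proof. by move=> H HP le_t phi; apply: fspec_weaken (H phi) _ _ _ => // m' f [-> /HP]. Qed.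

Lemma dspec_le c m t t' (P : memory -> Prop) :
  dspec c m t P -> t <= t' -> dspec c m t' P.
Proof. by move=> H; apply: dspec_weaken H _. Qed.

Lemma dspec_set a e v m (P : memory -> Prop) :
  fits m e -> fits m v -> P (upd m a (ev m e) (ev m v)) -> dspec (CSet a e v) m 1 P.
Proof. by move=> fe fv HP phi; apply: spec_set. Qed.

Lemma dspec_seq c1 c2 m t1 t2 (P : memory -> Prop) :
  dspec c1 m t1 (fun m' => dspec c2 m' t2 P) -> dspec (CSeq c1 c2) m (t1 + t2).+1 P.
Proof. by move=> H phi; apply: fspec_seq; apply: (dspec_fspec H) => m' /(_ phi). Qed.

Lemma dspec_if b c1 c2 m t (P : memory -> Prop) :
  tfits m b -> (tev m b -> dspec c1 m t P) -> (~~ tev m b -> dspec c2 m t P) ->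
  dspec (CIf b c1 c2) m t.+1 P.
Proof.
by move=> fb H1 H2 phi; apply: fspec_if => // h; [apply: H1|apply: H2].
Qed.

Lemma dspec_for v b c N (f : nat -> nat) (Inv : nat -> memory -> Prop) m (P : memory -> Prop) :
  1 < W -> N < W ->
  (forall i m, i <= N -> Inv i m -> [/\ m v 0 = i, fits m b & ev m b = N]) ->
  (forall i m, i < N -> Inv i m ->
     dspec c m (f i) (fun m' => m' v 0 = i /\ Inv i.+1 (upd m' v 0 i.+1))) ->
  (forall m, Inv N m -> P m) ->
  Inv 0 (upd m v 0 0) ->
  dspec (For v b c) m (\sum_(0 <= i < N) f i + 3 * N + 3) P.
Proof.
move=> W1 NW Hv Hbody Hexit HI phi.
apply: (@fspec_for _ _ _ N f (fun i m phi' => phi' = phi /\ Inv i m)) => //.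
- by move=> i m' phi' le_i [_ HI']; apply: Hv HI'.
- move=> i m' phi' lt_i [-> HI']; apply: (dspec_fspec (Hbody _ _ lt_i HI')).
  by move=> m1 [v1 HI1].
- by move=> m' phi' [-> HI']; split=> //; apply: Hexit.
Qed.

Lemma dspec_for_const v b c N f (Inv : nat -> memory -> Prop) m (P : memory -> Prop) :
  1 < W -> N < W ->
  (forall i m, i <= N -> Inv i m -> [/\ m v 0 = i, fits m b & ev m b = N]) ->
  (forall i m, i < N -> Inv i m ->
     dspec c m f (fun m' => m' v 0 = i /\ Inv i.+1 (upd m' v 0 i.+1))) ->
  (forall m, Inv N m -> P m) ->
  Inv 0 (upd m v 0 0) ->
  dspec (For v b c) m (N * (f + 3) + 3) P.
Proof.
move=> W1 NW Hv Hbody Hexit HI.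
apply: dspec_weaken (@dspec_for _ _ _ N (fun _ => f) Inv m P W1 NW Hv Hbody Hexit HI) _ _ => //.
by rewrite sum_nat_const_nat subn0 mulnDr [3 * N]mulnC.
Qed.

Lemma fspec_while t c (Inv : nat -> memory -> R -> Prop) N f m phi (Q : memory -> R -> Prop) :
  (forall N m phi, Inv N m phi -> tfits m t) ->
  (forall N m phi, Inv N m phi -> tev m t ->
     exists2 N', N = N'.+1 & fspec c m phi f (Inv N')) ->
  (forall N m phi, Inv N m phi -> ~~ tev m t -> Q m phi) ->
  Inv N m phi -> fspec (CWhile t c) m phi (N * f.+1 + 1) Q.
Proof.
move=> Hf Hbody Hexit HI.
apply: (@spec_while _ _ (fun N m phi tau => Inv N m phi /\ N * f.+1 < tau) N) => //.
- by move=> N' m' phi' tau [HI' lt_tau]; split; [apply: Hf HI'|lia].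
- move=> N' m' phi' tau [HI' lt_tau] ht.
  have [N1 eN Hs] := Hbody _ _ _ HI' ht; exists N1 => //.
  apply: spec_weaken (spec_frame (d := N1 * f.+1 + 1) Hs) => //; first by nia.
  by move=> m1 f1 t1 [t' -> HI1]; split=> //; lia.
- by move=> N' m' phi' tau [HI' _]; apply: Hexit HI'.
- by split=> //; lia.
Qed.

Lemma dspec_while t c (Inv : nat -> memory -> Prop) N f m (P : memory -> Prop) :
  (forall N m, Inv N m -> tfits m t) ->
  (forall N m, Inv N m -> tev m t -> exists2 N', N = N'.+1 & dspec c m f (Inv N')) ->
  (forall N m, Inv N m -> ~~ tev m t -> P m) ->
  Inv N m -> dspec (CWhile t c) m (N * f.+1 + 1) P.
Proof.
move=> Hf Hbody Hexit HI phi.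
apply: (@fspec_while _ _ (fun N m phi' => phi' = phi /\ Inv N m)) => //.
- by move=> N' m' phi' [_]; apply: Hf.
- move=> N' m' phi' [-> HI'] ht; have [N1 eN Hs] := Hbody _ _ HI' ht.
  by exists N1 => //; apply: (dspec_fspec Hs).
- by move=> N' m' phi' [-> HI'] ht; split=> //; apply: Hexit HI' ht.
Qed.

End Logic.

(** * Frame conditions on the word arrays *)

Definition agree (l : seq nat) (m m' : memory) : Prop :=
  forall a i, a \notin l -> m' a i = m a i.

Lemma agree_trans l m1 m2 m3 : agree l m1 m2 -> agree l m2 m3 -> agree l m1 m3.
Proof. by move=> H1 H2 a i al; rewrite H2 ?H1. Qed.

Lemma agree_sub l l' m m' : all [in l'] l -> agree l m m' -> agree l' m m'.
Proof. by move=> /allP ll H a i al; apply: H; apply: contra al; apply: ll. Qed.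

Lemma agree_upd l m m' a i v : a \in l -> agree l m m' -> agree l m (upd m' a i v).
Proof.
move=> al H b j bl; rewrite /upd; case: eqP => [eb|_] /=; last exact: H.
by rewrite eb al in bl.
Qed.

Lemma updE (m : memory) a i v b j :
  upd m a i v b j = if (b == a) && (j == i) then v else m b j.
Proof. by []. Qed.

(** * Sorting the points by their distance to each point *)

Declare Scope wexp_scope.
Delimit Scope wexp_scope with we.
Bind Scope wexp_scope with wexp.
Arguments WOp o (e1 e2)%_we : rename.
Local Notation "# c" := (WConst c%N) (at level 2, format "# c") : wexp_scope.
Local Notation "x + y" := (WOp OAdd x y) : wexp_scope.
Local Notation "x - y" := (WOp OSub x y) : wexp_scope.
Local Notation "x * y" := (WOp OMul x y) : wexp_scope.
Local Notation "x %/ y" := (WOp ODiv x y) : wexp_scope.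
Local Notation "x %% y" := (WOp OMod x y) : wexp_scope.
Local Notation "c1 ;; c2" := (CSeq c1 c2) (at level 90, right associativity, format "c1 ;; '//' c2").
Arguments SetV a%_N e%_we.
Arguments CSet a%_N e1%_we e2%_we : rename.
Arguments WLoad a%_N e%_we : rename.
Arguments V a%_N.
Arguments For v%_N b%_we c.
Arguments TLt e1%_we e2%_we : rename.
Arguments TEq e1%_we e2%_we : rename.
Arguments RDist e1%_we e2%_we : rename.
Arguments CRand a%_N e1%_we e2%_we : rename.

Local Notation aN := 0%N (only parsing).
Local Notation aAdj := 1%N (only parsing).
Local Notation aRank := 2%N (only parsing).
Local Notation aOrd := 3%N (only parsing).
Local Notation vJ := 4%N (only parsing).
Local Notation vX := 5%N (only parsing).
Local Notation vW := 6%N (only parsing).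
Local Notation vLo := 7%N (only parsing).
Local Notation vHi := 8%N (only parsing).
Local Notation vStart := 9%N (only parsing).
Local Notation vMid := 10%N (only parsing).

Definition binary_search : cmd :=
  CWhile (TLt (V vLo) (V vHi))
    (SetV vMid ((V vLo + V vHi) %/ #2) ;;
     CIf (TRLt (RDist (V vJ) (WLoad aOrd (V vJ * V aN + V vMid))) (RDist (V vJ) (V vX)))
       (SetV vLo (V vMid + #1))
       (SetV vHi (V vMid))).

(** Merging by binary search rather than with two pointers: each point adds to its rank the number
    of closer points in the sibling block, independently of the other points, at the price of a
    logarithmic factor that the time bound absorbs. The sibling block may start beyond [n]; the
    search range is then empty. *)
Definition merge_count : cmd :=
  SetV vLo ((V vX %/ V vW + #1 - #2 * ((V vX %/ V vW) %% #2)) * V vW) ;;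
  SetV vStart (V vLo) ;;
  SetV vHi (V vLo + V vW) ;;
  CIf (TLt (V aN) (V vHi)) (SetV vHi (V aN)) (SetV vHi (V vHi)) ;;
  binary_search ;;
  CSet aRank (V vJ * V aN + V vX) (WLoad aRank (V vJ * V aN + V vX) + (V vLo - V vStart)).

Definition place : cmd :=
  CSet aOrd (V vJ * V aN + (V vX %/ V vW * V vW + WLoad aRank (V vJ * V aN + V vX))) (V vX).

Definition sort_row : cmd :=
  For vX (V aN)
    (CSet aRank (V vJ * V aN + V vX) #0 ;;
     CSet aOrd (V vJ * V aN + V vX) (V vX)) ;;
  SetV vW #1 ;;
  CWhile (TLt (V vW) (V aN))
    (For vX (V aN) merge_count ;;
     SetV vW (#2 * V vW) ;;
     For vX (V aN) place).

Definition sort_rows : cmd := For vJ (V aN) sort_row.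

Section Sort.
Local Open Scope nat_scope.
Variables (R : realType) (W : nat) (dist : nat -> nat -> R).
Variable E : memory -> bool.
Local Notation dspec := (dspec W dist E).
Variable n : nat.
Hypothesis n_gt0 : 0 < n.
Hypothesis W_big : 16 * (n + 1) * (n + 1) <= W.
Hypothesis dist_total : forall j x y, j < n -> x < n -> y < n -> x != y ->
  dist j x != dist j y.

Definition closer (j y x : nat) : bool := (dist j y < dist j x)%R.

Lemma closer_irr j : irreflexive (closer j).
Proof. by move=> x; rewrite /closer ltxx. Qed.

Lemma closer_trans j : transitive (closer j).
Proof. by move=> y x z; apply: lt_trans. Qed.

Lemma closer_total j x y : j < n -> x < n -> y < n -> x != y ->
  closer j x y || closer j y x.
Proof. by move=> jn xn yn ne; rewrite /closer -neq_lt dist_total. Qed.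

Lemma idx_eq a b a' b' : b < n -> b' < n ->
  (a * n + b == a' * n + b') = (a == a') && (b == b').
Proof.
move=> bn bn'; apply/eqP/andP => [e|[/eqP-> /eqP->] //].
have ea : a = a'.
  by have := congr1 (divn^~ n) e; rewrite !divnMDl // !divn_small ?addn0.
by move: e; rewrite ea => /addnI ->.
Qed.

(** The boundary [s + c] between closer and farther points stays between [lo] and [hi]. For an empty
    range, as with a sibling block beyond [n], the bound by [maxn z s] forces [c = 0]. *)
Lemma binary_search_spec (m : memory) j x s z c t :
  m aN 0 = n -> m vJ 0 = j -> m vX 0 = x -> m vLo 0 = s -> m vHi 0 = z ->
  j < n -> x < n -> z <= n -> s + c <= maxn z s -> z - s < 2 ^ t ->
  (forall p, s <= p < z -> closer j (m aOrd (j * n + p)) x = (p < s + c)) ->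
  dspec binary_search m (t * 5 + 1) (fun m' =>
    agree [:: vLo; vHi; vMid] m m' /\ m' vLo 0 = s + c).
Proof.
move=> mN mJ mX mLo mHi jn xn zn sc zst Hord.
pose Inv t (m1 : memory) := exists lo hi,
  [/\ agree [:: vLo; vHi; vMid] m m1, m1 vLo 0 = lo, m1 vHi 0 = hi,
      [/\ s <= lo <= s + c, s + c <= maxn hi lo & hi <= z] & hi - lo < 2 ^ t].
apply: (@dspec_while _ _ _ _ _ _ Inv).
- move=> t1 m1 [lo [hi [ag e1 e2 [b1 b3 b4] b2]]] /=; lia.
- move=> t1 m1 [lo [hi [ag e1 e2 [b1 b3 b4] b2]]] /=.
  rewrite e1 e2 => lt_lh; case: t1 b2 => [|t1] b2; first by lia.
  exists t1 => //.
  have aN1 : m1 aN 0 = n by rewrite ag.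
  have aJ1 : m1 vJ 0 = j by rewrite ag.
  have aX1 : m1 vX 0 = x by rewrite ag.
  set mid := (lo + hi) %/ 2.
  have Hmid : lo <= mid < hi by rewrite /mid; lia.
  have jnb : j * n + n <= n * n by nia.
  apply: (@dspec_seq _ _ _ _ _ _ _ 1 2).
  apply: dspec_set => /=; rewrite ?e1 ?e2; [lia|do !split; lia|].
  rewrite -/mid; apply: dspec_if.
  + rewrite /= ?updE /= aN1 aJ1 ?aX1; do !split; lia.
  + rewrite /= !updE /= aN1 aJ1 aX1 ag // => hlt.
    apply: dspec_set => /=; rewrite ?updE /=; [lia|do !split; lia|].
    exists mid.+1, hi; rewrite updE /= addn1; split=> //.
    * by do 2![apply: agree_upd => //].
    * have := Hord mid; rewrite /closer hlt; split; lia.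
    * by rewrite expnS in b2; rewrite /mid in Hmid *; lia.
  + rewrite /= !updE /= aN1 aJ1 aX1 ag // => hlt.
    apply: dspec_set => /=; rewrite ?updE /=; [lia|lia|].
    exists lo, mid; rewrite !updE /=; split=> //.
    * by do 2![apply: agree_upd => //].
    * have := Hord mid; rewrite /closer (negPf hlt); split; lia.
    * by rewrite expnS in b2; rewrite /mid in Hmid *; lia.
- move=> t1 m1 [lo [hi [ag e1 e2 [b1 b3 b4] b2]]] /=.
  by rewrite e1 e2 -leqNgt => h; split=> //; lia.
- by exists s, z; split=> //; split; lia.
Qed.

Variable lg : nat.
Hypothesis n_lg : n < 2 ^ lg.

Lemma merge_count_spec (m : memory) j x w :
  m aN 0 = n -> m vJ 0 = j -> m vX 0 = x -> m vW 0 = w ->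
  j < n -> x < n -> 0 < w < n ->
  (forall y, y < n -> m aOrd (j * n + bpos (closer j) n w y) = y) ->
  m aRank (j * n + x) <= n ->
  dspec merge_count m (lg * 5 + 13) (fun m' =>
    agree [:: vLo; vHi; vStart; vMid; aRank] m m' /\
    forall z, m' aRank z = m aRank z +
      (if z == j * n + x then
         count (closer j ^~ x) (block n w (sibling (x %/ w))) else 0)).
Proof.
move=> mN mJ mX mW jn xn w0 Hord Hrk.
set b := sibling (x %/ w); set s := b * w.
have sb : b <= x %/ w + 1 by apply: leq_subr.
have xw : x %/ w * w <= x by apply: leq_trunc_div.
have xwn : x %/ w < n by rewrite (leq_ltn_trans (leq_div _ _)).
have sn : s <= n + n.
  by apply: leq_trans (leq_mul sb (leqnn w)) _; rewrite mulnDl mul1n; lia.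
set c := count _ _.
have jnb : j * n + n <= n * n by nia.
set z := minn (s + w) n.
have cz : c <= size (block n w b) by apply: count_size.
rewrite size_block ?(andP w0).1 // -/s in cz.
apply: dspec_le.
  apply: dspec_seq; apply: dspec_set => /=; [lia|by rewrite mX mW; do !split; lia|].
  rewrite mX mW -/(sibling (x %/ w)) -/b -/s.
  apply: dspec_seq; apply: dspec_set => /=; [lia|lia|].
  apply: dspec_seq; apply: dspec_set; rewrite /= ?updE /= ?mW; [lia|do !split; lia|].
  apply: dspec_seq.
  apply: (@dspec_weaken _ _ _ _ _ _ 2 2 (fun m1 => [/\ agree [:: vLo; vHi; vStart] m m1,
     m1 vLo 0 = s, m1 vStart 0 = s & m1 vHi 0 = z])) => //.
    apply: dspec_if; first by rewrite /= ?updE /=; lia.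
      rewrite /= !updE /= mN => h; apply: dspec_set; rewrite /= ?updE /= ?mN; [lia|lia|].
      split; rewrite ?updE //=; last by rewrite /z; lia.
      by do 4![apply: agree_upd => //].
    rewrite /= !updE /= mN => h; apply: dspec_set; rewrite /= ?updE /= ?mN; [lia|lia|].
    split; rewrite ?updE //=; last by rewrite /z; lia.
    by do 4![apply: agree_upd => //].
  move=> m1 [ag1 mLo1 mStart1 mHi1].
  apply: dspec_seq; apply: dspec_weaken.
  - apply: (@binary_search_spec m1 j x s z c lg) => //; rewrite ?ag1 //; try by rewrite /z; lia.
    move=> p sp; rewrite ag1 //.
    (* Position [p] holds the point [y] of rank [p - s] in the sibling block, and [y] is closer than
       [x] exactly when this rank is below [c]. *)
    have [y] := @rank_surj (closer j) n (closer_irr j) (@closer_trans j)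
      (fun x y => closer_total jn) (block n w b) (p - s) (block_uniq _ _ _)
      (@block_ltn _ _ _) ltac:(by rewrite size_block ?(andP w0).1 // -/s; lia).
    rewrite mem_block => /andP[yn /eqP eb] ey.
    have -> : j * n + p = j * n + bpos (closer j) n w y.
      by rewrite /bpos /brank eb ey -/s; lia.
    rewrite Hord // -(@count_ltE _ n (closer_irr j) (@closer_trans j) (fun x y => closer_total jn) (block n w b)) //.
    + by rewrite ey -/c; lia.
    + exact: block_ltn.
    + by rewrite mem_block yn eb eqxx.
  - move=> m2 [ag2 mLo2].
    have ag12 : agree [:: vLo; vHi; vStart; vMid; aRank] m m2.
      apply: (@agree_trans _ _ m1); [apply: agree_sub ag1 | apply: agree_sub ag2] => //.
    have mStart2 : m2 vStart 0 = s by rewrite ag2.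
    have mN2 : m2 aN 0 = n by rewrite ag12.
    have mJ2 : m2 vJ 0 = j by rewrite ag12.
    have mX2 : m2 vX 0 = x by rewrite ag12.
    have mR2 u : m2 aRank u = m aRank u by rewrite ag2 ?ag1.
    apply: dspec_set => /=; rewrite mN2 mJ2 mX2 ?mLo2 ?mStart2 ?mR2; [do !split; lia|do !split; lia|].
    split; first by apply: agree_upd.
    move=> u; rewrite updE /= mR2 addnC; case: eqP => [->|_]; last by rewrite addnC.
    by rewrite addKn addnC.
  - done.
- lia.
Qed.

Lemma row_outside j y : y < n -> (j * n + y) %/ n = j.
Proof. by move=> yn; rewrite divnMDl // divn_small ?addn0. Qed.

Definition ranked j w (m : memory) :=
  forall y, y < n -> m aRank (j * n + y) = brank (closer j) n w y.

Definition ordered j w (m : memory) :=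
  forall y, y < n -> m aOrd (j * n + bpos (closer j) n w y) = y.

Definition off_row j a (m m' : memory) :=
  forall z, z %/ n != j -> m' a z = m a z.

Lemma brank_le j w x : x < n -> 0 < w -> brank (closer j) n w x <= n.
Proof.
move=> xn w0; have := brank_lt (closer_irr j) w0 xn; rewrite leq_min => /andP[_ h].
by apply: ltnW (leq_trans h (leq_subr _ _)).
Qed.

Lemma merge_pass_spec (m : memory) j w :
  m aN 0 = n -> m vJ 0 = j -> m vW 0 = w -> j < n -> 0 < w < n ->
  ranked j w m -> ordered j w m ->
  dspec (For vX (V aN) merge_count) m (n * (lg * 5 + 16) + 3) (fun m' =>
    [/\ agree [:: vX; vLo; vHi; vStart; vMid; aRank] m m',
        ranked j (2 * w) m' & off_row j aRank m m']).
Proof.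
move=> mN mJ mW jn w0 Hrk Hord.
have w_gt0 := (andP w0).1.
have W1 : 1 < W by lia.
(* [aOrd] is not written during this pass, so every search sees the sorted blocks of width [w] while
   the ranks move one by one to width [2 * w]. *)
pose Inv x (m1 : memory) :=
  [/\ agree [:: vX; vLo; vHi; vStart; vMid; aRank] m m1, m1 vX 0 = x,
      forall y, y < n -> m1 aRank (j * n + y) =
        brank (closer j) n (if y < x then 2 * w else w) y &
      off_row j aRank m m1].
apply: dspec_le; first apply: (@dspec_for_const _ _ _ _ _ _ _ n (lg * 5 + 13) Inv) => //.
- by lia.
- move=> x m1 _ [ag mX _ _]; rewrite /= mX ag //; split=> //; lia.
- move=> x m1 xn [ag mX hR hO].
  have mN1 : m1 aN 0 = n by rewrite ag.
  have mJ1 : m1 vJ 0 = j by rewrite ag.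
  have mW1 : m1 vW 0 = w by rewrite ag.
  have hO1 y : y < n -> m1 aOrd (j * n + bpos (closer j) n w y) = y.
    by move=> yn; rewrite ag // Hord.
  have hr : m1 aRank (j * n + x) <= n by rewrite hR // ltnn brank_le.
  apply: dspec_weaken (merge_count_spec mN1 mJ1 mX mW1 jn xn w0 hO1 hr) _ _.
  + move=> m2 [ag2 hR2]; split; first by rewrite ag2 ?mX.
    split; rewrite ?updE //=.
    * apply: agree_upd => //; apply: (@agree_trans _ _ m1) => //.
      exact: agree_sub ag2.
    * move=> y yn; rewrite updE /= hR2 hR // idx_eq // eqxx /= ltnS.
      case: (eqVneq y x) => [->|ne]; first by rewrite ltnn leqnn -brank_double // closer_irr.
      by rewrite addn0 [y <= x]leq_eqVlt (negPf ne).
    * move=> z hz; rewrite updE /= hR2 hO //.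
      by case: eqP => [e|]; rewrite ?addn0 //; rewrite e row_outside ?eqxx in hz.
  + exact: leqnn.
- by move=> m1 [ag mX hR hO]; split=> // y yn; rewrite hR // yn.
- split; rewrite ?updE //=.
  + by apply: agree_upd.
- by rewrite -addnA.
Qed.

Lemma place_pass_spec (m : memory) j w :
  m aN 0 = n -> m vJ 0 = j -> m vW 0 = w -> j < n -> 0 < w -> w < 2 * n ->
  ranked j w m ->
  dspec (For vX (V aN) place) m (n * 4 + 3) (fun m' =>
    [/\ agree [:: vX; aOrd] m m', ordered j w m' & off_row j aOrd m m']).
Proof.
move=> mN mJ mW jn w0 wn Hrk.
have W1 : 1 < W by lia.
have jnb : j * n + n <= n * n by nia.
pose Inv x (m1 : memory) :=
  [/\ agree [:: vX; aOrd] m m1, m1 vX 0 = x,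
      forall y, y < x -> m1 aOrd (j * n + bpos (closer j) n w y) = y &
      off_row j aOrd m m1].
apply: dspec_le; first apply: (@dspec_for_const _ _ _ _ _ _ _ n 1 Inv) => //.
- by lia.
- move=> x m1 _ [ag mX _ _]; rewrite /= mX ag //; split=> //; lia.
- move=> x m1 xn [ag mX hR hO].
  have mN1 : m1 aN 0 = n by rewrite ag.
  have mJ1 : m1 vJ 0 = j by rewrite ag.
  have mW1 : m1 vW 0 = w by rewrite ag.
  have xw : x %/ w * w <= x by apply: leq_trunc_div.
  have xwn : x %/ w < n by rewrite (leq_ltn_trans (leq_div _ _)).
  have bn := bpos_lt (closer_irr j) w0 xn.
  have rE : m1 aRank (j * n + x) = brank (closer j) n w x by rewrite ag // Hrk.
  rewrite /place; apply: dspec_set => /=; rewrite ?mN1 ?mJ1 ?mX ?mW1 ?rE -?/(bpos _ _ w x).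
  + do !split; try lia.
    by rewrite /bpos in bn; lia.
  split; rewrite ?updE //=; split; rewrite ?updE //=.
  + by do 2![apply: agree_upd => //].
  + move=> y; rewrite !updE /= ltnS => yx; have yn := leq_ltn_trans yx xn.
    (* Positions are pairwise distinct, so placing [x] does not overwrite a point placed before. *)
    rewrite idx_eq ?(bpos_lt (closer_irr j)) // eqxx; case: eqP => [e|ne] /=.
      by rewrite (bpos_inj (closer_irr j) (@closer_trans j) (fun x y => closer_total jn) w0 yn xn e).
    by apply: hR; rewrite ltn_neqAle yx andbT; apply/eqP => e; rewrite e in ne.
  + move=> z hz; rewrite !updE /=; case: eqP => [e|]; last by rewrite hO.
    by rewrite e row_outside ?eqxx in hz.
- by move=> m1 [ag mX hR hO]; split.
- split; rewrite ?updE //=.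
  + by apply: agree_upd.
- lia.
Qed.

Lemma off_row_trans j a m1 m2 m3 :
  off_row j a m1 m2 -> off_row j a m2 m3 -> off_row j a m1 m3.
Proof. by move=> H1 H2 z hz; rewrite H2 ?H1. Qed.

Definition rank (j x : nat) : nat := count (closer j ^~ x) (iota 0 n).

Lemma rank_lt j x : x < n -> rank j x < n.
Proof.
move=> xn; rewrite -[X in _ < X](size_iota 0) -(count_predT (iota 0 n)).
by apply: (@sub_count_lt _ _ _ _ x); rewrite ?closer_irr // mem_iota.
Qed.

Definition row_sorted j (m : memory) :=
  forall y, y < n -> m aRank (j * n + y) = rank j y /\ m aOrd (j * n + rank j y) = y.

Definition sort_vars := [:: vX; vW; vLo; vHi; vStart; vMid; aRank; aOrd].

Lemma sort_row_spec (m : memory) j :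
  m aN 0 = n -> m vJ 0 = j -> j < n -> n <= 2 ^ lg.-1 ->
  dspec sort_row m (n * lg * (lg * 5 + 40)) (fun m' =>
    [/\ agree sort_vars m m', row_sorted j m', off_row j aRank m m' & off_row j aOrd m m']).
Proof.
move=> mN mJ jn n_lg1.
have W1 : 1 < W by lia.
have lg0 : 0 < lg by case: (lg) n_lg => //; rewrite expn0; lia.
have jnb : j * n + n <= n * n by nia.
pose Inv0 x (m1 : memory) :=
  [/\ agree sort_vars m m1, m1 vX 0 = x,
      forall y, y < x -> m1 aRank (j * n + y) = 0 /\ m1 aOrd (j * n + y) = y,
      off_row j aRank m m1 & off_row j aOrd m m1].
pose Inv t (m1 : memory) := exists w,
  [/\ agree sort_vars m m1, m1 vW 0 = w, 0 < w < 2 * n & n <= w * 2 ^ t] /\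
  [/\ ranked j w m1, ordered j w m1, off_row j aRank m m1 & off_row j aOrd m m1].
rewrite /sort_row; apply: dspec_le.
  apply: dspec_seq.
  apply: (@dspec_for_const _ _ _ _ _ _ _ n 3 Inv0) => //.
  - by lia.
  - move=> x m1 _ [ag mX _ _ _]; rewrite /= mX ag //; split=> //; lia.
  - move=> x m1 xn [ag mX hR o1 o2].
    have mN1 : m1 aN 0 = n by rewrite ag.
    have mJ1 : m1 vJ 0 = j by rewrite ag.
    apply: (@dspec_seq _ _ _ _ _ _ _ 1 1).
    apply: dspec_set => /=; rewrite ?mN1 ?mJ1 ?mX; [do !split; lia|lia|].
    apply: dspec_set => /=; rewrite ?updE /= ?mN1 ?mJ1 ?mX; [do !split; lia|lia|].
    split; rewrite ?updE //=; split; rewrite ?updE //=.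
    + by do 3![apply: agree_upd => //].
    + move=> y; rewrite !updE /= ltnS => yx; have yn := leq_ltn_trans yx xn.
      rewrite idx_eq ?eqxx //=; case: eqP => [->//|/eqP ne].
      by apply: hR; rewrite ltn_neqAle ne.
    + move=> z hz; rewrite !updE /=; case: eqP => [e|]; last by rewrite o1.
      by rewrite e row_outside ?eqxx in hz.
    + move=> z hz; rewrite !updE /=; case: eqP => [e|]; last by rewrite o2.
      by rewrite e row_outside ?eqxx in hz.
  - move=> m1 [ag mX hR o1 o2].
    apply: (@dspec_seq _ _ _ _ _ _ _ 1); apply: dspec_set => //=; first by lia.
    apply: (@dspec_while _ _ _ _ _ _ Inv lg.-1 (n * (lg * 5 + 20) + 9)).
    + move=> t m2 [w [[ag2 mW _ _] _]] /=; lia.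
    + move=> t m2 [w [[ag2 mW w0 wt] [hr ho o3 o4]]] /=.
      have mN2 : m2 aN 0 = n by rewrite ag2.
      have mJ2 : m2 vJ 0 = j by rewrite ag2.
      rewrite mW mN2 => wn; case: t wt => [|t]; first by lia.
      rewrite expnS => wt; exists t => //.
      have w1 : 0 < w < n by lia.
      apply: dspec_le.
        apply: dspec_seq; apply: dspec_weaken (merge_pass_spec mN2 mJ2 mW jn w1 hr ho) _ (leqnn _).
        move=> m3 [ag3 hr3 o5].
        have mN3 : m3 aN 0 = n by rewrite ag3.
        have mJ3 : m3 vJ 0 = j by rewrite ag3.
        have mW3 : m3 vW 0 = w by rewrite ag3.
        apply: dspec_seq; apply: dspec_set; rewrite /= ?mW3; [lia|do !split; lia|].
        set m4 := upd _ _ _ _.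
        have ag4 : agree [:: vW] m3 m4 by apply: agree_upd.
        have mN4 : m4 aN 0 = n by rewrite ag4.
        have mJ4 : m4 vJ 0 = j by rewrite ag4.
        apply: dspec_weaken (@place_pass_spec m4 j (2 * w) mN4 mJ4 _ jn _ _ _) _ (leqnn _) => //; try lia.
        move=> m5 [ag5 ho5 o6].
        have ag15 : agree sort_vars m2 m5.
          apply: agree_trans (agree_sub _ ag3) _ => //.
          by apply: agree_trans (agree_sub _ ag4) (agree_sub _ ag5).
        exists (2 * w); split; split=> //; rewrite ?ag5 //; try lia.
        * by apply: agree_trans ag2 ag15.
        * by move=> y yn; rewrite ag5 // ag4 // hr3.
        * apply: off_row_trans o3 _; apply: off_row_trans o5 _.
          by move=> z _; rewrite ag5 // ag4.
        * apply: off_row_trans o4 _; apply: off_row_trans o6 => z _.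
          by rewrite ag4 // ag3.
      lia.
    + move=> t m2 [w [[ag2 mW w0 wt] [hr ho o3 o4]]] /=.
      rewrite mW ag2 // mN -leqNgt => nw.
      split=> // y yn.
      have e : brank (closer j) n w y = rank j y by apply: brank_last.
      rewrite hr // e; split=> //; have := ho y yn.
      by rewrite /bpos e divn_small // (leq_trans yn).
    + exists 1; split; split=> //; rewrite ?mul1n //; try lia.
      * by apply: agree_upd.
      * by move=> y yn; rewrite updE /= brank1 ?(hR y yn).1 //; apply: closer_irr.
      * move=> y yn; rewrite updE /= /bpos brank1 ?divn1 ?muln1 ?addn0 ?(hR y yn).2 //.
        exact: closer_irr.
  - split; rewrite ?updE //=.
    by apply: agree_upd.
nia.
Qed.

Lemma sort_rows_spec (m : memory) :
  m aN 0 = n -> n <= 2 ^ lg.-1 ->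
  dspec sort_rows m (n * (n * lg * (lg * 5 + 40) + 3) + 3) (fun m' =>
    agree (vJ :: sort_vars) m m' /\ (forall j, j < n -> row_sorted j m')).
Proof.
move=> mN n_lg1.
have W1 : 1 < W by lia.
pose Inv x (m1 : memory) :=
  [/\ agree (vJ :: sort_vars) m m1, m1 vJ 0 = x & forall j, j < x -> row_sorted j m1].
apply: dspec_le; first apply: (@dspec_for_const _ _ _ _ _ _ _ n _ Inv) => //.
- by lia.
- move=> x m1 _ [ag mJ _]; rewrite /= mJ ag //; split=> //; lia.
- move=> j m1 jn [ag mJ hR].
  have mN1 : m1 aN 0 = n by rewrite ag.
  apply: dspec_weaken (sort_row_spec mN1 mJ jn n_lg1) _ (leqnn _).
  move=> m2 [ag2 hR2 o1 o2]; split; first by rewrite ag2.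
  split; rewrite ?updE //=.
  + by apply: agree_upd => //; apply: agree_trans ag (agree_sub _ ag2).
  + move=> j'; rewrite ltnS leq_eqVlt => /orP[/eqP->|lt_j] y yn; rewrite !updE /=; first exact: hR2.
    have [e1 e2] := hR _ lt_j _ yn.
    by rewrite o1 ?o2 ?row_outside ?rank_lt // neq_ltn lt_j.
- by move=> m1 [ag mJ hR]; split.
- by split=> //; apply: agree_upd.
- exact: leqnn.
Qed.

End Sort.

(** * Each row of ranks is a permutation *)

Section Ranks.
Local Open Scope nat_scope.
Variables (R : realType) (dist : nat -> nat -> R) (n : nat).
Hypothesis dist_total : forall j x y, j < n -> x < n -> y < n -> x != y ->
  dist j x != dist j y.
Local Notation rank := (rank dist n).

Lemma rank_perm_iota j : j < n -> perm_eq [seq rank j k | k <- iota 0 n] (iota 0 n).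
Proof.
move=> jn.
have := @rank_perm (closer dist j) n (closer_irr dist j) (@closer_trans _ dist j)
  (fun x y => closer_total dist_total jn) (iota 0 n) (iota_uniq _ _).
by rewrite size_iota; apply=> x; rewrite mem_iota.
Qed.

Lemma count_rank j l : j < n -> count (fun k => rank j k < l) (iota 0 n) = minn l n.
Proof.
move=> jn; rewrite -(count_map (rank j) (fun r => r < l)) (permP (rank_perm_iota jn)).
elim: (n) => [|k IH]; first by rewrite minn0.
by rewrite -addn1 iotaD count_cat IH /= add0n; lia.
Qed.

Lemma rank_ex j r : j < n -> r < n -> exists2 k, k < n & rank j k = r.
Proof.
move=> jn rn; have : r \in iota 0 n by rewrite mem_iota.
rewrite -(perm_mem (rank_perm_iota jn)) => /mapP[k]; rewrite mem_iota => kn ->.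
by exists k.
Qed.

Lemma rank_inj_row j x y : j < n -> x < n -> y < n -> rank j x = rank j y -> x = y.
Proof.
move=> jn xn yn; apply: (@rank_inj _ n (closer_irr dist j) (@closer_trans _ dist j)).
- by move=> ? ?; apply: closer_total.
- by move=> z; rewrite mem_iota.
- by rewrite mem_iota.
- by rewrite mem_iota.
Qed.

End Ranks.

Local Arguments mkseq : simpl never.
Local Arguments iota : simpl never.

(** * The program *)

(* [aU] lists the [vU] uncovered elements of the instance [vI], where [vI = n]
   is the common instance; the samples covered by [k], numbered in order of
   appearance, are stored in [aLst] from the index [k * vM], and there are
   [aCnt k] of them. *)
Local Notation vLg := 11%N (only parsing).
Local Notation vH := 12%N (only parsing).
Local Notation vP := 13%N (only parsing).
Local Notation vG := 14%N (only parsing).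
Local Notation vL := 15%N (only parsing).
Local Notation vI := 16%N (only parsing).
Local Notation aDone := 17%N (only parsing).
Local Notation aU := 18%N (only parsing).
Local Notation vU := 19%N (only parsing).
Local Notation vRound := 20%N (only parsing).
Local Notation vM := 21%N (only parsing).
Local Notation vE := 22%N (only parsing).
Local Notation aMark := 24%N (only parsing).
Local Notation aCnt := 25%N (only parsing).
Local Notation aLst := 26%N (only parsing).
Local Notation vK := 27%N (only parsing).
Local Notation vQ := 28%N (only parsing).
Local Notation vC := 29%N (only parsing).
Local Notation vR := 30%N (only parsing).
Local Notation vNU := 31%N (only parsing).
Local Notation vLen := 32%N (only parsing).
Local Notation vII := 33%N (only parsing).
Local Notation vEl := 34%N (only parsing).

Definition skip : cmd := SetV vLen (V vLen).

Definition set_len : cmd :=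
  CIf (TLt (V vI) (V aN)) (SetV vLen (WLoad aRank (V vEl * V aN + V vI)))
    (SetV vLen (V vL)).

(** Row [n] of [aAdj] lies beyond the output matrix and holds the picks of the common instance.
    Every other row starts as a copy of it, which also erases what an unsuccessful smaller guess
    left there. *)
Definition init_row : cmd :=
  For vK (V aN)
    (CIf (TLt (V vI) (V aN))
      (CSet aAdj (V vI * V aN + V vK) (WLoad aAdj (V aN * V aN + V vK)))
      (CSet aAdj (V vI * V aN + V vK) #0)).

Definition collect : cmd :=
  SetV vU #0 ;;
  For vEl (V aN)
    (set_len ;;
     CIf (TAnd (TLt #0 (V vLen)) (TNot (TLt (V vL) (V vLen))))
       (CSet aU (V vU) (V vEl) ;; SetV vU (V vU + #1)) skip).

Definition clear : cmd := For vK (V aN) (CSet aCnt (V vK) #0).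

Definition record : cmd :=
  For vR (V vLen)
    (SetV vK (WLoad aOrd (V vEl * V aN + V vR)) ;;
     CSet aLst (V vK * V vM + WLoad aCnt (V vK)) (V vE) ;;
     CSet aCnt (V vK) (WLoad aCnt (V vK) + #1)).

Definition sample : cmd :=
  For vE (V vM)
    (CSet aMark (V vE) #0 ;;
     CRand vR #0 (V vU - #1) ;;
     SetV vEl (WLoad aU (V vR)) ;;
     set_len ;;
     record).

Definition count_unmarked : cmd :=
  SetV vC #0 ;;
  For vQ (WLoad aCnt (V vK))
    (CIf (TEq (WLoad aMark (WLoad aLst (V vK * V vM + V vQ))) #0)
      (SetV vC (V vC + #1)) skip).

Definition mark : cmd :=
  For vQ (WLoad aCnt (V vK)) (CSet aMark (WLoad aLst (V vK * V vM + V vQ)) #1).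

(** Compacts [aU] in place: the writing position [vNU] never overtakes the reading position [vQ]. *)
Definition discard : cmd :=
  SetV vNU #0 ;;
  For vQ (V vU)
    (SetV vEl (WLoad aU (V vQ)) ;;
     set_len ;;
     CIf (TLt (WLoad aRank (V vEl * V aN + V vK)) (V vLen)) skip
       (CSet aU (V vNU) (V vEl) ;; SetV vNU (V vNU + #1))) ;;
  SetV vU (V vNU).

Definition pick : cmd := CSet aAdj (V vI * V aN + V vK) #1 ;; mark ;; discard.

Definition scan : cmd :=
  For vK (V aN) (count_unmarked ;; CIf (TLt (V vC) (V vH)) skip pick).

Definition round : cmd := CIf (TLt #0 (V vU)) (clear ;; sample ;; scan) skip.

Definition cover_instance : cmd :=
  init_row ;; collect ;; For vRound (#15 * V vLg) round ;;
  CIf (TAnd (TEq (V vU) #0) (TLt (V vI) (V aN))) (CSet aDone (V vI) #1) skip.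

(** The common instance has the number [n] and must come before the rows that copy it, hence the
    descending index [vI]. *)
Definition guess : cmd :=
  SetV vL ((V aN + V vG - #1) %/ V vG) ;;
  SetV vM (#2 * V vG * V vH) ;;
  For vII (V aN + #1)
    (SetV vI (V aN - V vII) ;;
     CIf (TEq (WLoad aDone (V vI)) #0) cover_instance skip) ;;
  SetV vG (#2 * V vG).

(** [kappa] acts only on the number of samples, through [vH]. The last guess below [2 * n] is at
    least [n], hence at least any out-degree. *)
Definition build_graph (kappa : nat) : cmd :=
  sort_rows ;;
  SetV vP #1 ;; SetV vLg #1 ;;
  CWhile (TLt (V vP) (V aN)) (SetV vP (#2 * V vP) ;; SetV vLg (V vLg + #1)) ;;
  SetV vH (V vLg * #kappa) ;;
  SetV vG #1 ;;
  CWhile (TLt (V vG) (#2 * V aN)) guess.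

Lemma mkseq_rcons (T : Type) (f : nat -> T) k : mkseq f k.+1 = rcons (mkseq f k) (f k).
Proof. by rewrite /mkseq -addn1 iotaD map_cat cats1. Qed.

Lemma mkseq_eq (T : Type) (f g : nat -> T) k :
  (forall q, (q < k)%N -> f q = g q) -> mkseq f k = mkseq g k.
Proof.
elim: k => [//|k IH] H; rewrite !mkseq_rcons H // IH // => q qk.
by rewrite H // ltnS ltnW.
Qed.

(** * One set cover instance *)

Section Instance.
Local Open Scope nat_scope.
Variables (R : realType) (W : nat) (dist : nat -> nat -> R).
Variable E : memory -> bool.
Local Notation dspec := (dspec W dist E).
Local Notation spec := (spec W dist E).
Variables n lg h g L M i : nat.
Hypothesis n_gt0 : 0 < n.
Hypothesis W_big : 16 * (n + 1) * (n + 1) <= W.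
Hypothesis W_M : (n + 1) * (M + 1) <= W.
Hypothesis dist_total : forall j x y, j < n -> x < n -> y < n -> x != y ->
  dist j x != dist j y.
Hypotheses (L_gt0 : 0 < L) (L_le : L <= n) (i_le : i <= n).
Hypotheses (h_gt0 : 0 < h) (g_gt0 : 0 < g) (ME : M = 2 * g * h).

Local Notation rank := (rank dist n).

(** For [i < n] the element [j] is covered by the points closer to [j] than [i], which form a prefix
    of the sorted list of [j]; [i = n] is the common instance. *)
Definition len (j : nat) : nat := if i < n then rank j i else L.

Definition cov (k j : nat) : bool := rank j k < len j.

Definition env (m : memory) : Prop :=
  [/\ m aN 0 = n, m vH 0 = h, m vL 0 = L & m vM 0 = M] /\
  [/\ m vI 0 = i, m vLg 0 = lg & forall j, j < n -> row_sorted dist n j m].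

Definition env_arrays := [:: aN; vH; vL; vM; vI; vLg; aRank; aOrd].

Lemma env_agree l m m' : all (fun a => a \notin l) env_arrays -> agree l m m' ->
  env m -> env m'.
Proof.
move=> /allP hl ag [[e1 e2 e3 e4] [e5 e6 hr]]; split; split; rewrite ?ag ?hl //.
by move=> j jn y yn; have [r1 r2] := hr _ jn _ yn; rewrite !ag ?hl.
Qed.

Lemma len_le j : j < n -> len j <= n.
Proof. by rewrite /len => jn; case: ifP => [h1|_] //; apply: ltnW (rank_lt _ _ _). Qed.

Lemma set_len_spec (m : memory) j : env m -> m vEl 0 = j -> j < n ->
  dspec set_len m 2 (fun m' => agree [:: vLen] m m' /\ m' vLen 0 = len j).
Proof.
move=> [[mN _ mL _] [mI _ hr]] mEl jn.
have jnb : j * n + n <= n * n by nia.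
apply: dspec_if => /=; rewrite ?mI ?mN; first by lia.
  move=> lt_in; apply: dspec_set => /=; rewrite ?mEl ?mI ?mN; [lia|do !split; lia|].
  by split; [apply: agree_upd|rewrite updE /= /len lt_in (hr _ jn _ lt_in).1].
move=> ge_in; apply: dspec_set => /=; rewrite ?mL; [lia|lia|].
by split; [apply: agree_upd|rewrite updE /= /len (negPf ge_in)].
Qed.

Definition elems (m : memory) : seq nat := mkseq (m aU) (m vU 0).

Lemma discard_spec (m : memory) k : env m -> m vK 0 = k -> k < n ->
  all (fun j => j < n) (elems m) -> m vU 0 <= n ->
  dspec discard m (m vU 0 * 12 + 7) (fun m' =>
    agree [:: vNU; vQ; vEl; vLen; aU; vU] m m' /\
    elems m' = [seq j <- elems m | ~~ cov k j]).
Proof.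
move=> em mK kn /allP hU un; set u := m vU 0.
have hU' q : q < u -> m aU q < n.
  by move=> qu; apply: hU; apply/mapP; exists q => //; rewrite mem_iota.
have tS q : q < u -> take q.+1 (elems m) = rcons (take q (elems m)) (m aU q).
  by move=> qu; rewrite (take_nth 0) ?size_mkseq // nth_mkseq.
pose Inv q (m1 : memory) :=
  [/\ agree [:: vNU; vQ; vEl; vLen; aU] m m1, m1 vQ 0 = q, m1 vNU 0 <= q,
      mkseq (m1 aU) (m1 vNU 0) = [seq j <- take q (elems m) | ~~ cov k j] &
      forall p, q <= p -> m1 aU p = m aU p].
apply: dspec_le.
  apply: dspec_seq; apply: dspec_set => /=; [lia|lia|].
  apply: dspec_seq; apply: (@dspec_for_const _ _ _ _ _ _ _ u 9 Inv).
  - lia.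
  - lia.
  - move=> q m1 _ [ag mQ _ _ _]; rewrite /= mQ ag //; split=> //; lia.
  - move=> q m1 qu [ag mQ nuq hs hp].
    have em1 : env m1 by apply: env_agree ag em.
    have mK1 : m1 vK 0 = k by rewrite ag.
    apply: (@dspec_seq _ _ _ _ _ _ _ 1 7).
    apply: dspec_set => /=; rewrite ?mQ; [lia|lia|].
    rewrite hp //; set j := m aU q; have jn : j < n := hU' _ qu.
    set m2 := upd _ _ _ _.
    have ag2 : agree [:: vEl] m1 m2 by apply: agree_upd.
    have em2 : env m2 by apply: env_agree ag2 em1.
    apply: (@dspec_seq _ _ _ _ _ _ _ 2 4).
    apply: dspec_weaken (set_len_spec em2 (j := j) _ jn) _ (leqnn _); first by rewrite /m2 updE.
    move=> m3 [ag3 mLen3].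
    have em3 : env m3 by apply: env_agree ag3 em2.
    have mEl3 : m3 vEl 0 = j by rewrite ag3.
    have mK3 : m3 vK 0 = k by rewrite ag3 // ag2.
    have mN3 : m3 aN 0 = n by case: em3 => -[].
    have rE : m3 aRank (j * n + k) = rank j k by case: em3 => _ [_ _ /(_ j jn k kn)[]].
    have mNU3 : m3 vNU 0 = m1 vNU 0 by rewrite ag3 // ag2.
    have mQ3 : m3 vQ 0 = q by rewrite ag3 // ag2.
    have ag13 : agree [:: vNU; vQ; vEl; vLen; aU] m m3.
      apply: agree_trans ag _; apply: agree_trans (agree_sub _ ag2) (agree_sub _ ag3) => //.
    have jnb : j * n + n <= n * n by nia.
    have aU3 p : m3 aU p = m1 aU p by rewrite ag3 // ag2.
    apply: dspec_if => /=; rewrite ?mEl3 ?mN3 ?mK3 ?rE ?mLen3 -?/(cov k j).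
    + do !split; lia.
    + move=> ckj; apply: dspec_le; first apply: dspec_set => /=; [lia|lia| |lia].
      split; rewrite ?updE //=; split; rewrite ?updE //= ?mNU3 //.
      * by do 2![apply: agree_upd => //].
      * exact: leqW.
      * rewrite tS // filter_rcons ckj -hs; apply: mkseq_eq => p _.
        by rewrite !updE /= aU3.
      * by move=> p qp; rewrite !updE /= aU3 hp // ltnW.
    + move=> ckj; apply: (@dspec_seq _ _ _ _ _ _ _ 1 1).
      apply: dspec_set => /=; rewrite ?mNU3 ?mEl3; [lia|lia|].
      apply: dspec_set => /=; rewrite ?updE /= ?mNU3 ?mEl3; [lia|do !split; lia|].
      split; rewrite ?updE //=; split; rewrite ?updE //= ?addn1 //.
      * by do 3![apply: agree_upd => //].
      * rewrite mkseq_rcons tS // filter_rcons ckj -hs; congr rcons; last by rewrite !updE /= eqxx.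
        by apply: mkseq_eq => p pu; rewrite !updE /= ltn_eqF // aU3.
      * move=> p qp; rewrite !updE /= gtn_eqF ?aU3 ?hp //; first by rewrite ltnW.
        exact: leq_ltn_trans nuq qp.
  - move=> m1 [ag mQ nuu hs _].
    apply: dspec_set => /=; [lia|lia|].
    split; first by apply: agree_upd => //; apply: agree_sub ag.
    rewrite -(take_size (elems m)) size_mkseq -/u.
    by rewrite /elems updE /= -hs; apply: mkseq_eq => p _; rewrite updE.
  - split; rewrite ?updE //= ?take0 //.
    by do 2![apply: agree_upd => //].
rewrite /=; lia.
Qed.

Definition samples (m : memory) (k : nat) : seq nat :=
  mkseq (fun q => m aLst (k * M + q)) (m aCnt k).

Lemma mark_spec (m : memory) k : env m -> m vK 0 = k -> k < n -> m aCnt k <= M ->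
  dspec mark m (m aCnt k * 4 + 3) (fun m' =>
    agree [:: vQ; aMark] m m' /\
    forall e, m' aMark e = if e \in samples m k then 1 else m aMark e).
Proof.
move=> em mK kn cM; set c := m aCnt k in cM *.
have tS q : q < c -> take q.+1 (samples m k) = rcons (take q (samples m k)) (m aLst (k * M + q)).
  by move=> qu; rewrite (take_nth 0) ?size_mkseq // nth_mkseq.
have knM : k * M + M <= n * M by nia.
pose Inv q (m1 : memory) :=
  [/\ agree [:: vQ; aMark] m m1, m1 vQ 0 = q &
      forall e, m1 aMark e = if e \in take q (samples m k) then 1 else m aMark e].
apply: dspec_le; first apply: (@dspec_for_const _ _ _ _ _ _ _ c 1 Inv).
- lia.
- lia.
- move=> q m1 _ [ag mQ _]; rewrite /= mQ !ag // mK; do !split => //; lia.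
- move=> q m1 qc [ag mQ hm].
  have em1 : env m1 by apply: env_agree ag em.
  have [[mN1 _ _ mM1] _] := em1.
  have mK1 : m1 vK 0 = k by rewrite ag.
  apply: dspec_set => /=; rewrite ?mK1 ?mM1 ?mQ ?(ag aLst) //; [do !split; lia|lia|].
  split; rewrite ?updE //=; split; rewrite ?updE //=.
  + by do 2![apply: agree_upd => //].
  + move=> e; rewrite !updE /= tS // mem_rcons inE.
    by case: eqP => //= _; rewrite hm.
- move=> m1 [ag mQ hm]; split=> // e; rewrite hm.
  by rewrite -{2}(take_size (samples m k)) size_mkseq.
- split; rewrite ?updE //=; first by apply: agree_upd.
  by move=> e; rewrite updE take0.
- lia.
Qed.

Lemma count_unmarked_spec (m : memory) k : env m -> m vK 0 = k -> k < n -> m aCnt k <= M ->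
  dspec count_unmarked m (m aCnt k * 5 + 5) (fun m' =>
    agree [:: vQ; vC; vLen] m m' /\
    m' vC 0 = count (fun e => m aMark e == 0) (samples m k)).
Proof.
move=> em mK kn cM; set c := m aCnt k in cM *.
have tS q : q < c -> take q.+1 (samples m k) = rcons (take q (samples m k)) (m aLst (k * M + q)).
  by move=> qu; rewrite (take_nth 0) ?size_mkseq // nth_mkseq.
have knM : k * M + M <= n * M by nia.
pose Inv q (m1 : memory) :=
  [/\ agree [:: vQ; vC; vLen] m m1, m1 vQ 0 = q &
      m1 vC 0 = count (fun e => m aMark e == 0) (take q (samples m k))].
apply: dspec_le.
  apply: dspec_seq; apply: dspec_set => /=; [lia|lia|].
  apply: (@dspec_for_const _ _ _ _ _ _ _ c 2 Inv).
  - lia.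
  - lia.
  - move=> q m1 _ [ag mQ _]; rewrite /= mQ !ag // mK; do !split => //; lia.
  - move=> q m1 qc [ag mQ hC].
    have em1 : env m1 by apply: env_agree ag em.
    have [[mN1 _ _ mM1] _] := em1.
    have mK1 : m1 vK 0 = k by rewrite ag.
    have cq : m1 vC 0 <= q by rewrite hC (leq_trans (count_size _ _)) ?size_take_min ?geq_minl.
    apply: dspec_if => /=; rewrite ?mK1 ?mM1 ?mQ ?(ag aLst) ?(ag aMark) //.
    + do !split; lia.
    + move=> h0; apply: dspec_le; first apply: dspec_set => /=; [lia|do !split; lia| |lia].
      split; rewrite ?updE //=; split; rewrite ?updE //=.
      * by do 2![apply: agree_upd => //].
      * by rewrite tS // -cats1 count_cat /= h0 hC addn0.
    + move=> h0; apply: dspec_le; first apply: dspec_set => /=; [lia|lia| |lia].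
      split; rewrite ?updE //=; split; rewrite ?updE //=.
      * by do 2![apply: agree_upd => //].
      * by rewrite tS // -cats1 count_cat /= (negPf h0) hC !addn0.
  - move=> m1 [ag mQ ->]; split=> //.
    by rewrite -{2}(take_size (samples m k)) size_mkseq.
  - split; rewrite ?updE //= ?take0 //.
    by do 2![apply: agree_upd => //].
lia.
Qed.

Definition pick_vars := [:: vNU; vQ; vEl; vLen; aU; vU; aMark; aAdj].

Definition set_edge (m : memory) (m' : memory) (C : seq nat) : Prop :=
  forall z, m' aAdj z = if (z %/ n == i) && (z %% n \in C) then 1 else m aAdj z.

Lemma pick_spec (m : memory) k : env m -> m vK 0 = k -> k < n -> m aCnt k <= M ->
  all (fun j => j < n) (elems m) -> m vU 0 <= n ->
  dspec pick m (m aCnt k * 4 + m vU 0 * 12 + 13) (fun m' =>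
    [/\ agree pick_vars m m', set_edge m m' [:: k],
        forall e, m' aMark e = if e \in samples m k then 1 else m aMark e &
        elems m' = [seq j <- elems m | ~~ cov k j]]).
Proof.
move=> em mK kn cM hU un; have [[mN _ _ _] [mI _ _]] := em.
have jnb : i * n + n <= n * n + n by nia.
apply: dspec_le.
  apply: dspec_seq; apply: dspec_set => /=; rewrite ?mI ?mN ?mK; [do !split; lia|lia|].
  set m1 := upd _ _ _ _.
  have ag1 : agree [:: aAdj] m m1 by apply: agree_upd.
  have em1 : env m1 by apply: env_agree ag1 em.
  have sE : samples m1 k = samples m k by [].
  have eE : elems m1 = elems m by [].
  have mK1 : m1 vK 0 = k by rewrite ag1.
  apply: (@dspec_seq _ _ _ _ _ _ _ _ (m vU 0 * 12 + 7)).
  apply: dspec_weaken (mark_spec em1 mK1 kn cM) _ (leqnn _).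
  move=> m2 [ag2 hm2].
  have em2 : env m2 by apply: env_agree ag2 em1.
  have mK2 : m2 vK 0 = k by rewrite ag2.
  have uE2 : m2 vU 0 = m vU 0 by rewrite ag2.
  have eE2 : elems m2 = elems m.
    by rewrite /elems uE2; apply: mkseq_eq => q _; rewrite ag2.
  apply: dspec_weaken; first apply: (discard_spec em2 mK2 kn); rewrite ?eE2 ?uE2 //.
    move=> m3 [ag3 eE3]; split.
    + apply: agree_trans (agree_sub _ ag1) _ => //.
      by apply: agree_trans (agree_sub _ ag2) (agree_sub _ ag3).
    + move=> z; rewrite ag3 // ag2 // /m1 updE /= inE.
      congr (if _ then _ else _); rewrite {1}(divn_eq z n).
      by rewrite idx_eq // ltn_mod.
    + by move=> e; rewrite ag3 // hm2 sE.
    + by rewrite eE3 ?eE2.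
rewrite /=; have -> : upd m 1 (i * n + k) 1 aCnt k = m aCnt k by [].
lia.
Qed.

Definition covered (C : seq nat) (j : nat) : bool := has (cov^~ j) C.

Definition scan_vars := [:: vK; vC; vNU; vQ; vEl; vLen; aU; vU; aMark; aAdj].

(** Each pick covers at least [h] samples not covered before, out of [2 * g * h], hence the bound on
    the picks. The time of a pick is linear in the number of uncovered elements and is charged to
    the [2 * g - size C] picks still possible. Once scanned, a point covers fewer than [h] of the
    samples left, whether it was picked or not, and this persists because [C] only grows. *)
Lemma scan_spec (m : memory) (js : seq nat) : env m ->
  all (fun j => j < n) (elems m) -> m vU 0 <= n -> size js = M ->
  (forall e, e < M -> m aMark e = 0) ->
  (forall k, k < n -> samples m k = [seq e <- iota 0 M | cov k (nth 0 js e)]) ->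
  dspec scan m
    (9 * (\sum_(0 <= k < n) m aCnt k) + 11 * n + 2 * g * (12 * m vU 0 + 12) + 3)
    (fun m' => exists C,
      [/\ agree scan_vars m m', all (fun k => k < n) C, size C <= 2 * g & set_edge m m' C] /\
      (elems m' = [seq j <- elems m | ~~ covered C j] /\
       forall k, k < n -> count (fun j => cov k j && ~~ covered C j) js < h)).
Proof.
move=> em hU un sjs hM hS phi.
have [[mN mH _ _] _] := em.
set u0 := m vU 0 in un *.
have hjs : js = map (nth 0 js) (iota 0 M) by rewrite -{1}(mkseq_nth 0 js) sjs.
have cntM k : k < n -> m aCnt k <= M.
  move=> kn; have <- : size (samples m k) = m aCnt k by rewrite size_mkseq.
  by rewrite hS // size_filter (leq_trans (count_size _ _)) ?size_iota.
pose hits C := count (covered C) js.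
pose left k C := count (fun j => cov k j && ~~ covered C j) js.
have hits_cons k C : hits (k :: C) = hits C + left k C.
  rewrite /hits /left -count_predUI [X in _ = _ + X](@eq_count _ _ pred0).
    rewrite count_pred0 addn0; apply: eq_count => j /=.
    by rewrite /covered /=; case: (cov k j); case: has.
  by move=> j /=; case: covered; rewrite ?andbF.
have hitsM C : hits C <= 2 * g * h by rewrite -ME -sjs count_size.
pose Inv k (m1 : memory) (phi' : R) t := phi' = phi /\ exists C,
  [/\ agree scan_vars m m1, m1 vK 0 = k, all (fun k => k < n) C, size C * h <= hits C &
      \sum_(k <= k' < n) (9 * m aCnt k' + 8) + (2 * g - size C) * (12 * u0 + 12) <= t] /\
  [/\ set_edge m m1 C,
      forall e, e < M -> (m1 aMark e != 0) = covered C (nth 0 js e),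
      elems m1 = [seq j <- elems m | ~~ covered C j] &
      forall k', k' < k -> left k' C < h].
have szC C : size C * h <= hits C -> size C <= 2 * g.
  by move=> hC; rewrite -(leq_pmul2r h_gt0) (leq_trans hC).
have E0 : \sum_(0 <= k < n) (9 * m aCnt k + 8) = 9 * \sum_(0 <= k < n) m aCnt k + 8 * n.
  by rewrite big_split /= -big_distrr sum_nat_const_nat subn0 [n * 8]mulnC.
apply: spec_weaken; [exact: lexx| | |apply: (@spec_for _ _ _ _ _ _ _ n Inv _ _
   (\sum_(0 <= k < n) (9 * m aCnt k + 8) + 2 * g * (12 * u0 + 12)))].
- rewrite E0; lia.
- by move=> m' f t; exact.
- lia.
- lia.
- move=> k m1 f t _ [_ [C [[ag mK _ _ _] _]]]; rewrite /= mK ag //; split=> //; lia.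
- move=> k m1 f t kn [-> [C [[ag mK hC hsz ht] [hadj hmark hel hleft]]]].
  have em1 : env m1 by apply: env_agree ag em.
  have cE : m1 aCnt k = m aCnt k by rewrite ag.
  have sE : samples m1 k = samples m k.
    by rewrite /samples cE; apply: mkseq_eq => q _; rewrite ag.
  have cM : m1 aCnt k <= M by rewrite cE cntM.
  have uE : m1 vU 0 <= u0.
    have <- : size (elems m1) = m1 vU 0 by rewrite size_mkseq.
    by rewrite hel size_filter (leq_trans (count_size _ _)) ?size_mkseq.
  move: ht; rewrite big_ltn //.
  set S' := \sum_(k.+1 <= _ < n) _; set D := (2 * g - size C) * _ => ht.
  have -> : t = (t.-1).+1 by lia.
  apply: spec_seq; apply: (dspec_spec (count_unmarked_spec em1 mK kn cM)); first by rewrite cE; lia.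
  rewrite cE => m2 t2 ht2 [ag2 hc2].
  have em2 : env m2 by apply: env_agree ag2 em1.
  have cntE : m2 vC 0 = left k C.
    rewrite hc2 sE hS // count_filter /left {2}hjs count_map; apply: eq_in_count => e.
    rewrite mem_iota add0n /= => eM; rewrite andbC; congr (_ && _).
    by rewrite -hmark // negbK.
  have [[mN2 mH2 _ _] _] := em2.
  have mK2 : m2 vK 0 = k by rewrite ag2.
  have cE2 : m2 aCnt k = m aCnt k by rewrite ag2.
  have sE2 : samples m2 k = samples m k.
    by rewrite -sE /samples ag2 //; apply: mkseq_eq => q _; rewrite ag2.
  have uE2 : m2 vU 0 = m1 vU 0 by rewrite ag2.
  have elE2 : elems m2 = elems m1.
    by rewrite /elems uE2; apply: mkseq_eq => q _; rewrite ag2.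
  have ag02 : agree scan_vars m m2 by apply: agree_trans ag (agree_sub _ ag2).
  have -> : t2 = (t2.-1).+1 by lia.
  apply: spec_if => /=; rewrite ?mH2 ?cntE; first by lia.
    move=> lt_h; have -> : t2.-1 = (t2.-2).+1 by lia.
    apply: spec_set => /=; [lia|lia|].
    split; rewrite ?updE //=; split=> //; exists C; split; split; rewrite ?updE //=.
    + by do 2![apply: agree_upd => //].
    + lia.
    + by move=> z; rewrite updE /= updE /= ag2 // hadj.
    + by move=> e eM; rewrite !updE /= ag2 // hmark.
    + rewrite -hel -elE2 /elems !updE /=; apply: mkseq_eq => q _.
      by rewrite !updE.
    + by move=> k'; rewrite ltnS leq_eqVlt => /orP[/eqP->//|]; apply: hleft.
  rewrite -leqNgt => le_h.
  have el2n : all (fun j => j < n) (elems m2).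
    rewrite elE2 hel all_filter; apply: sub_all hU => j /= ->; exact: implybT.
  have hsz' : size (k :: C) * h <= hits (k :: C).
    by rewrite hits_cons /= mulSn addnC leq_add.
  have sz' := szC _ hsz'; rewrite /= in sz'.
  have eg : D =
    (2 * g - (size C).+1) * (12 * u0 + 12) + (12 * u0 + 12).
    by rewrite -mulSnr /D; congr (_ * _); lia.
  set D' := (2 * g - (size C).+1) * _ in eg.
  apply: (dspec_spec (pick_spec em2 mK2 kn _ el2n _)); rewrite ?cE2 ?uE2 ?cntM //; try lia.
  move=> m3 t3 ht3 [ag3 hadj3 hmark3 hel3].
  split; first by rewrite ag3 ?mK2.
  split=> //; exists (k :: C); split; split; rewrite ?updE //=.
  + by apply: agree_upd => //; apply: agree_trans ag02 (agree_sub _ ag3).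
  + by rewrite kn.
  + by rewrite -/D' -/S'; lia.
  + move=> z; rewrite updE /= hadj3 ag2 // hadj !inE.
    by case: (_ == i); case: (_ == k).
  + move=> e eM; rewrite updE /= hmark3 sE2 hS // mem_filter mem_iota add0n eM /= andbT.
    by rewrite /covered /=; case: (cov k _) => //=; rewrite ag2 // hmark.
  + rewrite /elems updE /=; rewrite (_ : mkseq _ _ = elems m3); last first.
      by apply: mkseq_eq => q _; rewrite updE.
    rewrite hel3 elE2 hel -filter_predI; apply: eq_filter => j.
    by rewrite /covered /= negb_or.
  + move=> k'; rewrite ltnS leq_eqVlt => /orP[/eqP->|k'k].
      rewrite /left (@eq_count _ _ pred0) ?count_pred0 // => j /=.
      by rewrite /covered /=; case: (cov k j).
    apply: leq_ltn_trans (hleft _ k'k).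
    apply: sub_count => j /= /andP[-> /=]; rewrite /covered /=.
    by apply: contra => ->; rewrite orbT.
- move=> m1 f t [-> [C [[ag mK hC hsz _] [hadj _ hel hleft]]]]; split=> //.
  by exists C; split; split=> //; apply: szC.
- split=> //; exists [::]; split; split; rewrite ?updE //=.
  + by apply: agree_upd.
  + by rewrite subn0.
  + by move=> z; rewrite updE /= andbF.
  + by move=> e eM; rewrite updE /= hM.
  + rewrite filter_predT /elems updE /=; apply: mkseq_eq => q _.
    by rewrite updE.
Qed.

Local Notation fspec := (fspec W dist E).
Let W1 : 1 < W. Proof. by lia. Qed.

Lemma clear_spec (m : memory) : env m ->
  dspec clear m (n * 4 + 3) (fun m' =>
    agree [:: vK; aCnt] m m' /\ forall k, k < n -> m' aCnt k = 0).
Proof.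
move=> em.
pose Inv k (m1 : memory) := [/\ agree [:: vK; aCnt] m m1, m1 vK 0 = k &
  forall k', k' < k -> m1 aCnt k' = 0].
apply: dspec_le; first apply: (@dspec_for_const _ _ _ _ _ _ _ n 1 Inv).
- lia.
- lia.
- move=> k m1 _ [ag mK _]; have [[mN _ _ _] _] : env m1 by apply: env_agree ag em.
  by rewrite /= mK mN //; split=> //; lia.
- move=> k m1 kn [ag mK hk]; apply: dspec_set => /=; rewrite ?mK; [lia|lia|].
  split; rewrite ?updE //=; split; rewrite ?updE //=.
  + by do 2![apply: agree_upd => //].
  + move=> k'; rewrite ltnS leq_eqVlt !updE /=; case: eqP => //= _; exact: hk.
- by move=> m1 [].
- split; rewrite ?updE //=.
  by apply: agree_upd.
- lia.
Qed.

Lemma samples_push (m : memory) k0 k e : k0 < n -> m aCnt k0 < M -> m aCnt k <= M ->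
  samples (upd (upd m aLst (k0 * M + m aCnt k0) e) aCnt k0 (m aCnt k0).+1) k =
  if k == k0 then rcons (samples m k0) e else samples m k.
Proof.
move=> kn c0 cM; rewrite /samples !updE /=; case: eqP => [->|/eqP ne].
  rewrite mkseq_rcons !updE /= eqxx; congr rcons; apply: mkseq_eq => q qc.
  by rewrite !updE /= eqn_add2l ltn_eqF.
apply: mkseq_eq => q qc; rewrite !updE /= idx_eq ?(negPf ne) //; lia.
Qed.

(** Only the first [len j] points in the sorted list of [j] are visited, since they are exactly the
    ones covering [j]. A list receives at most one entry per sample, so it never runs into the [M]
    cells of the next list. *)
Lemma record_spec (m : memory) j e : env m -> m vEl 0 = j -> j < n ->
  m vLen 0 = len j -> m vE 0 = e -> e < M -> (forall k, k < n -> m aCnt k <= e) ->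
  dspec record m (len j * 8 + 3) (fun m' =>
    agree [:: vR; vK; aLst; aCnt] m m' /\
    forall k, k < n -> samples m' k =
      if cov k j then rcons (samples m k) e else samples m k).
Proof.
move=> em mEl jn mLen mE eM hcnt.
have lenn : len j <= n by apply: len_le.
pose Inv r (m1 : memory) := [/\ agree [:: vR; vK; aLst; aCnt] m m1, m1 vR 0 = r &
  forall k, k < n -> samples m1 k =
    if rank j k < r then rcons (samples m k) e else samples m k].
apply: dspec_le; first apply: (@dspec_for_const _ _ _ _ _ _ _ (len j) 5 Inv).
- lia.
- lia.
- by move=> r m1 _ [ag mR _]; rewrite /= mR ag // mLen; split=> //; lia.
- move=> r m1 rl [ag mR hs].
  have em1 : env m1 by apply: env_agree ag em.
  have [[mN1 mH1 mL1 mM1] [mI1 mLg1 hr]] := em1.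
  have mEl1 : m1 vEl 0 = j by rewrite ag.
  have mE1 : m1 vE 0 = e by rewrite ag.
  have [k0 k0n k0r] := rank_ex dist_total jn (leq_trans rl lenn).
  have ordE : m1 aOrd (j * n + r) = k0 by rewrite -k0r; have [] := hr j jn k0 k0n.
  have jnb : j * n + n <= n * n by nia.
  have kMb : k0 * M + M <= n * M by nia.
  have szE k m2 : size (samples m2 k) = m2 aCnt k by rewrite size_mkseq.
  have c0 : m1 aCnt k0 <= e.
    by rewrite -szE hs // k0r ltnn szE hcnt.
  have cM k : k < n -> m1 aCnt k <= M.
    move=> kn; rewrite -szE hs //; case: ifP => _; rewrite ?size_rcons szE.
      by apply: leq_ltn_trans eM; apply: hcnt.
    by apply: leq_trans (ltnW eM); apply: hcnt.
  rewrite /record.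
  apply: (@dspec_seq _ _ _ _ _ _ _ 1 3).
  apply: dspec_set => /=; rewrite ?mEl1 ?mN1 ?mR; [lia|do !split; lia|].
  rewrite ordE; apply: (@dspec_seq _ _ _ _ _ _ _ 1 1).
  apply: dspec_set; rewrite /= ?updE /= ?mM1 ?mE1; [do !split; lia|lia|].
  apply: dspec_set; rewrite /= ?updE /= ?mM1 ?mE1; [lia|do !split; lia|].
  split; rewrite ?updE //=; split; rewrite ?updE //=.
  + by do 4![apply: agree_upd => //].
  + move=> k kn; rewrite addn1.
    transitivity (samples (upd (upd m1 aLst (k0 * M + m1 aCnt k0) e) aCnt k0 (m1 aCnt k0).+1) k).
      rewrite /samples !updE /=; apply: mkseq_eq => q _.
      by rewrite !updE.
    rewrite samples_push ?cM //; last exact: leq_ltn_trans c0 eM.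
    rewrite !hs // ltnS; case: eqP => [->|/eqP ne]; first by rewrite k0r ltnn leqnn.
    rewrite [rank j k <= r]leq_eqVlt; case: eqP => // e0.
    by case/eqP: ne; apply: (rank_inj_row dist_total jn) => //; rewrite e0.
- by move=> m1 [ag _ hs]; split.
- by split; rewrite ?updE //=; apply: agree_upd.
- lia.
Qed.

(** * Random samples and their potential *)

Section Sampling.
Variables (F : finType) (P : F -> pred nat) (Us : seq nat).

Definition bad (f : F) : bool := 16 * count (P f) Us < size Us.

(* For a bad [f] a uniform element of [Us] satisfies [16 ^ P f] <= 2 on
   average, so the potential does not increase on average. *)
Definition potential (js : seq nat) : R :=
  (\sum_(f | bad f) 16 ^+ count (P f) js * 2 ^+ (M - size js) / 4 ^+ M)%R.

Lemma potential_ge0 js : (0 <= potential js)%R.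
Proof.
by apply: sumr_ge0 => f _; rewrite divr_ge0 ?mulr_ge0 ?exprn_ge0 ?ler0n.
Qed.

(** A sample replaces a pending factor 2 in the term of [f] by 16 or 1, according to whether [P f]
    holds of it. If [P f] holds of [a] of the [s] elements, the new factor is [1 + 15 * a / s] on
    average, which is below 2 when [16 * a < s]. *)
Lemma potential_step js : size js < M ->
  (\sum_(p < size Us) potential (rcons js (nth 0 Us p)) <= potential js *+ size Us)%R.
Proof.
move=> sM; rewrite /potential exchange_big /= -sumrMnl; apply: ler_sum => f bf.
set c := count (P f) js; set a := count (P f) Us; set s := size Us.
have aE : (\sum_(p < s) (P f (nth 0 Us p))%:R = a%:R :> R)%R.
  transitivity (\sum_(x <- Us) (P f x)%:R : R)%R; first by rewrite (big_nth 0) big_mkord.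
  rewrite /a; elim: (Us) => [|x r IH]; first by rewrite big_nil.
  by rewrite big_cons IH /= natrD.
have tE (p : 'I_s) : (16 ^+ count (P f) (rcons js (nth 0 Us p)) *
    2 ^+ (M - size (rcons js (nth 0 Us p))) / 4 ^+ M =
    (1 + 15 * (P f (nth 0 Us p))%:R) *
    (16 ^+ c * 2 ^+ (M - (size js).+1) / 4 ^+ M) :> R)%R.
  rewrite size_rcons -cats1 count_cat /= addn0 exprD -/c !mulrA; do 2 congr (_ * _)%R.
  by rewrite mulrC; case: (P f _); rewrite ?expr1 ?expr0 ?mulr1 ?mulr0 ?addr0 //; congr (_ * _)%R; ring.
under eq_bigr => p _ do rewrite tE.
rewrite -mulr_suml big_split /= -mulr_sumr aE sumr_const card_ord.
have -> : M - size js = (M - (size js).+1).+1 by lia.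
rewrite exprS; set X := (16 ^+ c)%R; set Y := (2 ^+ (M - _))%R; set Z := (4 ^+ M)%R.
have -> : (X * (2 * Y) / Z *+ s = (2 * s%:R) * (X * Y / Z))%R.
  by rewrite -mulr_natr; ring.
rewrite ler_wpM2r //.
  by rewrite divr_ge0 ?mulr_ge0 ?exprn_ge0 ?ler0n.
have : ((16 * a)%:R < s%:R :> R)%R by rewrite ltr_nat.
have : (0 <= a%:R :> R)%R by rewrite ler0n.
rewrite natrM; lra.
Qed.

Definition sample_vars := [:: vE; aMark; vR; vEl; vLen; vK; aLst; aCnt].

Lemma sample_spec (m : memory) (phi psi : R) : env m -> elems m = Us ->
  all (fun j => (j < n) && (len j <= L)) Us -> 0 < size Us <= n ->
  (forall k, k < n -> m aCnt k = 0) -> (psi + potential [::] <= phi)%R ->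
  fspec sample m phi (M * (8 * L + 15) + 3) (fun m' phi' => exists js,
    [/\ agree sample_vars m m', size js = M, {subset js <= Us} &
        (psi + potential js <= phi')%R] /\
    ((forall e, e < M -> m' aMark e = 0) /\
     forall k, k < n -> samples m' k = [seq e <- iota 0 M | cov k (nth 0 js e)])).
Proof.
move=> em eU /allP okU sU hcnt hphi.
have vUE : m vU 0 = size Us by rewrite -eU size_mkseq.
pose Inv e (m1 : memory) phi' := exists js,
  [/\ agree sample_vars m m1, m1 vE 0 = e, size js = e, {subset js <= Us} &
      (psi + potential js <= phi')%R] /\
  ((forall e', e' < e -> m1 aMark e' = 0) /\
   forall k, k < n -> samples m1 k = [seq e' <- iota 0 e | cov k (nth 0 js e')]).
apply: fspec_le; first apply: (@fspec_for _ _ _ _ _ _ _ M (fun _ => 8 * L + 12) Inv).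
- lia.
- lia.
- move=> e m1 f _ [js [[ag mE _ _ _] _]].
  have [[_ _ _ mM] _] : env m1 by apply: env_agree ag em.
  by rewrite /= mE mM; split=> //; lia.
- move=> e m1 f eM [js [[ag mE sjs sub hpsi] [hmark hs]]].
  have vU1 : m1 vU 0 = size Us by rewrite ag.
  have aU1 p : p < size Us -> m1 aU p = nth 0 Us p.
    by move=> pU; rewrite ag // -eU nth_mkseq // vUE.
  have szE k m2 : size (samples m2 k) = m2 aCnt k by rewrite size_mkseq.
  rewrite /sample.
  apply: fspec_le.
    apply: (@fspec_seq _ _ _ _ _ _ _ _ 1 (1 + (1 + (2 + (8 * L + 3)).+1).+1).+1).
    apply: spec_set => /=; rewrite ?mE; [lia|lia|].
    apply: (@fspec_seq _ _ _ _ _ _ _ _ 1 (1 + (2 + (8 * L + 3)).+1).+1).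
    (* Once index [p] is drawn, the credit is the reserve [psi] plus the potential with that sample
       appended; the averaging condition then reduces to [potential_step]. *)
    apply: (@spec_rand _ _ _ _ _ _ _ _ _ _
      (fun p => (psi + potential (rcons js (nth 0 Us p)))%R)) => /=; rewrite ?updE /= ?vU1.
    + lia.
    + do !split; lia.
    + have -> : (size Us - 1).+1 = size Us by lia.
      rewrite big_split /= sumr_const card_ord; apply: le_trans (ler_wMn2r _ hpsi).
      by rewrite mulrnDl lerD2l potential_step // sjs.
    move=> p pU; have {}pU : p < size Us by lia.
    set j := nth 0 Us p.
    have jU : j \in Us by apply: mem_nth.
    have /andP[jn lenL] := okU _ jU.
    set m2 := upd _ _ _ _.
    have ag2 : agree [:: aMark; vR] m1 m2 by do 2![apply: agree_upd => //].
    pose Post (m' : memory) :=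
      [/\ agree sample_vars m m', m' vE 0 = e, forall e', e' < e.+1 -> m' aMark e' = 0 &
        forall k, k < n -> samples m' k =
          [seq e' <- iota 0 e.+1 | cov k (nth 0 (rcons js j) e')]].
    apply: (@dspec_fspec _ _ _ _ _ _ _ Post).
      apply: (@dspec_seq _ _ _ _ _ _ _ 1 (2 + (8 * L + 3)).+1).
      apply: dspec_set => /=; [lia|lia|].
      have -> : m2 aU (m2 vR 0) = j by rewrite /m2 !updE /= aU1.
      set m3 := upd _ _ _ _.
      have ag3 : agree [:: aMark; vR; vEl] m1 m3.
        by apply: agree_upd => //; apply: agree_sub ag2.
      have ag03 : agree sample_vars m m3 by apply: agree_trans ag (agree_sub _ ag3).
      have em3 : env m3 by apply: env_agree ag03 em.
      apply: (@dspec_seq _ _ _ _ _ _ _ 2 (8 * L + 3)).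
      have mEl3 : m3 vEl 0 = j by rewrite /m3 updE.
      apply: dspec_weaken; first by apply: set_len_spec em3 mEl3 jn.
      move=> m4 [ag4 mLen4].
      have em4 : env m4 by apply: env_agree ag4 em3.
      have mEl4 : m4 vEl 0 = j by rewrite ag4.
      have mE4 : m4 vE 0 = e by rewrite ag4 // ag3.
      have sE4 k : samples m4 k = samples m1 k.
        rewrite /samples (_ : m4 aCnt k = m1 aCnt k); last by rewrite ag4 // ag3.
        by apply: mkseq_eq => q _; rewrite ag4 // ag3.
      have cE4 k : k < n -> m4 aCnt k <= e.
        move=> kn; rewrite -szE sE4 hs // size_filter (leq_trans (count_size _ _)) //.
        by rewrite size_iota.
      2: exact: leqnn.
      apply: dspec_weaken (record_spec em4 mEl4 jn mLen4 mE4 eM cE4) _ _.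
        move=> m5 [ag5 hs5].
        have ag15 : agree sample_vars m m5.
          by apply: agree_trans ag03 _; apply: agree_trans (agree_sub _ ag4) (agree_sub _ ag5).
        split=> //; first by rewrite ag5.
          move=> e' e'e; rewrite ag5 // ag4 // /m3 /m2 !updE /=.
          case: eqP => //= ne; apply: hmark; move: e'e; rewrite ltnS leq_eqVlt.
          by case: eqP.
        move=> k kn; rewrite hs5 // sE4 hs //.
        have -> : iota 0 e.+1 = iota 0 e ++ [:: e] by rewrite -addn1 iotaD.
        rewrite filter_cat /=.
        have -> : [seq e' <- iota 0 e | cov k (nth 0 js e')] =
                  [seq e' <- iota 0 e | cov k (nth 0 (rcons js j) e')].
          apply: eq_in_filter => e'; rewrite mem_iota add0n /= => e'e.
          by rewrite nth_rcons sjs e'e.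
        rewrite nth_rcons sjs ltnn eqxx.
        by case: ifP; rewrite ?cats1 ?cats0.
      by rewrite leq_add2r mulnC leq_mul2l lenL.
    move=> m3 [ag3 mE3 hm3 hs3]; split=> //.
    exists (rcons js j); split; split; rewrite ?updE //=.
    * by apply: agree_upd.
    * by rewrite size_rcons sjs.
    * by move=> x; rewrite mem_rcons inE => /orP[/eqP->//|]; apply: sub.
  lia.
- move=> m1 f [js [[ag mE sjs sub hpsi] [hmark hs]]].
  by exists js.
- exists [::]; split; split; rewrite ?updE //=.
  + by apply: agree_upd.
  + by move=> k kn; rewrite /samples updE /= hcnt.
- by rewrite sum_nat_const_nat subn0; lia.
Qed.

End Sampling.

(** * Fractional covers and the quality of one round *)

Definition elem_ok (j : nat) : bool := (j < n) && (0 < len j <= L).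

Lemma elem_ok_lt j : elem_ok j -> j < n.
Proof. by case/andP. Qed.

(** Double counting: a sample [j] is recorded at no more than [len j <= L] points. *)
Lemma sum_counts (m : memory) js : size js = M -> all elem_ok js ->
  (forall k, k < n -> samples m k = [seq e <- iota 0 M | cov k (nth 0 js e)]) ->
  \sum_(0 <= k < n) m aCnt k <= M * L.
Proof.
move=> sjs /allP ok hs.
have cE k : k < n -> m aCnt k = count (cov k) js.
  move=> kn; have <- : size (samples m k) = m aCnt k by rewrite size_mkseq.
  by rewrite hs // size_filter -{2}(mkseq_nth 0 js) sjs count_map.
rewrite (eq_big_nat _ _ (F2 := fun k => \sum_(j <- js) cov k j)) => [|k /= kn]; last first.
  rewrite cE // -sum1_count big_mkcond; apply: eq_bigr => j _.
  by case: (cov k j).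
rewrite exchange_big /= -sjs -[size js * L]/(size js * L).
have -> : size js * L = \sum_(j <- js) L by rewrite big_const_seq count_predT iter_addn_0 mulnC.
rewrite !big_seq; apply: leq_sum => j jjs; have /andP[jn /andP[_ hl]] := ok _ jjs.
have -> : \sum_(0 <= k < n) cov k j = count (cov^~ j) (iota 0 n).
  rewrite -sum1_count [RHS]big_mkcond /index_iota subn0; apply: eq_bigr => k _.
  by case: (cov k j).
rewrite (@eq_count _ _ (fun k => rank j k < len j)) // (count_rank dist_total) //.
by apply: leq_trans hl; rewrite geq_minl.
Qed.

(* Fractional set cover of the elements of the instance, with value at most
   [g] and weights [x k / D]. *)
Definition coverable : Prop := exists (D : nat) (x : nat -> nat),
  [/\ 0 < D, \sum_(0 <= k < n) x k <= g * D &
      forall j, elem_ok j -> D <= \sum_(0 <= k < n | cov k j) x k].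

(** Weighted double counting over the uncovered samples: each one is covered with weight at least
    [D], while every point covers fewer than [h] of them, so [D] times their number is at most [h]
    times the total weight, hence at most [h * g * D]. *)
Lemma coverable_hits C js : coverable -> size js = M -> all elem_ok js ->
  (forall k, k < n -> count (fun j => cov k j && ~~ covered C j) js < h) ->
  g * h <= count (covered C) js.
Proof.
move=> [D [x [D0 hx hc]]] sjs ok left.
set rem := [seq j <- js | ~~ covered C j].
have sz : count (covered C) js + size rem = 2 * g * h.
  by rewrite -ME -sjs size_filter count_predC.
suff : size rem <= g * h by lia.
rewrite -(leq_pmul2r D0).
have -> : size rem * D = \sum_(j <- rem) D by rewrite big_const_seq count_predT iter_addn_0 mulnC.
apply: (@leq_trans (\sum_(j <- rem) \sum_(0 <= k < n) (cov k j * x k))).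
  rewrite !big_seq; apply: leq_sum => j; rewrite mem_filter => /andP[_ /(allP ok) jok].
  apply: leq_trans (hc _ jok) _; rewrite big_mkcond; apply: leq_sum => k _.
  by case: cov; rewrite ?mul1n.
rewrite exchange_big /=.
apply: (@leq_trans (\sum_(0 <= k < n) h * x k)); last first.
  by rewrite -big_distrr /= [g * h]mulnC -mulnA leq_mul2l hx orbT.
rewrite !big_nat; apply: leq_sum => k /= kn; rewrite -big_distrl /= leq_mul2r.
apply/orP; right; apply: leq_trans (ltnW (left _ kn)).
rewrite -count_filter -/rem -sum1_count [X in _ <= X]big_mkcond.
by apply: leq_sum => j _; case: cov.
Qed.

(** Sequences of [2 * g] optional picks instead of sets: the union bound then runs over exactly
    [n.+1 ^ (2 * g)] objects. *)
Definition pick_family := {ffun 'I_(2 * g) -> 'I_n.+1}.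

(* The value [n] stands for the absence of a pick. *)
Definition picks (f : pick_family) : seq nat :=
  [seq k <- [seq val (f a) | a <- enum 'I_(2 * g)] | k < n].

Lemma picks_onto C : size C <= 2 * g -> all (fun k => k < n) C ->
  exists f : pick_family, covered (picks f) =1 covered C.
Proof.
move=> sC /allP hC; exists [ffun a : 'I_(2 * g) => inord (nth n C a)] => j.
apply: eq_has_r => k; rewrite mem_filter; apply/andP/idP => [[kn /mapP[a _]]|kC].
  rewrite ffunE /=; case: (ltnP a (size C)) => ha.
    by rewrite inordK ?ltnS ?(ltnW (hC _ (mem_nth _ ha))) // => ->; apply: mem_nth.
  by rewrite nth_default // inordK // => ek; rewrite ek ltnn in kn.
split; first exact: hC.
have ia : index k C < 2 * g by rewrite (leq_trans _ sC) // index_mem.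
apply/mapP; exists (Ordinal ia); first by rewrite mem_enum.
by rewrite ffunE /= nth_index // inordK // ltnS ltnW // hC.
Qed.

(** The failure credit of one round: each of the at most [n.+1 ^ (2 * g)] bad families starts with
    the potential [2 ^ M / 4 ^ M]. *)
Definition eps : R := ((n.+1 ^ (2 * g))%:R * 2 ^+ M / 4 ^+ M)%R.

Lemma eps_ge0 : (0 <= eps)%R.
Proof. by rewrite divr_ge0 ?mulr_ge0 ?exprn_ge0 ?ler0n. Qed.

Local Notation pot := (potential (fun f : pick_family => covered (picks f))).

Lemma potential_nil Us : (pot Us [::] <= eps)%R.
Proof.
rewrite /potential /eps -mulr_suml ler_wpM2r ?invr_ge0 ?exprn_ge0 ?ler0n //.
have -> : n.+1 ^ (2 * g) = #|{: pick_family}| by rewrite card_ffun !card_ord.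
rewrite -sum1_card natr_sum mulr_suml big_mkcond /=; apply: ler_sum => f _.
by case: ifP => _; rewrite ?expr0 ?subn0 // mul1r exprn_ge0 ?ler0n.
Qed.

(** The picks cover at least [g * h] samples. If they form a bad family, their term in the final
    potential is at least [16 ^ (g * h) / 4 ^ (2 * g * h) = 1], so the credit pays for the failure;
    otherwise they cover at least one sixteenth of the elements. *)
Lemma round_quality Us C js (psi phi : R) : coverable ->
  all elem_ok Us -> {subset js <= Us} -> size js = M ->
  size C <= 2 * g -> all (fun k => k < n) C ->
  (forall k, k < n -> count (fun j => cov k j && ~~ covered C j) js < h) ->
  (0 <= psi)%R -> (psi + pot Us js <= phi)%R ->
  (1 <= phi)%R \/ 16 * size [seq j <- Us | ~~ covered C j] <= 15 * size Us.
Proof.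
move=> cv okU sub sjs sC hC left psi0 hphi.
have okjs : all elem_ok js by apply/allP => j /sub /(allP okU).
have hits := coverable_hits cv sjs okjs left.
have [f hf] := picks_onto sC hC.
case bf: (bad (fun f : pick_family => covered (picks f)) Us f); last first.
  right; move: bf; rewrite /bad (eq_count hf) => /negbT; rewrite -leqNgt => bf.
  have := count_predC (covered C) Us.
  have : size [seq j <- Us | ~~ covered C j] = count (predC (covered C)) Us by rewrite size_filter.
  lia.
left; apply: le_trans hphi; rewrite -[X in (X <= _)%R]add0r lerD // /potential.
rewrite (bigD1 f) //= (eq_count hf) sjs subnn expr0 mulr1.
rewrite -[X in (X <= _)%R]addr0 lerD //; last first.
  by apply: sumr_ge0 => f' _; rewrite mulr1 divr_ge0 ?exprn_ge0 ?ler0n.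
rewrite ler_pdivlMr ?exprn_gt0 ?ltr0n // mul1r ME -mulnA exprM.
have -> : (4 ^+ 2 = 16 :> R)%R by ring.
by rewrite ler_weXn2l // ler1n.
Qed.

Definition round_vars :=
  [:: vK; vC; vNU; vQ; vEl; vLen; aU; vU; aMark; aAdj; vE; vR; aLst; aCnt].

Definition round_cost (u : nat) : nat :=
  15 * n + 17 * (M * L) + 15 * M + 2 * g * (12 * u + 12) + 12.

(** [psi] is reserved for what follows the round. The case [1 <= phi] of an earlier failure is
    included because time and memory must be controlled on every run; the conjunct [phi < 1] of the
    conclusion lets the caller exclude that case whenever it relies on the quality of this round. *)
Lemma round_spec (m : memory) (phi psi : R) : env m ->
  all elem_ok (elems m) -> m vU 0 <= n -> (0 <= psi)%R ->
  (1 <= phi)%R \/ (psi + eps <= phi)%R ->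
  fspec round m phi (round_cost (m vU 0)) (fun m' phi' => exists C,
    [/\ agree round_vars m m', all (fun k => k < n) C, size C <= 2 * g & set_edge m m' C] /\
    (elems m' = [seq j <- elems m | ~~ covered C j] /\
     ((1 <= phi')%R \/ (phi < 1)%R /\ (psi <= phi')%R /\
       (coverable -> 16 * size (elems m') <= 15 * size (elems m))))).
Proof.
move=> em okU un psi0 hphi.
have {}hphi : (1 <= phi)%R \/ (phi < 1)%R /\ (psi + eps <= phi)%R.
  by case: (lerP 1 phi) hphi => [h1|lt1 []//]; [left|right].
have okU' : all (fun j => (j < n) && (len j <= L)) (elems m).
  by apply: sub_all okU => j /andP[-> /andP[_ ->]].
have okn : all (fun j => j < n) (elems m).
  by apply: sub_all okU => j /andP[->].
rewrite /round /round_cost addnS; apply: fspec_if => /=; first by lia.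
  move=> u0.
  apply: fspec_le.
    apply: fspec_seq; apply: (dspec_fspec (clear_spec em)) => m1 [ag1 hcnt].
    have em1 : env m1 by apply: env_agree ag1 em.
    have uE1 : m1 vU 0 = m vU 0 by rewrite ag1.
    have eE1 : elems m1 = elems m.
      by rewrite /elems uE1; apply: mkseq_eq => q _; rewrite ag1.
    have sU : 0 < size (elems m) <= n by rewrite size_mkseq u0.
    apply: (@fspec_seq _ _ _ _ _ _ _ _ (M * (8 * L + 15) + 3)
      (9 * (M * L) + 11 * n + 2 * g * (12 * m vU 0 + 12) + 3)).
    suff Hs : fspec sample m1 phi (M * (8 * L + 15) + 3) (fun m' phi' => exists js,
      [/\ agree sample_vars m1 m', size js = M & {subset js <= elems m}] /\
      [/\ forall e, e < M -> m' aMark e = 0,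
         forall k, k < n -> samples m' k = [seq e <- iota 0 M | cov k (nth 0 js e)] &
         (1 <= phi')%R \/ (phi < 1)%R /\ (psi + pot (elems m) js <= phi')%R]).
      apply: fspec_weaken Hs _ (lexx _) (leqnn _).
      move=> m2 phi2 [js [[ag2 sjs sub] [hmark hs hphi2]]].
      have em2 : env m2 by apply: env_agree ag2 em1.
      have uE2 : m2 vU 0 = m vU 0 by rewrite ag2.
      have eE2 : elems m2 = elems m.
        by rewrite /elems uE2; apply: mkseq_eq => q _; rewrite ag2 ?ag1.
      have okjs : all elem_ok js by apply/allP => j /sub /(allP okU).
      have un2 : m2 vU 0 <= n by rewrite uE2.
      have okn2 : all (fun j => j < n) (elems m2) by rewrite eE2.
      have hsum := sum_counts sjs okjs hs.
      apply: fspec_le; last first.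
        by apply: (leq_trans _ (leq_add (leq_add (leq_add (leq_mul (leqnn 9) hsum) (leqnn (11 * n)))
          (leqnn (2 * g * (12 * m vU 0 + 12)))) (leqnn 3))); rewrite -uE2; exact: leqnn.
      apply: (dspec_fspec (scan_spec em2 okn2 un2 sjs hmark hs)) => m3 [C [[ag3 hC sC adj3] [el3 left]]].
      exists C; split; split=> //.
      - apply: agree_trans (agree_sub _ ag1) _ => //.
        by apply: agree_trans (agree_sub _ ag2) (agree_sub _ ag3).
      - by move=> z; rewrite adj3 ag2 // ag1.
      - by rewrite el3 eE2.
      - case: hphi2 => [|[lt_phi hphi2]]; first by left.
        case: (lerP 1 phi2) => [|lt1]; [by left|right; split=> //; split].
          by apply: le_trans hphi2; rewrite lerDl potential_ge0.
        move=> cv; rewrite el3 eE2.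
        have [h1|//] := round_quality cv okU sub sjs sC hC left psi0 hphi2.
        by move: lt1; rewrite ltNge h1.
    case: hphi => [hphi|[lt_phi hphi]].
      (* After a failure there is no credit to spend on this round: over the empty index type [void]
         the potential vanishes, and [sample_spec] still yields time and memory. *)
      have pot0 : (phi + potential (fun (f : void) (_ : nat) => false) (elems m) [::] <= phi)%R.
        by rewrite /potential big_pred0 ?addr0 // => -[].
      apply: fspec_weaken (sample_spec em1 eE1 okU' sU hcnt pot0) _ (lexx _) (leqnn _).
      move=> m2 phi2 [js [[ag2 sjs sub h2] [hm hs]]]; exists js; split; split=> //.
      by left; apply: le_trans hphi (le_trans _ h2); rewrite lerDl potential_ge0.
    have pot0 : (psi + pot (elems m) [::] <= phi)%R.
      by apply: le_trans hphi; rewrite lerD2l potential_nil.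
    apply: fspec_weaken (sample_spec em1 eE1 okU' sU hcnt pot0) _ (lexx _) (leqnn _).
    move=> m2 phi2 [js [[ag2 sjs sub h2] [hm hs]]]; exists js; split; split=> //.
    by right.
  rewrite mulnDr; lia.
rewrite -eqn0Ngt => /eqP u0.
apply: fspec_le; first apply: (@spec_set _ _ _ _ _ _ _ _ _ 0) => /=; [lia|lia| |lia].
have e0 : elems m = [::] by rewrite /elems u0.
exists [::]; split; split=> //.
- by apply: agree_upd.
- by move=> z; rewrite updE /= andbF.
- by rewrite e0 /elems updE /= u0.
- case: hphi => [|[lt_phi hphi]]; [by left|right; split=> //; split].
    by apply: le_trans hphi; rewrite lerDl eps_ge0.
  by move=> _; rewrite e0 /elems updE /= u0.
Qed.

(** * All the rounds of an instance *)

Hypotheses (lg_gt0 : 0 < lg) (n_lg : n < 2 ^ lg) (W_lg : 15 * lg < W).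

Lemma init_row_spec (m : memory) : env m ->
  dspec init_row m (n * 5 + 3) (fun m' =>
    [/\ agree [:: vK; aAdj] m m', off_row n i aAdj m m' &
      forall k, k < n -> m' aAdj (i * n + k) = if i < n then m aAdj (n * n + k) else 0]).
Proof.
move=> em.
pose Inv k (m1 : memory) := [/\ agree [:: vK; aAdj] m m1, m1 vK 0 = k,
  off_row n i aAdj m m1 &
  forall k', k' < k -> m1 aAdj (i * n + k') = if i < n then m aAdj (n * n + k') else 0].
have inb : i * n + n <= n * n + n by nia.
apply: dspec_le; first apply: (@dspec_for_const _ _ _ _ _ _ _ n 2 Inv).
- lia.
- lia.
- move=> k m1 _ [ag mK _ _]; have [[mN _ _ _] _] : env m1 by apply: env_agree ag em.
  by rewrite /= mK mN; split=> //; lia.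
- move=> k m1 kn [ag mK off hk].
  have [[mN _ _ _] [mI _ _]] : env m1 by apply: env_agree ag em.
  have step v : v = (if i < n then m aAdj (n * n + k) else 0) ->
      upd m1 aAdj (i * n + k) v vK 0 = k /\
      Inv k.+1 (upd (upd m1 aAdj (i * n + k) v) vK 0 k.+1).
    move=> ev; rewrite updE /=; split=> //; split; rewrite ?updE //=.
    - by do 2![apply: agree_upd => //].
    - move=> z hz; rewrite !updE /=; case: eqP => [e|_]; last exact: off.
      by rewrite e row_outside ?eqxx in hz.
    - move=> k'; rewrite ltnS !updE /= eqn_add2l leq_eqVlt.
      by case: eqP => [->//|_]; apply: hk.
  apply: dspec_if => /=; rewrite ?mI ?mN ?mK; first by lia.
    move=> lt_in; apply: dspec_set => /=; rewrite ?mI ?mN ?mK; [do !split; lia|do !split; lia|].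
    by apply: step; rewrite lt_in off // row_outside // gtn_eqF.
  move=> ge_in; apply: dspec_set => /=; rewrite ?mI ?mN ?mK; [do !split; lia|lia|].
  by apply: step; rewrite (negPf ge_in).
- by move=> m1 [ag _ off hk]; split.
- by split; rewrite ?updE //=; apply: agree_upd.
- lia.
Qed.

Lemma collect_spec (m : memory) : env m ->
  dspec collect m (n * 10 + 5) (fun m' =>
    agree [:: vU; vEl; vLen; aU] m m' /\ elems m' = [seq j <- iota 0 n | elem_ok j]).
Proof.
move=> em.
have tS j : j < n -> take j.+1 (iota 0 n) = rcons (take j (iota 0 n)) j.
  by move=> jn; rewrite (take_nth 0) ?size_iota // nth_iota.
pose Inv j (m1 : memory) := [/\ agree [:: vU; vEl; vLen; aU] m m1, m1 vEl 0 = j &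
  elems m1 = [seq j' <- take j (iota 0 n) | elem_ok j']].
apply: dspec_le.
  apply: dspec_seq; apply: dspec_set => /=; [lia|lia|].
  apply: (@dspec_for_const _ _ _ _ _ _ _ n 7 Inv).
  - lia.
  - lia.
  - move=> j m1 _ [ag mEl _]; have [[mN _ _ _] _] : env m1 by apply: env_agree ag em.
    by rewrite /= mEl mN; split=> //; lia.
  - move=> j m1 jn [ag mEl hel].
    have em1 : env m1 by apply: env_agree ag em.
    have uj : m1 vU 0 <= j.
      have <- : size (elems m1) = m1 vU 0 by rewrite size_mkseq.
      rewrite hel size_filter (leq_trans (count_size _ _)) // size_take_min.
      exact: geq_minl.
    apply: (@dspec_seq _ _ _ _ _ _ _ 2 4).
    apply: dspec_weaken (set_len_spec em1 mEl jn) _ (leqnn _) => m2 [ag2 mLen2].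
    have ag02 : agree [:: vU; vEl; vLen; aU] m m2 by apply: agree_trans ag (agree_sub _ ag2).
    have [[mN2 _ mL2 _] _] : env m2 by apply: env_agree ag02 em.
    have mEl2 : m2 vEl 0 = j by rewrite ag2.
    have uE2 : m2 vU 0 = m1 vU 0 by rewrite ag2.
    have aE2 q : m2 aU q = m1 aU q by rewrite ag2.
    have okE : elem_ok j = (0 < len j) && ~~ (L < len j) by rewrite /elem_ok jn -leqNgt.
    apply: dspec_if => /=; rewrite ?mL2 ?mLen2 -?okE; first by do !split; lia.
      move=> ok; apply: (@dspec_seq _ _ _ _ _ _ _ 1 1).
      apply: dspec_set => /=; rewrite ?uE2 ?mEl2; [lia|lia|].
      apply: dspec_set => /=; rewrite ?updE /= ?uE2; [lia|do !split; lia|].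
      split; rewrite ?updE //=; split; rewrite ?updE //=.
      + by do 3![apply: agree_upd => //].
      + rewrite tS // filter_rcons ok -hel /elems !updE /= addn1 mkseq_rcons.
        congr rcons; last by rewrite !updE /= eqxx.
        by apply: mkseq_eq => q qu; rewrite !updE /= ltn_eqF // aE2.
    move=> ok; apply: dspec_le; first apply: dspec_set => /=; [lia|lia| |lia].
    split; rewrite ?updE //=; split; rewrite ?updE //=.
    + by do 2![apply: agree_upd => //].
    + rewrite tS // filter_rcons (negPf ok) -hel /elems !updE /= uE2.
      by apply: mkseq_eq => q qu; rewrite !updE /= aE2.
  - move=> m1 [ag mEl ->]; split=> //.
    by rewrite take_oversize ?size_iota.
  - split; rewrite ?updE //= ?take0 //.
    by do 2![apply: agree_upd => //].
lia.
Qed.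

Definition cover_vars := [:: vRound, aDone & round_vars].

Definition n_elems := count elem_ok (iota 0 n).

Definition cover_cost : nat :=
  15 * n + 15 * lg * (round_cost n_elems + 3) + 20.

(** The inequality [(1 + 1 / b) ^ b >= 2] raised to the power [t]. With [b = 15], fifteen successful
    rounds at least halve the number of uncovered elements, and [15 * lg] rounds leave fewer than
    one. *)
Lemma expn_double b t : 0 < b -> 2 ^ t * b ^ (b * t) <= b.+1 ^ (b * t).
Proof.
move=> b0; rewrite !expnM -expnMn; case: t => [|t]; first by rewrite !expn0.
rewrite leq_exp2r //.
(* Bernoulli's inequality *)
have bern p : (b + p) * b ^ p <= b * b.+1 ^ p.
  elim: p => [|p IH]; first by rewrite addn0.
  rewrite [b.+1 ^ _]expnS [b ^ p.+1]expnS; move: (b ^ p) (b.+1 ^ p) IH => x y; nia.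
by have := bern b; rewrite addnn -mul2n [2 * b]mulnC -mulnA leq_pmul2l.
Qed.

Lemma rounds_empty u : u <= n -> 16 ^ (15 * lg) * u <= 15 ^ (15 * lg) * n -> u = 0.
Proof.
move=> un hu; case: (posnP u) => // u0; exfalso.
have hlg : 2 ^ lg * 15 ^ (15 * lg) <= 16 ^ (15 * lg) by apply: expn_double.
have p15 : 0 < 15 ^ (15 * lg) by rewrite expn_gt0.
have : 16 ^ (15 * lg) <= 15 ^ (15 * lg) * n.
  by apply: leq_trans hu; rewrite leq_pmulr.
have : 15 ^ (15 * lg) * n < 15 ^ (15 * lg) * 2 ^ lg by rewrite ltn_pmul2l.
by rewrite [_ * 2 ^ lg]mulnC; lia.
Qed.

Lemma covered_cat C C' j : covered (C ++ C') j = covered C j || covered C' j.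
Proof. exact: has_cat. Qed.

(** [empty] is an outcome of the run: an instance whose guess is too small may stay unsolved without
    any failure, and may also be solved by luck, with the same bound on the number of picks. *)
Lemma cover_instance_spec (m : memory) (phi psi : R) : env m -> (0 <= psi)%R ->
  (1 <= phi)%R \/ (psi + eps *+ (15 * lg) <= phi)%R ->
  fspec cover_instance m phi cover_cost (fun m' phi' => exists C (empty : bool),
    [/\ agree cover_vars m m', all (fun k => k < n) C, size C <= 2 * g * (15 * lg) &
        off_row n i aAdj m m'] /\
    [/\ forall k, k < n -> (m' aAdj (i * n + k) != 0) =
          ((i < n) && (m aAdj (n * n + k) != 0)) || (k \in C),
        forall z, m' aDone z = if [&& z == i, i < n & empty] then 1 else m aDone z,
        empty -> forall j, elem_ok j -> covered C j &
        (1 <= phi')%R \/ (phi < 1)%R /\ (psi <= phi')%R /\ (coverable -> empty)]).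
Proof.
move=> em psi0 hphi.
have {}hphi : (1 <= phi)%R \/ (phi < 1)%R /\ (psi + eps *+ (15 * lg) <= phi)%R.
  by case: (lerP 1 phi) hphi => [h1|lt1 []//]; [left|right].
set Us := [seq j <- iota 0 n | elem_ok j].
have sUs : size Us = n_elems by rewrite size_filter.
have Usn : n_elems <= n by rewrite /n_elems (leq_trans (count_size _ _)) ?size_iota.
have okUs : all elem_ok Us by apply: filter_all.
pose RR := 15 * lg.
pose Inv (m0 : memory) t (m1 : memory) phi1 := exists C,
  [/\ agree (vRound :: round_vars) m0 m1, m1 vRound 0 = t, all (fun k => k < n) C,
      size C <= 2 * g * t & set_edge m0 m1 C] /\
  [/\ elems m1 = [seq j <- Us | ~~ covered C j] &
      (1 <= phi1)%R \/ (phi < 1)%R /\ (psi + eps *+ (RR - t) <= phi1)%R /\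
        (coverable -> 16 ^ t * size (elems m1) <= 15 ^ t * n)].
apply: fspec_le.
  apply: fspec_seq; apply: (dspec_fspec (init_row_spec em)) => m1 [ag1 off1 adj1].
  have em1 : env m1 by apply: env_agree ag1 em.
  apply: fspec_seq; apply: (dspec_fspec (collect_spec em1)) => m2 [ag2 el2].
  have em2 : env m2 by apply: env_agree ag2 em1.
  apply: (@fspec_seq _ _ _ _ _ _ _ _ _ 2).
  apply: (@fspec_for _ _ _ _ _ _ _ RR (fun _ => round_cost n_elems) (Inv m2)).
  - lia.
  - exact: W_lg.
  - move=> t m3 phi3 _ [C [[ag3 mR _ _ _] _]].
    have [_ [_ mLg _]] : env m3 by apply: env_agree ag3 em2.
    by rewrite /= mR mLg; split=> //; do !split; lia.
  - move=> t m3 phi3 tR [C [[ag3 mR hC sC adj3] [el3 q3]]].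
    have em3 : env m3 by apply: env_agree ag3 em2.
    have ok3 : all elem_ok (elems m3).
      by rewrite el3; apply/allP => j; rewrite mem_filter => /andP[_ /(allP okUs)].
    have u3 : m3 vU 0 <= n_elems.
      have <- : size (elems m3) = m3 vU 0 by rewrite size_mkseq.
      by rewrite el3 -sUs size_filter count_size.
    have psi0' : (0 <= psi + eps *+ (RR - t.+1))%R.
      by rewrite addr_ge0 // mulrn_wge0 // eps_ge0.
    have q3' : (1 <= phi3)%R \/ (psi + eps *+ (RR - t.+1) + eps <= phi3)%R.
      case: q3 => [|[_ [q3 _]]]; [by left|right].
      by rewrite -addrA -mulrSr subnSK.
    apply: fspec_le.
      apply: fspec_weaken (round_spec em3 ok3 (leq_trans u3 Usn) psi0' q3') _ (lexx _) (leqnn _).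
      move=> m4 phi4 [C' [[ag4 hC' sC' adj4] [el4 q4]]].
      split; first by rewrite ag4.
      exists (C ++ C'); split; split; rewrite ?updE //=.
      + by apply: agree_upd => //; apply: agree_trans ag3 (agree_sub _ ag4).
      + by rewrite all_cat hC.
      + by rewrite size_cat mulnS addnC leq_add.
      + move=> z; rewrite updE /= adj4 adj3 mem_cat.
        by case: (_ == i); case: (_ \in C); case: (_ \in C').
      + rewrite /elems updE /= (_ : mkseq _ _ = elems m4); last first.
          by apply: mkseq_eq => q _; rewrite updE.
        rewrite el4 el3 -filter_predI; apply: eq_filter => j /=.
        by rewrite covered_cat negb_or andbC.
      + have eE : size (elems (upd m4 vRound 0 t.+1)) = size (elems m4).
          by rewrite !size_mkseq updE.
        rewrite eE; case: q4 => [|[lt1 [h4 hc4]]]; [by left|].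
        case: q3 => [q3|[lt_phi [q3 hc3]]]; first by move: lt1; rewrite ltNge q3.
        right; split; [exact: lt_phi|split; [exact: h4|]] => cv; have := hc4 cv; have := hc3 cv.
        rewrite !expnS -![_ * _ ^ t * _]mulnA => h1 h2.
        apply: (@leq_trans (15 * (16 ^ t * size (elems m3)))); last by rewrite leq_mul2l h1.
        by rewrite mulnCA [15 * _]mulnCA leq_mul2l h2 orbT.
    rewrite /round_cost leq_add2r leq_add2l leq_mul2l; apply/orP; right.
    by rewrite leq_add2r leq_mul2l u3 orbT.
  - move=> m3 phi3 [C [[ag3 mR hC sC adj3] [el3 q3]]].
    have em3 : env m3 by apply: env_agree ag3 em2.
    have [[mN3 _ _ _] [mI3 _ _]] := em3.
    have ag03 : agree cover_vars m m3.
      apply: agree_trans (agree_sub _ ag1) _ => //.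
      by apply: agree_trans (agree_sub _ ag2) (agree_sub _ ag3).
    have u3 : size (elems m3) = m3 vU 0 by rewrite size_mkseq.
    have u3n : m3 vU 0 <= n.
      by rewrite -u3 el3 size_filter (leq_trans (count_size _ _)) // sUs.
    set empty := m3 vU 0 == 0.
    have common m4 phi4 : agree cover_vars m3 m4 -> m4 aAdj = m3 aAdj ->
        (forall z, m4 aDone z = if [&& z == i, i < n & empty] then 1 else m3 aDone z) ->
        phi4 = phi3 -> exists C (empty : bool),
        [/\ agree cover_vars m m4, all (fun k => k < n) C, size C <= 2 * g * (15 * lg) &
            off_row n i aAdj m m4] /\
        [/\ forall k, k < n -> (m4 aAdj (i * n + k) != 0) =
              ((i < n) && (m aAdj (n * n + k) != 0)) || (k \in C),
            forall z, m4 aDone z = if [&& z == i, i < n & empty] then 1 else m aDone z,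
            empty -> forall j, elem_ok j -> covered C j &
            (1 <= phi4)%R \/ (phi < 1)%R /\ (psi <= phi4)%R /\ (coverable -> empty)].
      move=> ag4 adj4 dn4 ->; exists C, empty; split; split=> //.
      + exact: agree_trans ag03 ag4.
      + by move=> z hz; rewrite adj4 adj3 (negPf hz) /= ag2 // off1.
      + move=> k kn; rewrite adj4 adj3 row_outside // modnMDl modn_small // eqxx /=.
        rewrite ag2 // adj1 //; case: (k \in C); rewrite ?orbT ?orbF //.
        by case: (i < n).
      + by move=> z; rewrite dn4 ag3 // ag2 // ag1.
      + move=> /eqP e0 j jok; have : j \notin elems m3.
          by rewrite /elems e0.
        rewrite el3 mem_filter mem_filter jok mem_iota add0n (elem_ok_lt jok) !andbT.
        by rewrite negbK.
      + case: q3 => [|[lt_phi [h3 hc3]]]; [by left|right]; split; [exact: lt_phi|split=> [|cv]].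
          by move: h3; rewrite subnn mulr0n addr0.
        by apply/eqP; apply: rounds_empty => //; rewrite -u3; apply: hc3.
    have W0 := ltnW W1.
    apply: fspec_if => /=; rewrite ?mI3 ?mN3; first by [].
      move=> /andP[e0 lt_in]; apply: spec_set => /=; rewrite ?mI3; [exact: W0|exact: W1|].
      apply: common => //; first by apply: agree_upd.
      by move=> z; rewrite updE /= lt_in /empty e0 !andbT.
    move=> hne; apply: spec_set => /=; [exact: W0|exact: W0|].
    apply: common => //; first by apply: agree_upd.
    by move=> z; rewrite updE /= [(i < n) && _]andbC (negPf hne) andbF.
  - exists [::]; split; split; rewrite ?updE //=.
    + by apply: agree_upd.
    + by move=> z; rewrite updE /= andbF.
    + rewrite /elems updE /= (_ : mkseq _ _ = elems m2) ?el2 ?filter_predT //.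
    + have -> : size (elems (upd m2 vRound 0 0)) = n_elems.
        by rewrite -sUs /Us -el2 !size_mkseq updE.
      case: hphi => [|[lt_phi hphi]]; [by left|right].
      split; first exact: lt_phi.
      by rewrite subn0 !expn0 !mul1n.
rewrite sum_nat_const_nat subn0 /cover_cost -/RR; lia.
Qed.

End Instance.

(** * Guessing the optimum *)

Section Build.
Local Open Scope nat_scope.
Variables (R : realType) (W : nat) (dist : nat -> nat -> R).
Variable E : memory -> bool.
Local Notation dspec := (dspec W dist E).
Local Notation fspec := (fspec W dist E).
Variables n lg kappa : nat.
Hypothesis n_gt0 : 0 < n.
Hypothesis W_big : 16 * (n + 1) * (n + 1) <= W.
Hypothesis W_samples : (n + 1) * (4 * n * (lg * kappa) + 1) <= W.
Hypotheses (W_lg : 15 * lg < W) (W_kappa : kappa < W).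
Hypothesis dist_total : forall j x y, j < n -> x < n -> y < n -> x != y ->
  dist j x != dist j y.
Hypothesis dist_self : forall j x, j < n -> x < n -> x != j -> closer dist j j x.
Hypotheses (kappa_gt0 : 0 < kappa) (lg_gt0 : 0 < lg) (n_lg : n < 2 ^ lg).
Hypotheses (n_lg1 : n <= 2 ^ lg.-1) (lgE : lg = (up_log 2 n).+1).

Local Notation rank := (rank dist n).
Let h := lg * kappa.
Let RR := 15 * lg.

(* An arbitrary navigable graph, to which the output is compared. *)
Variable Hr : rel nat.
Hypothesis Hr_nav : forall i j, i < n -> j < n -> i != j ->
  exists2 k, k < n & Hr i k && (rank j k < rank j i).

Definition opt (i : nat) : nat := count (Hr i) (iota 0 n).

Definition edge (m : memory) (i k : nat) : bool := m aAdj (i * n + k) != 0.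

Definition degree (m : memory) (i : nat) : nat := count (edge m i) (iota 0 n).

(** The common instance and instance [i] each contribute at most [2 * g] picks in each of [RR]
    rounds, and a row is settled with [g < 2 * maxn 1 (opt i)]: hence the factor 8. The [maxn 1] is
    there for the initial guess [g = 1]. *)
Definition good_row (m : memory) (i : nat) : Prop :=
  (forall j, j < n -> i != j -> exists2 k, k < n & edge m i k && (rank j k < rank j i)) /\
  degree m i <= 8 * RR * maxn 1 (opt i).

(** [aDone] stays 0 at [n], so the common instance is solved afresh for every guess. *)
Definition top_env (g : nat) (m : memory) : Prop :=
  [/\ m aN 0 = n, m vH 0 = h, m vG 0 = g & m vLg 0 = lg] /\
  [/\ forall j, j < n -> row_sorted dist n j m & m aDone n = 0].

Let W1 : 1 < W. Proof. by lia. Qed.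

Lemma rank_self j : j < n -> rank j j = 0.
Proof.
move=> jn; apply/eqP; rewrite -leqn0 leqNgt -has_count; apply/hasP => -[y].
rewrite mem_iota add0n => /= yn yj.
have : y != j by apply: contraTneq yj => ->; rewrite closer_irr.
move=> /(dist_self jn yn) jy.
by have := closer_trans jy yj; rewrite closer_irr.
Qed.

Lemma rank_gt0 j i : j < n -> i < n -> i != j -> 0 < rank j i.
Proof.
move=> jn i_n ne; rewrite -has_count; apply/hasP; exists j; first by rewrite mem_iota.
exact: dist_self.
Qed.

(** * The analysis of one guess *)

Section Guess.
Variable g : nat.
Hypotheses (g_gt0 : 0 < g) (g_lt : g < 2 * n).
Let L := (n + g - 1) %/ g.
Let M := 2 * g * h.

Lemma width_bounds : [/\ 0 < L, L <= n, n <= g * L & g * L <= 3 * n].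
Proof.
have h1 : g * L <= n + g - 1 by rewrite mulnC leq_trunc_div.
have h2 : n + g - 1 < (L + 1) * g by rewrite addn1 ltn_ceil.
split; [|rewrite -(leq_pmul2l g_gt0); nia|nia|nia].
rewrite divn_gt0 //; lia.
Qed.

Let L_gt0 : 0 < L. Proof. by have [] := width_bounds. Qed.
Let L_le : L <= n. Proof. by have [] := width_bounds. Qed.
Let h_gt0 : 0 < h. Proof. by rewrite muln_gt0 lg_gt0. Qed.
Let W_M : (n + 1) * (M + 1) <= W.
Proof.
apply: leq_trans W_samples; rewrite leq_mul2l leq_add2r /M leq_mul2r; lia.
Qed.

Lemma coverable_opt i : i < n -> opt i <= g -> coverable dist n g L i.
Proof.
move=> i_n og; exists 1, (Hr i); split=> //.
  rewrite muln1; apply: leq_trans og; rewrite /opt -sum1_count [X in _ <= X]big_mkcond /index_iota subn0.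
  by apply: leq_sum => k _; case: Hr.
move=> j /andP[jn hl].
(* The point [i] itself is no element of its instance, its prefix being empty. *)
have ij : i != j.
  by apply: contraTneq hl => ->; rewrite /len jn rank_self.
have [k kn /andP[hk rk]] := Hr_nav i_n jn ij.
rewrite big_mkcond (big_rem k) /=; last by rewrite mem_index_iota.
by rewrite /cov /len i_n rk hk.
Qed.

Lemma coverable_top : coverable dist n g L n.
Proof.
have [_ _ nL _] := width_bounds.
exists L, (fun _ => 1); split=> //; first by rewrite sum_nat_const_nat subn0 muln1.
move=> j /andP[jn _]; rewrite sum1_count /index_iota subn0.
rewrite (@eq_count _ _ (fun k => rank j k < L)); last first.
  by move=> k; rewrite /cov /len ltnn.
by rewrite (count_rank dist_total) //; lia.
Qed.

(** For a fixed [j] the ranks of the points are distinct, so at most [L] points [i] have a rank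
    between 1 and [L]. *)
Lemma sum_n_elems : \sum_(0 <= i < n) n_elems dist n L i <= n * L.
Proof.
rewrite (eq_bigr (fun i => \sum_(0 <= j < n) elem_ok dist n L i j)); last first.
  move=> i _; rewrite /n_elems -sum1_count big_mkcond /index_iota subn0.
  by apply: eq_bigr => j _; case: elem_ok.
rewrite exchange_big /=.
have -> : n * L = \sum_(0 <= j < n) L by rewrite sum_nat_const_nat subn0.
rewrite !big_nat; apply: leq_sum => j /= jn.
apply: (@leq_trans (count (fun i => 0 < rank j i <= L) (iota 0 n))).
  rewrite -sum1_count [X in _ <= X]big_mkcond /index_iota subn0 !big_seq.
  apply: leq_sum => i; rewrite mem_iota add0n => /= i_n.
  by rewrite /elem_ok /len i_n jn /=; case: ifP.
rewrite -(count_map (rank j) (fun r => 0 < r <= L)) (permP (rank_perm_iota dist_total jn)).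
have -> : L = size (iota 1 L) by rewrite size_iota.
rewrite -size_filter; apply: uniq_leq_size; first by rewrite filter_uniq ?iota_uniq.
by move=> r; rewrite mem_filter !mem_iota size_iota; lia.
Qed.

Definition guess_cost : nat := 100 * (92 * (n * n * (lg * h))).

Local Notation eps := (eps R n g M).

(* [ii] instances have been processed, in the order [n], [n - 1], ... *)
Definition guess_inv (psi : R) (ii : nat) (m : memory) (phi : R) : Prop :=
  (1 <= phi)%R \/
  [/\ (psi + eps *+ (RR * (n.+1 - ii)) <= phi)%R,
     0 < ii -> (forall j, j < n -> exists2 k, k < n & edge m n k && (rank j k < L)) /\
       degree m n <= 2 * g * RR,
     forall i, i < n -> m aDone i != 0 -> good_row m i &
     forall i, i < n -> m aDone i = 0 ->
       if n < i + ii then g < opt i else g < 2 * maxn 1 (opt i)].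

Definition guess_env (m : memory) : Prop :=
  top_env g m /\ (m vL 0 = L /\ m vM 0 = M).

Lemma guess_env_agree (m m' : memory) : agree (vII :: vI :: cover_vars) m m' ->
  m' aDone n = 0 -> guess_env m -> guess_env m'.
Proof.
move=> ag d0 [[[e1 e2 e3 e4] [hr _]] [e5 e6]]; split; last by rewrite !ag.
split; split; rewrite ?d0 ?ag // => j jn y yn.
by have [r1 r2] := hr _ jn _ yn; rewrite !ag.
Qed.

Lemma edge_off_row i i' m m' : off_row n i aAdj m m' -> i' != i ->
  forall k, k < n -> edge m' i' k = edge m i' k.
Proof. by move=> off ne k kn; rewrite /edge off // row_outside. Qed.

Lemma degree_eq m m' i : (forall k, k < n -> edge m' i k = edge m i k) ->
  degree m' i = degree m i.
Proof. by move=> e; apply: eq_in_count => k; rewrite mem_iota add0n; apply: e. Qed.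

Lemma good_row_off i i' m m' : off_row n i aAdj m m' -> i' != i ->
  good_row m i' -> good_row m' i'.
Proof.
move=> off ne [nav deg]; have e := edge_off_row off ne; split; last by rewrite (degree_eq e).
move=> j jn ij; have [k kn hk] := nav j jn ij.
by exists k => //; rewrite e.
Qed.

Lemma degree_cover (m m' : memory) i (b : bool) C : all (fun k => k < n) C ->
  (forall k, k < n -> edge m' i k = (b && edge m n k) || (k \in C)) ->
  degree m' i <= b * degree m n + size C.
Proof.
move=> hC e; rewrite /degree (eq_in_count (a2 := predU (fun k => b && edge m n k) (mem C))).
  apply: (@leq_trans (count (fun k => b && edge m n k) (iota 0 n) + count (mem C) (iota 0 n))).
    by rewrite -count_predUI leq_addr.
  apply: leq_add; first by case: (b); rewrite ?mul1n // count_pred0.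
  rewrite -size_filter; apply: uniq_leq_size; first by rewrite filter_uniq ?iota_uniq.
  by move=> k; rewrite mem_filter => /andP[].
by move=> k; rewrite mem_iota add0n; apply: e.
Qed.

(** Barring a failure, the common instance ends empty by [coverable_top]. For [i < n], an instance
    that ends empty settles row [i]: its picks serve the [j] with [rank j i <= L] and the copied row
    [n] serves the others. If it does not end empty, [coverable_opt] gives [g < opt i], which
    justifies the next guess. *)
Lemma cover_step (psi : R) ii (m : memory) (phi : R) : (0 <= psi)%R -> ii <= n ->
  guess_env m -> m vI 0 = n - ii -> m aDone (n - ii) = 0 -> guess_inv psi ii m phi ->
  fspec cover_instance m phi (cover_cost dist n lg g L M (n - ii)) (fun m' phi' =>
    [/\ agree cover_vars m m', m' aDone n = 0 & guess_inv psi ii.+1 m' phi']).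
Proof.
move=> psi0 iin [[[mN mH mG mLg] [hr d0]] [mL mM]] mI dI hinv.
set i := n - ii in mI dI *.
have i_le : i <= n by apply: leq_subr.
have em : env dist n lg h L M i m by split; split.
pose psi' := (psi + eps *+ (RR * (n - ii)))%R.
have psi0' : (0 <= psi')%R by rewrite addr_ge0 // mulrn_wge0 // eps_ge0.
have hphi : (1 <= phi)%R \/ (psi' + eps *+ RR <= phi)%R.
  case: hinv => [|[hphi _ _ _]]; [by left|right].
  by rewrite -addrA -mulrnDr -mulnSr -subSn.
apply: fspec_weaken (cover_instance_spec n_gt0 W_big W_M dist_total L_gt0 L_le i_le
  h_gt0 g_gt0 (erefl M) lg_gt0 n_lg W_lg em psi0' hphi) _ (lexx _) (leqnn _).
move=> m' phi' [C [empty [[ag hC sC off] [adj dn cv q]]]].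
have dn' : m' aDone n = 0.
  by rewrite dn d0; case: eqP => //= <-; rewrite ltnn.
split=> //; case: q => [|[lt_phi [h' cv']]]; first by left.
case: hinv => [hinv|[_ top good todo]]; first by move: lt_phi; rewrite ltNge hinv.
right; split; first by rewrite subSS.
- move=> _; case: (posnP ii) => [ii0|ii_gt0]; last first.
    have ne : n != i by rewrite /i; clear -ii_gt0 n_gt0; lia.
    have [t1 t2] := top ii_gt0; have e := edge_off_row off ne.
    split; last by rewrite (degree_eq e).
    by move=> j jn; have [k kn hk] := t1 j jn; exists k => //; rewrite e.
  have ein : i = n by rewrite /i ii0 subn0.
  have emp : empty by apply: cv'; rewrite ein; apply: coverable_top.
  have adjn k : k < n -> edge m' n k = (k \in C).
    by move=> kn; rewrite /edge -{1}ein adj // ein ltnn.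
  split; last first.
    apply: leq_trans sC; have := @degree_cover m m' n false C hC adjn.
    by rewrite mul0n.
  move=> j jn; have jok : elem_ok dist n L i j by rewrite /elem_ok jn /len ein ltnn L_gt0 leqnn.
  have /hasP[k kC] := cv emp _ jok; rewrite /cov /len ein ltnn => rk.
  have kn : k < n by apply: (allP hC).
  by exists k => //; rewrite adjn // kC.
- move=> i' i'n; rewrite dn; case: (eqVneq i' i) => [ei|ne]; last first.
    by move=> d; apply: good_row_off off ne (good _ i'n d).
  rewrite ei in i'n *; rewrite i'n /= dI; case: ifP => // emp _.
  have ii_gt0 : 0 < ii by move: i'n; rewrite /i; clear; lia.
  have [t1 t2] := top ii_gt0.
  have adji k : k < n -> edge m' i k = (true && edge m n k) || (k \in C).
    by move=> kn; rewrite /edge adj // i'n.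
  split.
    move=> j jn ij; case: (leqP (rank j i) L) => hl.
      have jok : elem_ok dist n L i j by rewrite /elem_ok jn /len i'n hl rank_gt0.
      have /hasP[k kC] := cv emp _ jok; rewrite /cov /len i'n => rk.
      have kn : k < n by apply: (allP hC).
      by exists k => //; rewrite adji // kC orbT.
    have [k kn /andP[ek rk]] := t1 j jn; exists k => //.
    by rewrite adji //= ek (ltn_trans rk hl).
  have deg := degree_cover hC adji; rewrite mul1n in deg.
  have := todo _ i'n dI; rewrite (_ : n < i + ii = false); last by rewrite /i; clear -iin; lia.
  have sC' : size C <= 2 * g * RR by [].
  move=> hg; apply: leq_trans deg _; apply: leq_trans (leq_add t2 sC') _.
  have -> : 2 * g * RR + 2 * g * RR = RR * (4 * g) by ring.
  rewrite [8 * RR]mulnC -mulnA leq_mul2l; apply/orP; right; clear -hg; lia.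
- move=> i' i'n; rewrite dn; case: (eqVneq i' i) => [ei|ne].
    rewrite ei in i'n *; rewrite i'n /= (_ : n < i + ii.+1); last by rewrite /i; clear -iin; lia.
    case: ifP => // /negbT emp _; rewrite ltnNge; apply: contra emp => og.
    by apply: cv'; apply: coverable_opt.
  move=> d; have := todo _ i'n d; rewrite (_ : (n < i' + ii.+1) = (n < i' + ii)) //.
  by move/eqP: ne; rewrite /i; clear -iin; lia.
Qed.

Lemma sum_addn_const (F : nat -> nat) c N :
  \sum_(0 <= i < N) (F i + c) = \sum_(0 <= i < N) F i + c * N.
Proof. by rewrite big_split /= sum_nat_const_nat subn0 [N * c]mulnC. Qed.

(** [B] bounds the part of the cost that is the same for all instances. The term [360 * lg * g] per
    element comes from [15 * lg] rounds of [2 * g] picks at 12 units per uncovered element; it is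
    summed with [sum_n_elems], plus at most [n] elements for the common instance, and
    [g * L <= 3 * n]. *)
Lemma sum_cover_cost :
  \sum_(0 <= ii < n + 1) (cover_cost dist n lg g L M (n - ii) + 3 + 3) <= 100 * (91 * (n * n * (lg * h))).
Proof.
have [_ _ _ gL] := width_bounds.
set X := n * n * (lg * h).
pose A := 15 * n + 17 * (M * L) + 15 * M + 24 * g + 15.
pose B := 15 * n + 15 * (lg * A) + 26.
have p : 0 < lg * h by rewrite muln_gt0 lg_gt0 h_gt0.
have nh : n <= n * h by rewrite leq_pmulr // h_gt0.
have hML : M * L <= 6 * (n * h).
  have -> : M * L = 2 * h * (g * L) by rewrite /M; ring.
  have -> : 6 * (n * h) = 2 * h * (3 * n) by ring.
  by rewrite leq_mul2l gL orbT.
have hM : M <= 4 * (n * h).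
  have -> : 4 * (n * h) = 2 * (2 * n) * h by ring.
  by rewrite /M leq_mul2r leq_mul2l ltnW ?orbT.
have hA : A <= 240 * (n * h).
  by rewrite /A; clear -hML hM nh g_lt n_gt0; lia.
have hlA : lg * A <= 240 * (n * (lg * h)).
  have -> : 240 * (n * (lg * h)) = lg * (240 * (n * h)) by ring.
  by rewrite leq_mul2l hA orbT.
have nlh : n <= n * (lg * h) by rewrite leq_pmulr.
have hB : B <= 3641 * (n * (lg * h)).
  by rewrite /B; clear -hlA nlh n_gt0; lia.
have hnB : (n + 1) * B <= 2 * (3641 * X).
  have -> : 2 * (3641 * X) = 2 * n * (3641 * (n * (lg * h))) by rewrite /X; ring.
  by apply: leq_mul hB; clear -n_gt0; lia.
have hsum : \sum_(0 <= ii < n + 1) n_elems dist n L (n - ii) <= n * L + n.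
  rewrite big_nat_rev /= addn1 add0n big_nat_recr //=.
  apply: leq_add; last by rewrite (leq_trans (count_size _ _)) ?size_iota.
  apply: leq_trans sum_n_elems; rewrite !big_nat; apply: leq_sum => i /= i_n.
  by rewrite (_ : n - (n.+1 - i.+1) = i) // subSS subKn // ltnW.
have hC : 360 * lg * g * (n * L + n) <= 1800 * X.
  have -> : 360 * lg * g * (n * L + n) = 360 * (lg * n) * (g * L + g) by ring.
  have -> : 1800 * X = 360 * (lg * n) * (5 * (n * h)) by rewrite /X; ring.
  by rewrite leq_mul2l; apply/orP; right; clear -gL g_lt nh; lia.
rewrite (eq_bigr (fun ii => B + 360 * lg * g * n_elems dist n L (n - ii))); last first.
  by move=> ii _; rewrite /cover_cost /round_cost /B /A; ring.
rewrite big_split /= sum_nat_const_nat subn0 -big_distrr /=.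
apply: (@leq_trans (2 * (3641 * X) + 1800 * X)).
  by apply: (leq_add hnB); apply: leq_trans hC; rewrite leq_mul2l hsum orbT.
by clearbody X; clear; lia.
Qed.

Lemma guess_spec (psi : R) (m : memory) (phi : R) : (0 <= psi)%R ->
  top_env g m ->
  (1 <= phi)%R \/
  [/\ (psi + eps *+ (RR * n.+1) <= phi)%R,
     forall i, i < n -> m aDone i != 0 -> good_row m i &
     forall i, i < n -> m aDone i = 0 -> g < 2 * maxn 1 (opt i)] ->
  fspec guess m phi guess_cost (fun m' phi' => top_env (2 * g) m' /\
    ((1 <= phi')%R \/
    [/\ (psi <= phi')%R,
       forall i, i < n -> m' aDone i != 0 -> good_row m' i &
       forall i, i < n -> m' aDone i = 0 -> 2 * g < 2 * maxn 1 (opt i)])).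
Proof.
move=> psi0 te hinv; have [[mN mH mG mLg] [hr d0]] := te.
have MW : M < W by have := W_M; nia.
have W0 := ltnW W1.
apply: fspec_le.
  apply: (@fspec_seq _ _ _ _ _ _ _ _ 1); apply: spec_set => /=; rewrite ?mN ?mG; [lia|by do !split; lia|].
  apply: (@fspec_seq _ _ _ _ _ _ _ _ 1); apply: spec_set => /=; rewrite ?updE /= ?mG ?mH -/L -/M.
    lia.
    do !split; lia.
  set m1 := upd (upd _ _ _ _) _ _ _.
  have ag1 : agree [:: vL; vM] m m1 by do 2![apply: agree_upd => //].
  have ge1 : guess_env m1.
    split; last by rewrite /m1 !updE.
    by split; split; rewrite ?ag1 // => j jn y yn; have [r1 r2] := hr _ jn _ yn; rewrite !ag1.
  have hinv1 : guess_inv psi 0 m1 phi.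
    case: hinv => [|[h1 h2 h3]]; [by left|right; split=> //].
    by move=> i i_n; rewrite ag1 // => d; rewrite addn0 ltnNge ltnW //=; apply: h3.
  apply: (@fspec_seq _ _ _ _ _ _ _ _ _ 1).
  pose Inv ii (m2 : memory) phi2 := [/\ m2 vII 0 = ii, guess_env m2 & guess_inv psi ii m2 phi2].
  apply: (@fspec_for _ _ _ _ _ _ _ (n + 1)
    (fun ii => cover_cost dist n lg g L M (n - ii) + 3) Inv).
  - exact: W1.
  - lia.
  - move=> ii m2 phi2 _ [mII [[[mN2 _ _ _] _] _] _]; rewrite /= mII mN2; do !split => //; lia.
  - move=> ii m2 phi2 iin [mII ge2 hinv2].
    have [[[mN2 _ _ _] [_ d2]] _] := ge2.
    rewrite addn1 ltnS in iin.
    apply: fspec_le.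
      apply: (@fspec_seq _ _ _ _ _ _ _ _ 1 (cover_cost dist n lg g L M (n - ii)).+1).
      apply: spec_set => /=; rewrite ?mN2 ?mII; [exact: W0|do !split; lia|].
      set m3 := upd _ _ _ _.
      have ag3 : agree [:: vI] m2 m3 by apply: agree_upd.
      have ge3 : guess_env m3.
        by apply: guess_env_agree ge2; [apply: agree_sub ag3|rewrite ag3].
      have mI3 : m3 vI 0 = n - ii by rewrite /m3 updE.
      have hinv3 : guess_inv psi ii m3 phi2 by exact: hinv2.
      have mII3 : m3 vII 0 = ii by rewrite ag3.
      have next m4 phi4 : agree cover_vars m3 m4 -> m4 aDone n = 0 ->
          guess_inv psi ii.+1 m4 phi4 ->
          m4 vII 0 = ii /\ Inv ii.+1 (upd m4 vII 0 ii.+1) phi4.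
        move=> ag4 d4 hinv4; split; first by rewrite ag4.
        have ag45 : agree [:: vII] m4 (upd m4 vII 0 ii.+1) by apply: agree_upd.
        split; [by rewrite updE| |exact: hinv4].
        apply: guess_env_agree ge3; last by rewrite ag45.
        by apply: agree_trans (agree_sub _ ag4) (agree_sub _ ag45).
      apply: fspec_if => /=; rewrite ?mI3; first by [].
        move=> /eqP d3; apply: fspec_weaken (cover_step psi0 iin ge3 mI3 d3 hinv3) _ (lexx _) (leqnn _).
        by move=> m4 phi4 [ag4 d4 hinv4]; apply: next.
      move=> d3; apply: fspec_le; first apply: (@spec_set _ _ _ _ _ _ _ _ _ 0) => /=; [exact: W0|exact: W0| |].
        apply: next; [by apply: agree_upd|by rewrite updE; case: ge3 => -[_ []]|].
        case: hinv3 => [|[h1 h2 h3 h4]]; [by left|right].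
        have ii_gt0 : 0 < ii.
          by case: (posnP ii) d3 => // ->; rewrite subn0; case: ge3 => -[_ [_ ->]].
        split.
        - by apply: le_trans h1; rewrite lerD2l ler_wpMn2l ?eps_ge0 // leq_mul2l; lia.
        - by move=> _; apply: h2.
        - exact: h3.
        - move=> i i_n; rewrite updE /= => d; have := h4 i i_n d.
          suff -> : (n < i + ii.+1) = (n < i + ii) by [].
          have : i != n - ii by apply/eqP => e; move: d3; rewrite -e [m3 _ _]d.
          clear -iin; lia.
      by rewrite /cover_cost; lia.
    by rewrite addn3 add1n.
  - move=> m2 phi2 [mII ge2 hinv2].
    have [[[mN2 mH2 mG2 mL2] [hr2 d2]] _] := ge2.
    apply: spec_set => /=; rewrite ?mG2; [exact: W0|do !split; lia|].
    split; first by split; split; rewrite ?updE.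
    case: hinv2 => [|[h1 _ h3 h4]]; [by left|right; split].
    - by move: h1; rewrite addn1 subnn muln0 mulr0n addr0.
    - exact: h3.
    - move=> i i_n; rewrite updE /= => d; have := h4 i i_n d.
      have -> : n < i + (n + 1) by lia.
      by rewrite ltn_pmul2l // => hg; apply: leq_trans hg (leq_maxr _ _).
  - split; [by rewrite updE| |exact: hinv1].
    apply: guess_env_agree (ge1); first by apply: agree_upd.
    by rewrite updE; case: ge1 => -[_ []].
have hs : \sum_(0 <= ii < n + 1) (cover_cost dist n lg g L M (n - ii) + 3) + 3 * (n + 1) <=
    100 * (91 * (n * n * (lg * h))) by rewrite -sum_addn_const; exact: sum_cover_cost.
have p : 0 < lg * h by rewrite muln_gt0 lg_gt0 h_gt0.
have p1 : n <= n * n * (lg * h) by rewrite -mulnA leq_pmulr // muln_gt0 n_gt0 p.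
cbv beta; rewrite /guess_cost; move: hs p1.
move: (n * n * (lg * h)) (\sum_(0 <= ii < n + 1) _) => X S hs p1.
by clear -hs p1 n_gt0; lia.
Qed.

End Guess.

(** * Failure and time over all the guesses *)

Lemma eps_le g : 0 < g ->
  (eps R n g (2 * g * h) <= (2 ^+ (2 * lg * kappa.-1))^-1)%R.
Proof.
move=> g0; rewrite /eps -mulrA -expr_div_n.
have -> : (2 / 4 = 2^-1 :> R)%R by field.
rewrite exprVn ler_pdivrMr ?exprn_gt0 ?ltr0n // -[X in (_ <= X)%R]mulrC.
rewrite ler_pdivlMr ?exprn_gt0 ?ltr0n // -!natrX -natrM ler_nat.
(* The factor [2 ^ (2 * g * lg)] absorbs [n.+1 ^ (2 * g)]; the rest of the exponent is smallest at
   [g = 1]. *)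
have -> : 2 * g * h = 2 * g * lg + 2 * g * lg * kappa.-1.
  by rewrite -mulnS prednK // /h mulnA.
rewrite expnD; apply: leq_mul.
  by rewrite [2 * g * lg]mulnC [2 ^ _]expnM leq_exp2r // muln_gt0.
by rewrite leq_exp2l // leq_mul2r leq_mul2r leq_pmulr ?orbT.
Qed.

(** The failure credit of one guess: [RR] rounds for each of the [n + 1] instances, with a bound on
    [eps] that is uniform in [g]. *)
Definition step : R := ((2 ^+ (2 * lg * kappa.-1))^-1 *+ (RR * n.+1))%R.

Definition total_cost : nat := 100 * (100 * (n * n * (lg * lg * lg * kappa))).

Lemma log_loop_spec (m : memory) : m aN 0 = n -> m vP 0 = 1 -> m vLg 0 = 1 ->
  dspec (CWhile (TLt (V vP) (V aN)) (SetV vP (#2 * V vP) ;; SetV vLg (V vLg + #1))) m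
    (lg * 4 + 1) (fun m' => agree [:: vP; vLg] m m' /\ m' vLg 0 = lg).
Proof.
move=> mN mP mLg.
have W0 := ltnW W1.
pose Inv t (m1 : memory) := exists l, [/\ agree [:: vP; vLg] m m1, m1 vP 0 = 2 ^ l,
  m1 vLg 0 = l.+1 & l + t = lg] /\ (l <= up_log 2 n /\ 2 ^ l < 2 * n).
apply: (@dspec_while _ _ _ _ _ _ Inv).
- by move=> t m1 _ /=.
- move=> t m1 [l [[ag eP eL elt] [lu l2]]] /=; rewrite eP ag // mN => ln.
  have lu' : l < up_log 2 n.
    by rewrite ltnNge; apply/negP => ul; have := up_logP n (isT : 1 < 2);
       rewrite leqNgt (leq_ltn_trans _ ln) // leq_exp2l.
  exists t.-1; first by move: elt lu'; rewrite lgE; clear; lia.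
  apply: (@dspec_seq _ _ _ _ _ _ _ 1 1).
  apply: dspec_set => /=; rewrite ?eP; [exact: W0|by do !split; lia|].
  apply: dspec_set; rewrite /= ?updE /= ?eL; [exact: W0| |].
    have ll : l < 2 ^ l by apply: ltn_expl.
    by do !split => //; lia.
  exists l.+1; rewrite !updE /= expnS addn1; split; split=> //.
  + by do 2![apply: agree_upd => //].
  + by move: elt lu'; rewrite lgE; clear; lia.
  + by rewrite ltn_pmul2l.
- move=> t m1 [l [[ag eP eL elt] [lu l2]]] /=; rewrite eP ag // mN -leqNgt => nl.
  split=> //; rewrite eL lgE; congr _.+1; apply/eqP; rewrite eqn_leq lu.
  exact: up_log_min.
- exists 0; split; split=> //; first by lia.
Qed.

Lemma build_graph_spec (m : memory) (phi : R) :
  m aN 0 = n -> (forall z, m aDone z = 0) -> (step *+ lg <= phi)%R ->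
  fspec (build_graph kappa) m phi total_cost (fun m' phi' =>
    (1 <= phi')%R \/ (0 <= phi')%R /\ forall i, i < n -> good_row m' i).
Proof.
move=> mN mD hphi; have W0 := ltnW W1.
have h_gt0 : 0 < h by rewrite muln_gt0 lg_gt0.
have hW : h < W by have := W_samples; rewrite /h; nia.
have step0 : (0 <= step)%R by rewrite mulrn_wge0 // invr_ge0 exprn_ge0 ?ler0n.
(* At most [t] guesses remain, each with a credit [step]. Starting from [g = 1], the value [t = lg]
   is enough since [2 * n <= 2 ^ lg]. *)
pose Inv t (m1 : memory) (phi1 : R) := exists g, [/\ 0 < g, top_env g m1, 2 * n <= g * 2 ^ t &
  (1 <= phi1)%R \/ [/\ (step *+ t <= phi1)%R,
     forall i, i < n -> m1 aDone i != 0 -> good_row m1 i &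
     forall i, i < n -> m1 aDone i = 0 -> g < 2 * maxn 1 (opt i)]].
apply: fspec_le.
  apply: fspec_seq; apply: (dspec_fspec (sort_rows_spec n_gt0 W_big dist_total n_lg mN n_lg1)).
  move=> m1 [ag1 hr].
  apply: (@fspec_seq _ _ _ _ _ _ _ _ 1); apply: spec_set => /=; [exact: W0|exact: W1|].
  apply: (@fspec_seq _ _ _ _ _ _ _ _ 1); apply: spec_set => /=; [exact: W0|exact: W1|].
  set m2 := upd (upd _ _ _ _) _ _ _.
  have ag2 : agree [:: vP; vLg] m1 m2 by do 2![apply: agree_upd => //].
  have mN2 : m2 aN 0 = n by rewrite ag2 // ag1.
  apply: fspec_seq; apply: (dspec_fspec (log_loop_spec mN2 _ _)); rewrite /m2 ?updE //.
  rewrite -/m2 => m3 [ag3 mLg3].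
  have ag13 : agree [:: vP; vLg] m1 m3 by apply: agree_trans ag2 ag3.
  apply: (@fspec_seq _ _ _ _ _ _ _ _ 1); apply: spec_set => /=; rewrite ?mLg3; [exact: W0|by do !split|].
  apply: (@fspec_seq _ _ _ _ _ _ _ _ 1); apply: spec_set => /=; [exact: W0|exact: W1|].
  set m4 := upd (upd _ _ _ _) _ _ _.
  have ag4 : agree [:: vH; vG] m3 m4 by do 2![apply: agree_upd => //].
  have ag14 : agree [:: vP; vLg; vH; vG] m1 m4.
    by apply: agree_trans (agree_sub _ ag13) (agree_sub _ ag4).
  apply: (@fspec_while _ _ _ _ _ _ Inv lg guess_cost).
  - move=> t m5 phi5 [g [_ te _ _]] /=; have [[mN5 _ _ _] _] := te; rewrite mN5.
    split=> //; split=> //; lia.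
  - move=> t m5 phi5 [g [g0 te gt hinv]] /=.
    have [[mN5 _ mG5 _] _] := te.
    rewrite mN5 mG5 => gn; case: t gt hinv => [|t] gt hinv; first by move: gt gn; rewrite expn0; clear; lia.
    exists t => //.
    have psi0 : (0 <= step *+ t)%R by rewrite mulrn_wge0.
    apply: fspec_weaken (guess_spec g0 gn psi0 te _) _ (lexx _) (leqnn _).
      case: hinv => [|[h1 h2 h3]]; [by left|right; split=> //].
      apply: le_trans h1; rewrite mulrSr lerD2l /step.
      by rewrite ler_wMn2r ?eps_le.
    move=> m6 phi6 [te6 q6]; exists (2 * g); split=> //; first by rewrite muln_gt0.
    by rewrite -mulnA mulnCA -expnS.
  - move=> t m5 phi5 [g [g0 te gt hinv]] /=.
    have [[mN5 _ mG5 _] _] := te.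
    rewrite mN5 mG5 -leqNgt => gn.
    case: hinv => [|[h1 h2 h3]]; [by left|right; split].
      by apply: le_trans h1; rewrite mulrn_wge0.
    (* At the exit [2 * n <= g], whereas an unsettled row would give
       [g < 2 * maxn 1 (opt i) <= 2 * n]. *)
    move=> i i_n; apply: h2 => //; apply/negP => /eqP /(h3 i i_n).
    have : opt i <= n by rewrite (leq_trans (count_size _ _)) ?size_iota.
    by move: gn n_gt0; clear; lia.
  - exists 1; split=> //.
    + split; split.
      * by rewrite ag14 ?ag1.
      * by rewrite /m4 !updE.
      * by rewrite /m4 !updE.
      * by rewrite ag4.
      * by move=> j jn y yn; have [r1 r2] := hr _ jn _ yn; rewrite !ag14.
      * by rewrite ag14 ?ag1.
    + rewrite mul1n -(prednK lg_gt0) expnS leq_mul2l.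
      exact: n_lg1.
    + right; split=> // i i_n.
      * by rewrite ag14 ?ag1 // mD.
      * by move=> _; rewrite mul2n -addnn; have := leq_maxl 1 (opt i); clear; lia.
rewrite /total_cost; set X := n * n * (lg * lg * lg * kappa).
have n2 : 0 < n * n by rewrite muln_gt0 n_gt0.
have l3 : 0 < lg * lg * lg * kappa by rewrite !muln_gt0 lg_gt0.
have X1 : n * n <= X by rewrite leq_pmulr.
have X2 : n <= X by apply: leq_trans X1; rewrite leq_pmulr.
have X3 : lg <= X.
  apply: leq_trans (leq_pmull _ n2); rewrite -!mulnA leq_pmulr // !muln_gt0 lg_gt0.
  exact: kappa_gt0.
have X4 : n * n * (lg * lg) <= X.
  by rewrite leq_mul2l -mulnA leq_pmulr ?orbT // muln_gt0 lg_gt0.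
have X5 : n * n * lg <= n * n * (lg * lg) by rewrite leq_mul2l leq_pmulr ?orbT.
have -> : n * (n * lg * (lg * 5 + 40) + 3) + 3 = 5 * (n * n * (lg * lg)) + 40 * (n * n * lg) + 3 * n + 3.
  by ring.
have -> : lg * guess_cost.+1 = 100 * (92 * X) + lg.
  by rewrite mulnS addnC /guess_cost /X /h; congr (_ + _); ring.
clearbody X; move: X1 X2 X3 X4 X5; move: (n * n * (lg * lg)) (n * n * lg) => Y Z.
by clear -n_gt0; lia.
Qed.

End Build.

(** * Numerical bounds and the theorem *)

Section Bounds.
Local Open Scope nat_scope.
Variables (n kappa : nat).
Hypothesis n_gt0 : 0 < n.
Let lg := (up_log 2 n).+1.
Let W := word_bound (kappa + 7) n.

Lemma lt_exp_lg : n < 2 ^ lg.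
Proof.
rewrite expnS mul2n -addnn; have := up_logP n (isT : 1 < 2).
by move: n_gt0; clear; lia.
Qed.

Lemma word_boundE : W = 2 ^ (kappa * lg) * 2 ^ (8 * lg).
Proof. by rewrite /W /word_bound -expnD -mulnDl -addnS. Qed.

(** [2 ^ lg] dominates [n + 1] and [lg], and [2 ^ (kappa * lg)] dominates [kappa]. The word size
    leaves eight further factors [2 ^ lg], four of which already exceed the constants. *)
Lemma word_bounds : [/\ 16 * (n + 1) * (n + 1) <= W,
  (n + 1) * (4 * n * (lg * kappa) + 1) <= W, 15 * lg < W & kappa < W].
Proof.
have nl : n + 1 <= 2 ^ lg by rewrite addn1; exact: lt_exp_lg.
have ll : lg < 2 ^ lg by apply: ltn_expl.
have two : 2 <= 2 ^ lg by rewrite -[X in X <= _]expn1 leq_exp2l.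
have kk : kappa < 2 ^ (kappa * lg).
  by apply: leq_trans (ltn_expl kappa (isT : 1 < 2)) _; rewrite leq_exp2l // leq_pmulr.
rewrite word_boundE [8 * lg]mulnC [2 ^ (lg * 8)]expnM.
move: (2 ^ lg) (2 ^ (kappa * lg)) nl ll two kk => x y nl ll two kk.
have y1 : 0 < y by apply: leq_ltn_trans kk.
have x1 : 0 < x by apply: leq_trans two.
have x16 : 16 <= x ^ 4 by apply: (@leq_trans (2 ^ 4)) => //; rewrite leq_exp2r.
have x4 : x ^ 4 <= x ^ 6 by rewrite leq_exp2l.
have h1 : 16 * (n + 1) * (n + 1) <= x ^ 6.
  rewrite -mulnA (_ : x ^ 6 = x ^ 4 * (x * x)); last by rewrite mulnA -!expnSr.
  by apply: leq_mul => //; apply: leq_mul.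
have xy z : z <= x ^ 6 -> z <= y * x ^ 8.
  move=> zx; apply: leq_trans (leq_pmull _ y1).
  by apply: leq_trans zx _; rewrite leq_exp2l.
split.
- exact: xy.
- have -> : y * x ^ 8 = x * (y * (x ^ 3 * (x ^ 4))) by rewrite !expnS expn0; ring.
  apply: leq_mul => //; rewrite addn1.
  apply: (@leq_ltn_trans (y * (4 * (x * x)))).
    have -> : 4 * n * (lg * kappa) = kappa * (4 * (n * lg)) by ring.
    apply: leq_mul; first exact: ltnW.
    rewrite leq_mul2l /=; apply: leq_mul; [exact: leq_trans (leq_addr _ _) nl|exact: ltnW].
  rewrite ltn_pmul2l // mulnA.
  have -> : x ^ 3 * x ^ 4 = (x ^ 4 * x) * (x * x) by rewrite !expnS expn0; ring.
  by rewrite -mulnA ltn_mul2r muln_gt0 x1 /=; move: x16 x1; clear; nia.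
- apply: xy; apply: (@leq_trans (16 * x)); first by move: ll; clear; lia.
  apply: (@leq_trans (x ^ 4 * x)); first by rewrite leq_mul2r x16 orbT.
  by rewrite -expnSr leq_exp2l.
- apply: leq_trans kk _; rewrite leq_pmulr // expn_gt0 x1 //.
Qed.

(** Rounds, instances, guesses and the target [n ^ c]. With [x = 2 ^ lg] the product is at most
    [x ^ (c + 7)], as 15 is below [x ^ 4], and the right-hand side is [x ^ (2 * c + 8)]; this is
    what the choice [kappa = c + 5] relies on. *)
Lemma failure_bound c : 15 * lg * n.+1 * lg * n ^ c <= 2 ^ (2 * lg * (c + 4)).
Proof.
have nl : n + 1 <= 2 ^ lg by rewrite addn1; exact: lt_exp_lg.
have ll : lg <= 2 ^ lg by apply/ltnW/ltn_expl.
have two : 2 <= 2 ^ lg by rewrite -[X in X <= _]expn1 leq_exp2l.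
have -> : 2 * lg * (c + 4) = lg * (2 * (c + 4)) by ring.
rewrite [2 ^ (lg * _)]expnM; move: (2 ^ lg) nl ll two => x nl ll two.
have x1 : 0 < x by apply: leq_trans two.
apply: (@leq_trans (x ^ 4 * x * x * x * x ^ c)); last first.
  by rewrite -!expnSr -expnD leq_exp2l //; clear; lia.
apply: leq_mul; last by case: (c) => // c1; rewrite leq_exp2r // (leq_trans (leq_addr 1 n)).
apply: leq_mul => //; apply: leq_mul; last by rewrite -addn1.
apply: leq_mul => //; apply: (@leq_trans (2 ^ 4)) => //.
by rewrite leq_exp2r.
Qed.

End Bounds.

(** * From memories to graphs *)

Section Correctness.
Variables (R : realType) (n : nat) (d : 'I_n -> 'I_n -> R).
Hypotheses (n_gt0 : (0 < n)%N) (dist_d : distance_function d) (gen_d : general_position d).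

Let lg := (up_log 2 n).+1.

Lemma oracleE (i j : 'I_n) : oracle d i j = d i j.
Proof. by rewrite /oracle !valK. Qed.

Lemma oracle_total j x y : (j < n)%N -> (x < n)%N -> (y < n)%N -> x != y ->
  oracle d j x != oracle d j y.
Proof.
move=> jn xn yn ne.
by rewrite (oracleE (Ordinal jn) (Ordinal xn)) (oracleE (Ordinal jn) (Ordinal yn)) gen_d.
Qed.

Lemma oracle_self j x : (j < n)%N -> (x < n)%N -> x != j -> closer (oracle d) j j x.
Proof.
move=> jn xn ne; have [d0 _ dpos] := dist_d; rewrite /closer.
rewrite (oracleE (Ordinal jn) (Ordinal jn)) (oracleE (Ordinal jn) (Ordinal xn)) d0.
by apply: dpos; rewrite -val_eqE /= eq_sym.
Qed.

(** Ranks compare distances from [j] while navigability compares distances to [j]; the symmetry of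
    [d] identifies them. *)
Lemma rank_closer (i j k : 'I_n) :
  (rank (oracle d) n j k < rank (oracle d) n j i)%N = (d k j < d i j).
Proof.
have [_ dC _] := dist_d.
rewrite /rank (@count_ltE _ n (closer_irr _ j) (@closer_trans _ _ j)
  (fun x y => closer_total oracle_total (ltn_ord j))) ?mem_iota ?ltn_ord //.
  by rewrite /closer !oracleE dC [d i j]dC.
by move=> z; rewrite mem_iota.
Qed.

Definition nat_edge (H : digraph n) (i k : nat) : bool :=
  if (insub i : option 'I_n, insub k : option 'I_n) is (Some a, Some b) then (a, b) \in H
  else false.

Lemma nat_edgeE H (i k : 'I_n) : nat_edge H i k = ((i, k) \in H).
Proof. by rewrite /nat_edge !valK. Qed.

Lemma count_outdeg (H : digraph n) (f : nat -> bool) (i : 'I_n) :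
  (forall k : 'I_n, f k = ((i, k) \in H)) -> count f (iota 0 n) = outdeg H i.
Proof.
move=> hf; rewrite /outdeg -val_enum_ord count_map cardE -size_filter.
rewrite /enum_mem -filter_predI; congr size; apply: eq_filter => k /=.
by rewrite !inE andbT hf.
Qed.

Lemma nat_edge_nav (H : digraph n) : navigable d H ->
  forall i j, (i < n)%N -> (j < n)%N -> i != j ->
  exists2 k, (k < n)%N &
    nat_edge H i k && (rank (oracle d) n j k < rank (oracle d) n j i)%N.
Proof.
move=> /forallP nav i j i_n jn ne.
have := nav (Ordinal i_n) => /forallP/(_ (Ordinal jn))/implyP/(_ ne)/existsP[k /andP[kH kd]].
exists k; first exact: ltn_ord.
have := rank_closer (Ordinal i_n) (Ordinal jn) k; rewrite /= => ->; rewrite kd andbT.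
by have := nat_edgeE H (Ordinal i_n) k; rewrite /= => ->.
Qed.

Definition mem_graph (m : memory) : digraph n := output_graph n (mem_state R m).

Lemma good_rows_graph (H : digraph n) (m : memory) : navigable d H ->
  (forall i, (i < n)%N -> good_row (oracle d) n lg (nat_edge H) m i) ->
  navigable d (mem_graph m) /\
  forall i : 'I_n, (outdeg (mem_graph m) i <= 8 * (15 * lg) * maxn 1 (outdeg H i))%N.
Proof.
move=> navH good; split.
  apply/forallP => i; apply/forallP => j; apply/implyP => ne.
  have [nav _] := good i (ltn_ord i).
  have [k kn /andP[ek rk]] := nav j (ltn_ord j) ne.
  apply/existsP; exists (Ordinal kn); rewrite inE /= -rank_closer rk andbT.
  exact: ek.
move=> i; have [_ deg] := good i (ltn_ord i).
rewrite /degree (@count_outdeg (mem_graph m) _ i) in deg; last by move=> k; rewrite inE.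
rewrite /opt (@count_outdeg H _ i) in deg; last by move=> k; rewrite nat_edgeE.
exact: deg.
Qed.

(** [H] only enters the analysis, as the graph to which the rows are compared. [P] is left abstract
    so that it can be any property implied by good rows. *)
Lemma run_build_graph (c : nat) (H : digraph n) (P : digraph n -> bool) :
  navigable d H ->
  (forall m, (forall i, (i < n)%N -> good_row (oracle d) n lg (nat_edge H) m i) ->
     P (mem_graph m)) ->
  let K := (c + 5 + 7)%N in let T := total_cost n lg (c + 5) in
  halts_within K (build_graph (c + 5)) d T /\
  1 - 1 / n%:R ^+ c <= Pr_output K (build_graph (c + 5)) d T P.
Proof.
move=> navH hP K T.
have [w1 w2 w3 w4] := word_bounds (c + 5) n_gt0.
have n_lg := lt_exp_lg n_gt0.
have n_lg1 : (n <= 2 ^ (up_log 2 n).+1.-1)%N by apply: up_logP.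
pose m0 : memory := upd (fun _ _ => 0%N) 0 0 n.
have mD z : m0 aDone z = 0%N by [].
have hstep : step R n lg (c + 5) *+ lg <= 1 / n%:R ^+ c.
  rewrite /step -mulrnA -[X in X <= _]mulr_natl ler_pdivlMr ?exprn_gt0 ?ltr0n //.
  rewrite mulrAC ler_pdivrMr ?exprn_gt0 ?ltr0n // mul1r -!natrX -natrM ler_nat.
  by rewrite [(c + 5)%N]addnS; apply: failure_bound.
have kappa_gt0 : (0 < c + 5)%N by rewrite addnS.
have := build_graph_spec (E := fun m => P (mem_graph m)) n_gt0 w1 w2 w3 w4 oracle_total
  oracle_self kappa_gt0 (ltn0Sn _) n_lg n_lg1 (erefl lg) (nat_edge_nav navH) (m := m0)
  (erefl n) mD hstep.
move=> /spec_ok /(_ _)/(_ T (leqnn _)); apply.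
move=> m phi _ [h1|[h0 good]]; [by right|left; split=> //].
exact: hP.
Qed.

End Correctness.

(** The left factor is [(up_log 2 n).-1 + 2], where [2 ^ (up_log 2 n).-1 < n] and [2 <= n] give one
    and two times [ln n]. *)
Lemma up_log_ln (R : realType) (n : nat) : (1 < n)%N ->
  (up_log 2 n).+1%:R * ln 2 <= 3 * ln n%:R :> R.
Proof.
move=> n1; have n0 : (0 < n)%N by apply: ltnW.
have h2 : ln 2 <= ln n%:R :> R by rewrite ler_ln ?posrE ?ltr0n // ler_nat.
have h1 : (up_log 2 n).-1%:R * ln 2 <= ln n%:R :> R.
  rewrite mulr_natl -lnXn ?ltr0n // ler_ln ?posrE ?exprn_gt0 ?ltr0n //.
  by rewrite -natrX ler_nat ltnW // up_log_gtn.
have u0 : (0 < up_log 2 n)%N by rewrite up_log_gt0.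
rewrite -(prednK u0) -2!natr1; move: h1; set u := _%:R => h1; lra.
Qed.

Theorem theorem1p2 (R : realType) :
  exists (c : R) (c' : nat), forall c'' : nat,
  exists (prog : cmd) (K : nat) (T : nat -> nat),
    soft_O R c' T (fun n => n ^ 2)%N /\
    forall (n : nat) (d : 'I_n -> 'I_n -> R),
      (0 < n)%N -> distance_function d -> general_position d ->
      halts_within K prog d (T n) /\
      forall H : digraph n, sparsest_navigable d H ->
        1 - 1 / n%:R ^+ c'' <=
        Pr_output K prog d (T n) (fun G =>
          navigable d G &&
          (avg_outdeg R G <= c * ln (n%:R : R) * avg_outdeg R H)).
Proof.
have ln2 : 0 < ln 2 :> R by rewrite ln_gt0 // ltr1n.
(* Out-degrees grow by a factor at most [8 * (15 * lg) = 120 * lg], and [lg * ln 2 <= 3 * ln n]. The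
   exponent 3 is that of [lg] in [total_cost]. *)
exists (360 / ln 2), 3%N => c.
exists (build_graph (c + 5)), (c + 5 + 7)%N, (fun n => total_cost n (up_log 2 n).+1 (c + 5)).
split.
  exists (100%:R * (100%:R * (c + 5)%:R) * (3 / (2 * ln 2)) ^+ 3), 2%N => n n2; cbv beta.
  set lg := (up_log 2 n).+1.
  (* The factor 2 in the denominator compensates [ln (n ^ 2) = 2 * ln n]. *)
  have hlg : lg%:R <= 3 / (2 * ln 2) * ln ((n ^ 2)%N%:R : R).
    have := up_log_ln R n2; rewrite natrX lnXn ?ltr0n; last exact: ltnW.
    rewrite -/lg => h.
    have -> : 3 / (2 * ln 2) * (ln n%:R *+ 2) = 3 * ln n%:R / ln 2 :> R.
      by rewrite -mulr_natr; field; rewrite gt_eqF.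
    by rewrite ler_pdivlMr.
  have -> : total_cost n lg (c + 5) = (100 * (100 * (c + 5)) * n ^ 2 * lg ^ 3)%N.
    by rewrite /total_cost; ring.
  rewrite natrM [(100 * _ * _)%N%:R]natrM [(100 * _)%N%:R]natrM [(100 * (c + 5))%N%:R]natrM.
  rewrite [(lg ^ 3)%N%:R]natrX; move: hlg; set l := ln _; set a := 3 / _ => hlg.
  rewrite mulrAC [X in _ <= X]mulrAC -[X in _ <= X * _]mulrA -exprMn ler_wpM2r ?ler0n //.
  rewrite ler_wpM2l ?mulr_ge0 ?ler0n //.
  by rewrite lerXn2r // ?nnegrE ?ler0n // (le_trans _ hlg) // ler0n.
move=> n d n_gt0 dist_d gen_d; split.
  (* Termination is obtained from the same specification, with the complete graph as the graph of
     comparison. *)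
  have nav : navigable d setT.
    apply/forallP => i; apply/forallP => j; apply/implyP => ne.
    have [d0 _ dpos] := dist_d.
    by apply/existsP; exists j; rewrite inE d0 dpos.
  by have [] := run_build_graph n_gt0 dist_d gen_d c (P := predT) nav (fun _ _ => isT).
move=> H [navH _].
(* For [n = 1] the required probability is 0. *)
have [n1|n1] := leqP n 1.
  have -> : 1 - 1 / n%:R ^+ c = 0 :> R.
    have -> : n = 1%N by apply/eqP; rewrite eqn_leq n1.
    by rewrite expr1n divr1 subrr.
  exact: Pr_ge0.
apply: (proj2 (run_build_graph n_gt0 dist_d gen_d c navH _)) => m good.
have [-> /= deg] := good_rows_graph dist_d gen_d navH good.
(* With at least two points every out-degree of a navigable graph is positive, which removes the
   [maxn 1]. *)
have deg_gt0 (i : 'I_n) : (0 < outdeg H i)%N.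
  have [j ne] : exists j : 'I_n, i != j.
    by case: (eqVneq i (Ordinal n_gt0)) => [->|ne]; [exists (Ordinal n1)|exists (Ordinal n_gt0)].
  have /forallP/(_ i)/forallP/(_ j)/implyP/(_ ne)/existsP[k /andP[ik _]] := navH.
  by rewrite /outdeg card_gt0; apply/set0Pn; exists k; rewrite inE.
rewrite /avg_outdeg mulrA ler_wpM2r ?invr_ge0 ?ler0n // mulr_sumr; apply: ler_sum => i _.
apply: (@le_trans _ _ ((120 * (up_log 2 n).+1 * outdeg H i)%N%:R)).
  rewrite ler_nat; apply: leq_trans (deg i) _.
  by rewrite (maxn_idPr (deg_gt0 i)) leq_mul2r; apply/orP; right; clear; lia.
rewrite natrM ler_wpM2r ?ler0n // natrM.
rewrite -mulrA [_^-1 * _]mulrC mulrA ler_pdivlMr //.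
by have := up_log_ln R n1; lra.
Qed.
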